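(* Assume (A1$_+$), (A2), (A3), (A4) and (A5) (listed in the context). Then for all data $u_1\in H^1(\mathbb R^n)$, $u_2\in L^2(\mathbb R^n)$ with $(u_1,u_2)\neq(0,0)$ there exists a constant $C>0$ (depending on the data) such that the solution $u(t,x)$ of the Cauchy problem $$u_{tt}-a^2(t)\Delta u=0,\qquad u(0,\cdot)=u_1,\qquad \mathrm D_t u(0,\cdot)=u_2,$$ satisfies, for all $t\ge0$, $$\mathbb E_\lambda(t;u)\ge C\,\lambda(t).$$
   Context: Notation: $\mathrm D_t=-\mathrm i\partial_t$, $\Delta=\sum_j\partial_{x_j}^2$ on $\mathbb R^n$, $\mathbb R_+=[0,\infty)$. For positive functions $f,g$: $f\lesssim g$ means $f\le Cg$ for some constant $C$ and all arguments; $f\gtrsim g$ means $g\lesssim f$; $f\approx g$ means both; $f\ll g$ means $f/g\le c<1$ for some constant $c$. Setting: $m\ge 2$ is an integer, $a\in C^m(\mathbb R_+)$ is written as $a(t)=\lambda(t)\omega(t)$ with real-valued $\lambda\in C^2(\mathbb R_+)$ and $\omega$; $\Lambda(t)=1+\int_0^t\lambda(s)\,\mathrm ds$; $\Theta(t)$ and $\Xi(t)$ are positive functions. The adapted energy is $\mathbb E_\lambda(t;u)=\frac12\int_{\mathbb R^n}\big(\lambda^2(t)|\nabla u(t,x)|^2+|u_t(t,x)|^2\big)\,\mathrm dx$. Assumptions: (A1) $\lambda(t)>0$, $\lambda'(t)>0$, $\lambda'(t)\approx\lambda(t)\frac{\lambda(t)}{\Lambda(t)}$ and $|\lambda''(t)|\lesssim\lambda(t)\left(\frac{\lambda(t)}{\Lambda(t)}\right)^2$.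 (A1$_+$) (A1) holds and in addition $t\sqrt{\lambda(t)}\lesssim\Lambda(t)$. (A2) $0<c_1\le\omega(t)\le c_2$ for constants $c_1,c_2$. (A3) $\int_0^t\lambda(s)|\omega(s)-1|\,\mathrm ds\lesssim\Theta(t)\ll\Lambda(t)$ as $t\to\infty$. (A4) $\left|\frac{\mathrm d^k}{\mathrm dt^k}a(t)\right|\lesssim\lambda(t)\,\Xi^{-k}(t)$ for $k=1,2,\dots,m$, where $\lambda(t)\Xi(t)\gtrsim\Theta(t)$. (A5) $\int_t^\infty\lambda^{1-m}(s)\,\Xi^{-m}(s)\,\mathrm ds\lesssim\Theta^{1-m}(t)$. *)

(* Defs.v *)
From HB Require Import structures.
From mathcomp Require Import all_boot all_order all_algebra.
From mathcomp Require Import all_classical all_reals all_analysis.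
From mathcomp Require Import complex.

Set Implicit Arguments.
Unset Strict Implicit.
Unset Printing Implicit Defensive.
Import Order.TTheory GRing.Theory Num.Theory.
Import numFieldNormedType.Exports.
Import ComplexField.
Local Open Scope classical_set_scope.
Local Open Scope ring_scope.

Definition rV_display : measure_display -> measure_display.
Proof. exact. Qed.

Section measurable_rV.
Context {R : realType}.
Variable n : nat.

Let coord (i : 'I_n) (v : 'rV[R]_n) : R := v ord0 i.

Let rV_set0 : g_sigma_preimage coord set0.
Proof. exact: sigma_algebra0. Qed.

Let rV_setC A : g_sigma_preimage coord A -> g_sigma_preimage coord (~` A).
Proof. exact: sigma_algebraC. Qed.

Let rV_bigcup (F : _^nat) : (forall i, g_sigma_preimage coord (F i)) ->
  g_sigma_preimage coord (\bigcup_i (F i)).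
Proof. exact: sigma_algebra_bigcup. Qed.

HB.instance Definition _ :=
  @isMeasurable.Build (rV_display default_measure_display)
    'rV[R]_n (g_sigma_preimage coord) rV_set0 rV_setC rV_bigcup.

End measurable_rV.

Lemma measurable_rV_coord (R : realType) n (i : 'I_n) :
  measurable_fun [set: 'rV[R]_n] (fun v => v ord0 i : measurableTypeR R).
Proof.
move=> _ Y mY; rewrite setTI; apply: sub_sigma_algebra => /=.
rewrite -bigcup_seq/=; exists i => /=; first by rewrite mem_index_enum.
by exists Y => //; rewrite setTI.
Qed.

Lemma measurable_fun_rV (R : realType) d (T : measurableType d) n
    (f : T -> 'rV[R]_n) :
  (forall i, measurable_fun setT (fun x => f x ord0 i : measurableTypeR R)) ->
  measurable_fun setT f.
Proof.
move=> mf.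
pose c (i : 'I_n) (v : 'rV[R]_n) : measurableTypeR R := v ord0 i.
have H : g_sigma_preimage (fun i => c i \o f) `<=` measurable.
  apply: smallest_sub; first exact: sigma_algebra_measurable.
  case: n => [|n] in f mf c *; first by rewrite big_ord0.
  rewrite -bigcup_mkord_ord; apply: bigcup_sub => i Ii.
  by move=> A [B mB <-]; exact: mf.
rewrite g_sigma_preimage_comp in H.
by move=> _ A mA; apply: H; exists A.
Qed.

Section lebesgue_rV.
Context {R : realType}.

(* [R * R^n ~ R^(n+1)]; the measure on [R^(n+1)] is the image under it of the
   product of the measures on [R] and [R^n]. *)
Definition rV_cons n (p : measurableTypeR R * 'rV[R]_n) : 'rV[R]_n.+1 :=
  \row_j oapp (p.2 ord0) p.1 (unlift ord0 j).

Let rV_uncons n (v : 'rV[R]_n.+1) : measurableTypeR R * 'rV[R]_n :=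
  (v ord0 ord0, \row_j v ord0 (lift ord0 j)).

Let rV_consK n : cancel (@rV_cons n) (@rV_uncons n).
Proof.
move=> [x v]; rewrite /rV_cons /rV_uncons /= mxE unlift_none; congr (_, _).
by apply/rowP => j; rewrite !mxE liftK.
Qed.

Let measurable_rV_cons n : measurable_fun setT (@rV_cons n).
Proof.
apply: measurable_fun_rV => i.
case: (unliftP ord0 i) => [j|] ->.
  rewrite [X in measurable_fun _ X]
    (_ : _ = (fun v : 'rV[R]_n => v ord0 j : measurableTypeR R) \o snd).
    by apply: measurableT_comp => //; exact: measurable_rV_coord.
  by apply/funext => x; rewrite /rV_cons mxE liftK.
rewrite [X in measurable_fun _ X](_ : _ = fst) //.
by apply/funext => x; rewrite /rV_cons mxE unlift_none.
Qed.

Let measurable_rV_uncons n : measurable_fun setT (@rV_uncons n).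
Proof.
apply/measurable_fun_pairP; split => /=; first exact: measurable_rV_coord.
apply: measurable_fun_rV => i.
rewrite [X in measurable_fun _ X](_ : _ =
  (fun v : 'rV[R]_n.+1 => v ord0 (lift ord0 i) : measurableTypeR R)).
  exact: measurable_rV_coord.
by apply/funext => v; rewrite /= mxE.
Qed.

Section step.
Variable n : nat.
Variable mu : {sigma_finite_measure set 'rV[R]_n -> \bar R}.

Definition lebesgue_rV_step : set 'rV[R]_n.+1 -> \bar R :=
  pushforward (product_measure1 (@lebesgue_measure R) mu) (@rV_cons n).

Let step0 : lebesgue_rV_step set0 = 0%E.
Proof. by rewrite /lebesgue_rV_step /pushforward preimage_set0 measure0. Qed.

Let step_ge0 A : (0 <= lebesgue_rV_step A)%E.
Proof. exact: (measure_ge0 (product_measure1 (@lebesgue_measure R) mu)). Qed.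

Let step_sigma_additive : semi_sigma_additive lebesgue_rV_step.
Proof.
move=> F mF tF mUF; rewrite /lebesgue_rV_step /pushforward preimage_bigcup.
have mcons A : measurable A -> measurable (@rV_cons n @^-1` A).
  by move=> mA; rewrite -[X in measurable X]setTI; exact: measurable_rV_cons.
apply: measure_semi_sigma_additive.
- by move=> k; exact: mcons.
- apply/trivIsetP => /= i j _ _ ij; rewrite -preimage_setI.
  by move/trivIsetP : tF => /(_ _ _ _ _ ij) ->//; rewrite preimage_set0.
- by rewrite -preimage_bigcup; exact: mcons.
Qed.

HB.instance Definition _ :=
  isMeasure.Build _ _ _ lebesgue_rV_step step0 step_ge0 step_sigma_additive.

Let step_sigma_finite : sigma_finite setT lebesgue_rV_step.
Proof.
have /sigma_finiteP[F [FT ndF Foo]] := sigma_finiteT (@lebesgue_measure R).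
have /sigma_finiteP[G [GT ndG Goo]] := sigma_finiteT mu.
exists (fun k => @rV_uncons n @^-1` (F k `*` G k)) => [|k].
  rewrite -preimage_bigcup (_ : \bigcup_k _ = setT) ?preimage_setT //.
  rewrite -subTset => -[x y] _.
  have [i _ Fx] : (\bigcup_k F k) x by rewrite -FT.
  have [j _ Gy] : (\bigcup_k G k) y by rewrite -GT.
  exists (maxn i j) => //; split => /=.
    by move: x Fx; exact/subsetPset/ndF/leq_maxl.
  by move: y Gy; exact/subsetPset/ndG/leq_maxr.
have [mF ltF] := Foo k; have [mG ltG] := Goo k; split.
  rewrite -[X in measurable X]setTI.
  by apply: measurable_rV_uncons => //; exact: measurableX.
rewrite /lebesgue_rV_step /pushforward -comp_preimage.
rewrite (_ : _ \o _ = id); last by rewrite funeqE => p; exact: rV_consK.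
by rewrite product_measure1E// lte_mul_pinfty// ge0_fin_numE.
Qed.

HB.instance Definition _ :=
  Measure_isSigmaFinite.Build _ _ _ lebesgue_rV_step step_sigma_finite.

End step.

Fixpoint lebesgue_rV n : {sigma_finite_measure set 'rV[R]_n -> \bar R} :=
  match n with
  | 0 => dirac (0 : 'rV[R]_0)
  | n'.+1 => lebesgue_rV_step (lebesgue_rV n')
  end.

End lebesgue_rV.
Arguments lebesgue_rV R n : clear implicits.

Section half_line.
Context {R : realType}.
Implicit Types (f g : R -> R) (t : R).

(* Increments [h] with [h != 0] and [t + h] still in [R_+]: all derivatives and
   limits below are one-sided at [t = 0] and ignore values at negative times. *)
Definition hl_incr t : set_system R := within [set h | 0 <= t + h] 0^'.

Definition hl_quot f t : R -> R := fun h => h^-1 * (f (t + h) - f t).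
Definition hl_derivable f t : Prop := cvg (hl_quot f t @ hl_incr t).
Definition hl_derive f t : R := lim (hl_quot f t @ hl_incr t).
Definition hl_deriven k f : R -> R := iter k hl_derive f.

Definition hl_Ck k f : Prop :=
  (forall j t, (j < k)%N -> 0 <= t -> hl_derivable (hl_deriven j f) t) /\
  (forall j, (j <= k)%N -> {within `[0, +oo[, continuous (hl_deriven j f)}).

Definition lesssim f g : Prop :=
  exists C : R, 0 < C /\ forall t, 0 <= t -> f t <= C * g t.
Definition approx f g : Prop := lesssim f g /\ lesssim g f.

(* Variants of [lesssim] and of [<<] for relations stated as [t --> +oo]. *)
Definition lesssim_pinfty f g : Prop :=
  exists C : R, 0 < C /\ \forall t \near +oo, f t <= C * g t.
Definition ll_pinfty f g : Prop :=
  exists c : R, c < 1 /\ \forall t \near +oo, f t / g t <= c.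

End half_line.

Section assumptions.
Context {R : realType}.
Implicit Types lam omega a Theta Xi : R -> R.

Definition Lambda lam (t : R) : R :=
  1 + \int[lebesgue_measure]_(s in `[0, t]) lam s.

Definition A1 lam : Prop :=
  [/\ forall t, 0 <= t -> 0 < lam t /\ 0 < hl_derive lam t,
      approx (hl_derive lam) (fun t => lam t * (lam t / Lambda lam t)) &
      lesssim (fun t => `|hl_deriven 2 lam t|)
              (fun t => lam t * (lam t / Lambda lam t) ^+ 2)].

Definition A1_plus lam : Prop :=
  A1 lam /\ lesssim (fun t => t * Num.sqrt (lam t)) (Lambda lam).

Definition A2 omega : Prop :=
  exists c1 c2 : R, 0 < c1 /\ forall t, 0 <= t -> c1 <= omega t <= c2.

(* The qualifier [t --> +oo] is read as governing both relations. *)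
Definition A3 lam omega Theta : Prop :=
  lesssim_pinfty
    (fun t => \int[lebesgue_measure]_(s in `[0, t]) (lam s * `|omega s - 1|))
    Theta /\
  ll_pinfty Theta (Lambda lam).

Definition A4 (m : nat) a lam Theta Xi : Prop :=
  (forall k, (1 <= k <= m)%N ->
     lesssim (fun t => `|hl_deriven k a t|) (fun t => lam t * Xi t ^- k)) /\
  lesssim Theta (fun t => lam t * Xi t).

(* Measurability of the integrand is part of the assumption, since the library
   integral of a non-measurable function is only a lower integral. *)
Definition A5 (m : nat) lam Theta Xi : Prop :=
  let f := fun s : R => lam s ^- m.-1 * Xi s ^- m in
  measurable_fun (`[0, +oo[ : set R) f /\
  exists C : R, 0 < C /\ forall t, 0 <= t ->
    (\int[lebesgue_measure]_(s in `[t, +oo[) (f s)%:E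
       <= (C * Theta t ^- m.-1)%:E)%E.

End assumptions.

Section sobolev.
Context {R : realType} {n : nat}.
Local Notation E := 'rV[R]_n.
Local Notation mu := (lebesgue_rV R n).
Local Notation normc := Normc.normc.
Implicit Types (f g : E -> R[i]) (phi : E -> R).

Definition L2_norm2 f : \bar R := (\int[mu]_x ((normc (f x)) ^+ 2)%:E)%E.

Definition isL2 f : Prop :=
  [/\ measurable_fun setT (fun x => complex.Re (f x)),
      measurable_fun setT (fun x => complex.Im (f x)) &
      (L2_norm2 f < +oo)%E].

Definition ae_zero f : Prop := {ae mu, forall x, f x = 0}.

Definition cintegral f : R[i] :=
  Complex (\int[mu]_x complex.Re (f x)) (\int[mu]_x complex.Im (f x)).

Definition partial (j : 'I_n) phi : E -> R :=
  fun x => 'D_(delta_mx ord0 j) phi x.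

Definition partials (l : seq 'I_n) phi : E -> R := foldr partial phi l.

(* [C_c^infty]: all iterated partial derivatives exist and are continuous.
   Real test functions suffice against complex-valued [f], componentwise. *)
Definition test_function phi : Prop :=
  (forall l, continuous (partials l phi) /\
     forall j x, derivable (partials l phi) x (delta_mx ord0 j)) /\
  compact (closure [set x | phi x != 0]).

Definition laplacian phi : E -> R :=
  fun x => \sum_(j < n) partial j (partial j phi) x.

Definition pairing f phi : R[i] := cintegral (fun x => f x * (phi x)%:C%C).

Definition weak_partial (j : 'I_n) f g : Prop :=
  forall phi, test_function phi -> pairing f (partial j phi) = - pairing g phi.

Definition isH1 f : Prop :=
  isL2 f /\ forall j, exists g, isL2 g /\ weak_partial j f g.

(* Weak gradient of an [H^1] function; each component is a representative of a
   class modulo null sets. *)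
Definition grad f (j : 'I_n) : E -> R[i] :=
  xget (fun=> 0) [set g | isL2 g /\ weak_partial j f g].

End sobolev.

Section wave.
Context {R : realType} {n : nat}.
Local Notation E := 'rV[R]_n.
Local Notation mu := (lebesgue_rV R n).
Local Notation normc := Normc.normc.
Implicit Types (u v : R -> E -> R[i]) (t : R).

Definition L2_continuous v : Prop :=
  forall t, 0 <= t ->
    (fun h => L2_norm2 (fun x => v (t + h) x - v t x)) @ hl_incr t --> 0%E.

Definition is_L2_derive u t (w : E -> R[i]) : Prop :=
  isL2 w /\
  (fun h => L2_norm2 (fun x => (h^-1)%:C%C * (u (t + h) x - u t x) - w x))
    @ hl_incr t --> 0%E.

(* [u_t(t, _)] as a strong [L^2] derivative; again a representative. *)
Definition time_deriv u t : E -> R[i] := xget (fun=> 0) [set w | is_L2_derive u t w].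

Definition energy_class u : Prop :=
  [/\ forall t, 0 <= t -> isH1 (u t),
      L2_continuous u /\ (forall j, L2_continuous (fun t => grad (u t) j)),
      forall t, 0 <= t -> exists w, is_L2_derive u t w &
      L2_continuous (time_deriv u)].

(* [u_tt = a^2 Delta u] in the sense of distributions in [x], at each time [t]:
   [d/dt <u_t(t), phi> = a(t)^2 <u(t), Delta phi>]. *)
Definition wave_equation (a : R -> R) u : Prop :=
  forall phi, test_function phi -> forall t, 0 <= t ->
    (fun h => normc (
        (h^-1)%:C%C * (pairing (time_deriv u (t + h)) phi
                       - pairing (time_deriv u t) phi)
        - (a t ^+ 2)%:C%C * pairing (u t) (laplacian phi)))
      @ hl_incr t --> (0 : R).

(* The initial velocity is prescribed through [D_t = - i d/dt]. *)
Definition cauchy_solution (a : R -> R) (u1 u2 : E -> R[i]) u : Prop :=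
  [/\ energy_class u, wave_equation a u,
      {ae mu, forall x, u 0 x = u1 x} &
      {ae mu, forall x, - 'i%C * time_deriv u 0 x = u2 x}].

Definition energy (lam : R -> R) t u : \bar R :=
  ((2^-1)%:E * \int[mu]_x
     (lam t ^+ 2 * (\sum_(j < n) normc (grad (u t) j x) ^+ 2)
      + normc (time_deriv u t x) ^+ 2)%:E)%E.

End wave.

(* Main.v *)
Require Import Defs.
From mathcomp Require Import all_boot all_order all_algebra.
From mathcomp Require Import all_classical all_reals all_analysis.
From mathcomp Require Import complex measurable_realfun.
From mathcomp Require Import ring lra zify.

(** The energy of [u] is compared with the energies of oscillators
    [p'' + (a(t) xi)^2 p = f], with [xi] in a fixed interval [[d, M]].

    For one oscillator the expected growth is [q^2 + lam^2 p^2 >= C lam], with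
    [q = p'], because the adiabatic invariant [q^2 / lam + lam p^2] is almost
    conserved. This is made precise with frames: if [phi = al + i be] solves the
    Riccati equation [phi' + phi^2 + (xi a)^2 = 0] up to a residual that is
    integrable relative to [be], then [(q - al p)^2 / be + be p^2] decreases at
    most by a bounded factor ([frame_estimate]). Such frames exist in two cases
    ([oscillator_energy_lower_bound]). If the integral of [|a - lam|] is bounded,
    the frame of [lam], [phi = - lam' / (2 lam) + i xi lam], is good enough
    ([stabilised_adapted_frames]). Otherwise [Theta], hence [lam Xi], tends to
    infinity, and [m - 1] steps of diagonalisation starting from [phi = i xi a]
    leave a residual that is integrable by the last assumption on [a]
    ([wkb_adapted_frames]). All constants are uniform for [xi] in [[d, M]].

    To reach such oscillators from the wave equation without a Fourier transform,
    one real component of [u] is multiplied by a bump function rescaled to the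
    cube of half-side [L], and tested against products of sines that vanish on
    the boundary of this cube. The coefficients are oscillators, driven by the
    commutator of the Laplacian with the cutoff ([wave_oscillators]). Bessel's
    inequality bounds the energy of the family by [L^n] times the energy of [u],
    and its forcing by a multiple of [L^n / L^2] ([commutator_le]).
    The gradient enters through one partial derivative: the coefficients of a
    derivative are those of [u] times wave numbers
    ([coefficient_slope_le]).

    It remains to see that non-zero initial data have, for large [L], a mass of at
    least [c L^n] on the frequencies between two positive bounds
    ([spectral_mass]). Such data have a non-zero integral over some box, and the
    indicator of a box is well approximated by its sine series restricted to
    the frequencies between [pi / (2 p)] and [p pi / 2] if [p] is large, uniformly
    in [L]: this follows from Parseval's identity for intervals
    ([sum_cos_diff_ge], [interval_mass]). Dividing by [L^n] and letting
    [L] tend to infinity at a fixed time gives the lower bound, with a constant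
    that depends on the data only ([wave_field_energy_lower_bound]). *)

Import Order.TTheory GRing.Theory Num.Theory.
Import numFieldNormedType.Exports.
Local Open Scope classical_set_scope.
Local Open Scope ring_scope.

Set Implicit Arguments.
Unset Strict Implicit.
Unset Printing Implicit Defensive.

(** * Derivatives and Gronwall's inequality *)

Section calculus.
Context {R : realType}.
Implicit Types (f g : R -> R) (x : R).

Lemma isd_cst (c : R) x : is_derive x 1 (fun=> c) 0.
Proof. exact: is_derive_cst. Qed.

Lemma isd_id x : is_derive x 1 (fun y : R => y) 1.
Proof. exact: is_derive_id. Qed.

Lemma isdD {f g x} {a b : R} :
  is_derive x 1 f a -> is_derive x 1 g b ->
  is_derive x 1 (fun y => f y + g y) (a + b).
Proof. exact: is_deriveD. Qed.

Lemma isdN {f x} {a : R} : is_derive x 1 f a ->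
  is_derive x 1 (fun y => - f y) (- a).
Proof. exact: is_deriveN. Qed.

Lemma isdB {f g x} {a b : R} :
  is_derive x 1 f a -> is_derive x 1 g b ->
  is_derive x 1 (fun y => f y - g y) (a - b).
Proof. exact: is_deriveB. Qed.

Lemma isdM {f g x} {a b : R} :
  is_derive x 1 f a -> is_derive x 1 g b ->
  is_derive x 1 (fun y => f y * g y) (a * g x + f x * b).
Proof.
move=> fa gb; apply: (is_derive_eq (is_deriveM fa gb)).
by rewrite /GRing.scale /=; ring.
Qed.

Lemma isdZ {f x} {a : R} (c : R) :
  is_derive x 1 f a -> is_derive x 1 (fun y => c * f y) (c * a).
Proof. by move=> fa; apply: (is_derive_eq (isdM (isd_cst c x) fa)); ring. Qed.

Lemma isdV {f x} {a : R} : f x != 0 -> is_derive x 1 f a ->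
  is_derive x 1 (fun y => (f y)^-1) (- a / f x ^+ 2).
Proof.
move=> fx0 fa; apply: (is_derive_eq (is_deriveV fx0 fa)).
by rewrite /GRing.scale /=; field.
Qed.

Lemma isd_div {f g x} {a b : R} : g x != 0 ->
  is_derive x 1 f a -> is_derive x 1 g b ->
  is_derive x 1 (fun y => f y / g y) ((a * g x - f x * b) / g x ^+ 2).
Proof.
move=> gx0 fa gb; apply: (is_derive_eq (isdM fa (isdV gx0 gb))).
by field.
Qed.

Lemma isd_sqr {f x} {a : R} : is_derive x 1 f a ->
  is_derive x 1 (fun y => f y ^+ 2) (2 * f x * a).
Proof.
move=> fa; rewrite (_ : (fun y => _) = fun y => f y * f y).
  by apply: (is_derive_eq (isdM fa fa)); ring.
by apply/funext => y; rewrite expr2.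
Qed.

Lemma isd_comp {f g x} {a b : R} :
  is_derive (g x) 1 f a -> is_derive x 1 g b ->
  is_derive x 1 (fun y => f (g y)) (a * b).
Proof.
exact: is_derive1_comp.
Qed.

Lemma isd_sum {I : Type} (r : seq I) (F : I -> R -> R) (D : I -> R) x :
  (forall i, is_derive x 1 (F i) (D i)) ->
  is_derive x 1 (fun y => \sum_(i <- r) F i y) (\sum_(i <- r) D i).
Proof.
move=> FD; elim: r => [|i r IH].
  rewrite big_nil (_ : (fun y => _) = fun=> 0); first exact: isd_cst.
  by apply/funext => y; rewrite big_nil.
rewrite big_cons (_ : (fun y => _) = fun y => F i y + \sum_(j <- r) F j y).
  exact: isdD.
by apply/funext => y; rewrite big_cons.
Qed.

Lemma isd_cont {f x} {a : R} : is_derive x 1 f a -> {for x, continuous f}.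
Proof.
move=> fa; apply: differentiable_continuous; apply/derivable1_diffP.
by case: fa.
Qed.

Section within.
Variable A : set R.
Local Notation cw f := ({within A, continuous f}).

Lemma cw_cst (c : R) : cw (fun _ : R => c).
Proof. by apply: continuous_subspaceT => x; exact: cvg_cst. Qed.

Lemma cw_id : cw (fun x : R => x).
Proof. by apply: continuous_subspaceT => x; exact: cvg_id. Qed.

Lemma cwD f g : cw f -> cw g -> cw (fun x => f x + g x).
Proof.
move=> /subspace_continuousP cf /subspace_continuousP cg.
by apply/subspace_continuousP => x Ax; apply: cvgD; [exact: cf|exact: cg].
Qed.

Lemma cwM f g : cw f -> cw g -> cw (fun x => f x * g x).
Proof.
move=> /subspace_continuousP cf /subspace_continuousP cg.
by apply/subspace_continuousP => x Ax; apply: cvgM; [exact: cf|exact: cg].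
Qed.

Lemma cwN f : cw f -> cw (fun x => - f x).
Proof.
move=> /subspace_continuousP cf.
by apply/subspace_continuousP => x Ax; apply: cvgN; exact: cf.
Qed.

Lemma cwB f g : cw f -> cw g -> cw (fun x => f x - g x).
Proof. by move=> cf cg; apply: cwD => //; exact: cwN. Qed.

Lemma cwX f k : cw f -> cw (fun x => f x ^+ k).
Proof.
move=> cf; elim: k => [|k IH].
  by under eq_fun do rewrite expr0; exact: cw_cst.
by under eq_fun do rewrite exprS; exact: cwM.
Qed.

Lemma cwV f : (forall x, A x -> f x != 0) -> cw f -> cw (fun x => (f x)^-1).
Proof.
move=> f0 /subspace_continuousP cf.
by apply/subspace_continuousP => x Ax; apply: cvgV; [exact: f0|exact: cf].
Qed.

Lemma cw_abs f : cw f -> cw (fun x => `|f x|).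
Proof.
move=> /subspace_continuousP cf.
by apply/subspace_continuousP => x Ax; apply: cvg_norm; exact: cf.
Qed.

Lemma cw_comp f g : continuous g -> cw f -> cw (fun x => g (f x)).
Proof.
move=> cg /subspace_continuousP cf.
apply/subspace_continuousP => x Ax.
by apply: (@continuous_cvg _ _ _ _ _ f g) => //; [exact: cg|exact: cf].
Qed.

Lemma cw_sum {I : Type} (r : seq I) (F : I -> R -> R) :
  (forall i, cw (F i)) -> cw (fun x => \sum_(i <- r) F i x).
Proof.
move=> cF; elim: r => [|i r IH].
  by under eq_fun do rewrite big_nil; exact: cw_cst.
by under eq_fun do rewrite big_cons; exact: cwD.
Qed.

Lemma cw_for f : (forall x, A x -> {for x, continuous f}) -> cw f.
Proof.
move=> cf; apply/subspace_continuousP => x Ax.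
exact: cvg_within_filter (cf x Ax).
Qed.

End within.

(** The integrating factors differ from one member of the family to the other;
    the signs of the [eta i] bound them all by [expR h], which absorbs the
    forcing, of which only the sum over the family is controlled. *)
Lemma gronwall_backward {I : finType} (G dG H eta k : I -> R -> R)
    (s t h K : R) :
  s <= t -> 0 <= K ->
  (forall i, {within `[s, t], continuous (G i)}) ->
  (forall i, {within `[s, t], continuous (H i)}) ->
  (forall i x, s < x < t -> is_derive x 1 (G i) (dG i x)) ->
  (forall i x, s < x < t -> is_derive x 1 (H i) (eta i x)) ->
  (forall i x, s < x < t -> 0 <= eta i x) ->
  (forall i x, s < x < t -> 0 <= k i x) ->
  (forall i x, s < x < t -> - (eta i x * G i x) - k i x <= dG i x) ->
  (forall x, s < x < t -> \sum_i k i x <= K) ->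
  (forall i, H i t - H i s <= h) -> (forall i, 0 <= G i t) ->
  \sum_i G i s <= expR h * (\sum_i G i t + K * (t - s)).
Proof.
move=> st K0 cG cH dGx dHx eta0 k0 le_dG le_k le_h Gt0.
have Hle i x : s < x < t -> H i x <= H i t.
  move=> /andP[sx xt]; apply: (@ger0_derive1_ndecr _ (H i) s t).
  - by move=> y; rewrite in_itv/= => /(dHx i)[].
  - move=> y; rewrite in_itv/= => yI; rewrite derive1E.
    by have /@derive_val -> := dHx i _ yI; exact: eta0.
  - exact: cH.
  - exact: ltW.
  - exact: ltW.
  - exact: lexx.
pose E i x := expR (H i x - H i s).
pose P x := \sum_i E i x * G i x + expR h * K * (x - s).
have dE i x : s < x < t -> is_derive x 1 (E i) (E i x * (eta i x - 0)).
  move=> xI.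
  exact: (isd_comp (is_derive_expR _) (isdB (dHx i _ xI) (isd_cst (H i s) x))).
have dP x : s < x < t -> is_derive x 1 P
    (\sum_i (E i x * (eta i x - 0) * G i x + E i x * dG i x) + expR h * K).
  move=> xI; apply: (is_derive_eq (isdD
    (isd_sum (index_enum I) (fun i => isdM (dE i x xI) (dGx i x xI)))
    (isdZ (expR h * K) (isdB (isd_id x) (isd_cst s x))))).
  by rewrite subr0 mulr1.
have cP : {within `[s, t], continuous P}.
  apply: cwD.
    apply: cw_sum => i; apply: cwM => //.
    apply: (cw_comp (g := expR)); first exact: continuous_expR.
    by apply: cwB => //; exact: cw_cst.
  apply: cwM; first exact: cw_cst.
  by apply: cwB; [exact: cw_id|exact: cw_cst].
have Pst : P s <= P t.
  apply: (@ger0_derive1_ndecr _ P s t) => //.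
    by move=> y; rewrite in_itv/= => /dP[].
  move=> y; rewrite in_itv/= => yI; rewrite derive1E.
  have /@derive_val -> := dP _ yI.
  rewrite -lerBlDr sub0r.
  apply: (@le_trans _ _ (\sum_i - (expR h * k i y))).
    by rewrite sumrN lerN2 -mulr_sumr ler_wpM2l ?expR_ge0// le_k.
  apply: ler_sum => i _.
  have e1 : 0 < E i y by exact: expR_gt0.
  have e2 : E i y <= expR h.
    by rewrite ler_expR (le_trans _ (le_h i))// lerD2r Hle.
  have hG := ler_wpM2l (ltW e1) (le_dG i _ yI).
  have : E i y * k i y <= expR h * k i y by rewrite ler_wpM2r// k0.
  by move: hG; lra.
rewrite /P subrr mulr0 addr0 in Pst.
have -> : \sum_i G i s = \sum_i E i s * G i s.
  by apply: eq_bigr => i _; rewrite /E subrr expR0 mul1r.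
apply: (le_trans Pst); rewrite [leRHS]mulrDr [expR h * (K * _)]mulrA lerD2r mulr_sumr.
by apply: ler_sum => i _; rewrite ler_wpM2r// ler_expR.
Qed.

End calculus.

(** * Energies of an oscillator with a variable coefficient *)

Section frame.
Context {R : realType}.
Implicit Types (a f : R -> R) (x : R).

(** [al + i be] is an approximate solution of the Riccati equation
    [phi' + phi^2 + (xi a)^2 = 0]; [eta] bounds its residual relative to [be]. *)
Definition frame a (xi : R) (eta al be : R -> R) (s t : R) :=
  [/\ {within `[s, t], continuous al},
      {within `[s, t], continuous be},
      forall x, s <= x <= t -> 0 < be x &
      forall x, s < x < t -> exists dal dbe : R,
        [/\ is_derive x 1 al dal, is_derive x 1 be dbe &
         `|dbe + 2 * al x * be x|
         + `|dal + al x ^+ 2 - be x ^+ 2 + (a x * xi) ^+ 2| <= eta x * be x]].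

Definition frame_energy (al be p q : R -> R) x : R :=
  (q x - al x * p x) ^+ 2 / be x + be x * p x ^+ 2.

Lemma frame_energy_ge0 al be p q x : 0 < be x -> 0 <= frame_energy al be p q x.
Proof.
move=> b0; apply: addr_ge0.
  by apply: divr_ge0; [exact: sqr_ge0|exact: ltW].
by apply: mulr_ge0; [exact: ltW|exact: sqr_ge0].
Qed.

(** With [z = q - al p] and [Rr + i Ri] the residual, the derivative of
    [z^2 / be + be p^2] is [Ri (p^2 - z^2 / be^2) - 2 Rr z p / be + 2 z f / be];
    the derivatives of [al] and [be] cancel. *)
Lemma frame_energy_derive (al be p q : R -> R) (dal dbe A f x : R) :
  0 < be x ->
  is_derive x 1 al dal -> is_derive x 1 be dbe ->
  is_derive x 1 p (q x) -> is_derive x 1 q (- A * p x + f) ->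
  let z := q x - al x * p x in
  is_derive x 1 (frame_energy al be p q)
    ((dbe + 2 * al x * be x) * (p x ^+ 2 - z ^+ 2 / be x ^+ 2)
     - 2 * (dal + al x ^+ 2 - be x ^+ 2 + A) * z * p x / be x
     + 2 * z * f / be x).
Proof.
move=> b0 dal_ dbe_ dp dq z.
have b1 : be x != 0 by rewrite gt_eqF.
apply: (is_derive_eq (isdD (isd_div b1
  (isd_sqr (isdB dq (isdM dal_ dp))) dbe_) (isdM dbe_ (isd_sqr dp)))).
by rewrite /z; field.
Qed.

(** The residual terms are at most [eta] times the energy; Young's inequality
    with weight [e] trades the forcing term for the rate [e]. *)
Lemma frame_rate_le (b Ri Rr z y f e eta : R) :
  0 < b -> 0 < e -> `|Ri| + `|Rr| <= eta * b ->
  - ((eta + e) * (z ^+ 2 / b + b * y ^+ 2)) - f ^+ 2 / (e * b) <=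
  Ri * (y ^+ 2 - z ^+ 2 / b ^+ 2) - 2 * Rr * z * y / b + 2 * z * f / b.
Proof.
move=> b0 e0 le_eta.
set Q := z ^+ 2 / b + b * y ^+ 2.
have b1 : b != 0 by rewrite gt_eqF.
have e1 : e != 0 by rewrite gt_eqF.
have Q0 : 0 <= Q.
  apply: addr_ge0; first by apply: divr_ge0; [exact: sqr_ge0|exact: ltW].
  by apply: mulr_ge0; [exact: ltW|exact: sqr_ge0].
have h1 : - (`|Ri| * (Q / b)) <= Ri * (y ^+ 2 - z ^+ 2 / b ^+ 2).
  have : `|Ri * (y ^+ 2 - z ^+ 2 / b ^+ 2)| <= `|Ri| * (Q / b).
    rewrite normrM ler_wpM2l//; apply: le_trans (ler_normB _ _) _.
    rewrite !ger0_norm ?divr_ge0 ?sqr_ge0// /Q.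
    by rewrite le_eqVlt; apply/orP; left; apply/eqP; field.
  by rewrite ler_norml => /andP[].
have h2 : - (`|Rr| * (Q / b)) <= - (2 * Rr * z * y / b).
  have : `|2 * Rr * z * y / b| <= `|Rr| * (Q / b).
    rewrite (_ : _ / b = Rr * (2 * z * y / b)); last by ring.
    rewrite normrM ler_wpM2l//.
    rewrite normrM (gtr0_norm (_ : 0 < b^-1)) ?invr_gt0// ler_pM2r ?invr_gt0//.
    rewrite ler_norml; apply/andP; split.
      rewrite -subr_ge0 (_ : _ - _ = (z + b * y) ^+ 2 / b).
        by rewrite divr_ge0 ?sqr_ge0// ltW.
      by rewrite /Q; field.
    rewrite -subr_ge0 (_ : _ - _ = (z - b * y) ^+ 2 / b).
      by rewrite divr_ge0 ?sqr_ge0// ltW.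
    by rewrite /Q; field.
  by rewrite ler_norml lerN2 => /andP[].
have h3 : - (e * Q) - f ^+ 2 / (e * b) <= 2 * z * f / b.
  have : 0 <= (e * z + f) ^+ 2 / (e * b)
    by apply: divr_ge0; [exact: sqr_ge0|apply: mulr_ge0; exact: ltW].
  have : 0 <= e * (b * y ^+ 2).
    by apply: mulr_ge0; [exact: ltW|apply: mulr_ge0; [exact: ltW|exact: sqr_ge0]].
  have -> : (e * z + f) ^+ 2 / (e * b)
    = e * (z ^+ 2 / b) + 2 * z * f / b + f ^+ 2 / (e * b) by field; rewrite b1 e1.
  by rewrite /Q; lra.
have h4 : (`|Ri| + `|Rr|) * (Q / b) <= eta * Q.
  rewrite (_ : eta * Q = eta * b * (Q / b)); last by field.
  by rewrite ler_wpM2r// divr_ge0// ltW.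
by lra.
Qed.

Definition oscillators {I : finType} a (xi : I -> R) (f p q : I -> R -> R) T :=
  [/\ forall i, {within `[0, T], continuous (p i)},
      forall i, {within `[0, T], continuous (q i)} &
      forall i x, 0 < x < T -> is_derive x 1 (p i) (q i x) /\
        is_derive x 1 (q i) (- (a x * xi i) ^+ 2 * p i x + f i x)].

(** The rate [e = 1 / (1 + t - s)] spent on the forcing costs a factor [expR 1]
    only, and makes the constant in front of the forcing finite. *)
Lemma frame_estimate {I : finType} a (xi : I -> R) (f p q : I -> R -> R)
    (eta H al be : I -> R -> R) (T s t bmin F h : R) :
  oscillators a xi f p q T -> 0 <= s -> s <= t -> t <= T ->
  (forall i, {within `[s, t], continuous (H i)}) ->
  (forall i x, s < x < t -> is_derive x 1 (H i) (eta i x)) ->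
  (forall i x, s < x < t -> 0 <= eta i x) ->
  (forall i, H i t - H i s <= h) ->
  (forall i, frame a (xi i) (eta i) (al i) (be i) s t) ->
  0 < bmin -> (forall i x, s <= x <= t -> bmin <= be i x) ->
  (forall x, 0 <= x <= T -> \sum_i f i x ^+ 2 <= F) ->
  \sum_i frame_energy (al i) (be i) (p i) (q i) s <=
  expR (h + 1) * (\sum_i frame_energy (al i) (be i) (p i) (q i) t
     + (1 + t - s) ^+ 2 / bmin * F).
Proof.
move=> [cp cq dpq] s0 st tT cH dH eta0 leh fr b0 leb leF.
have sub : `[s, t]%classic `<=` `[0, T]%classic.
  move=> x/=; rewrite !in_itv/= => /andP[sx xt].
  by rewrite (le_trans s0 sx) (le_trans xt tT).
pose e := (1 + t - s)^-1.
have ts0 : 0 < 1 + t - s by lra.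
have e0 : 0 < e by rewrite invr_gt0.
have F0 : 0 <= F.
  have /leF : 0 <= s <= T by rewrite s0 (le_trans st).
  by apply: le_trans; apply: sumr_ge0 => i _; exact: sqr_ge0.
have bex i x : s <= x <= t -> be i x != 0.
  by case: (fr i) => _ _ bpos _ xI; rewrite gt_eqF// bpos.
pose G i x := frame_energy (al i) (be i) (p i) (q i) x.
have cG i : {within `[s, t], continuous (G i)}.
  have [ca cb _ _] := fr i.
  have cpi := continuous_subspaceW sub (cp i).
  have cqi := continuous_subspaceW sub (cq i).
  apply: cwD; last by apply: cwM => //; exact: cwX.
  apply: cwM; first by apply: cwX; apply: cwB => //; exact: cwM.
  by apply: cwV => // x /=; rewrite in_itv/=; exact: bex.
have [dG hdG] : exists dG, forall i x, s < x < t ->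
    is_derive x 1 (G i) (dG i x) /\
    - ((eta i x + e) * G i x) - f i x ^+ 2 / (e * bmin) <= dG i x.
  pose P (ix : I * R) (d : R) := s < ix.2 < t ->
      is_derive ix.2 1 (G ix.1) d /\
      - ((eta ix.1 ix.2 + e) * G ix.1 ix.2)
        - f ix.1 ix.2 ^+ 2 / (e * bmin) <= d.
  have /choice[d hd] : forall ix, exists d, P ix d.
    move=> [i x]; rewrite /P /=.
    have [xI|] := boolP (s < x < t); last by exists 0.
    have xI' : s <= x <= t by move: xI; lra.
    have xT : 0 < x < T by move: xI; lra.
    have [_ _ bpos /(_ _ xI)[dal [dbe [dal_ dbe_ le_eta]]]] := fr i.
    have [dp dq] := dpq i _ xT.
    have bi := bpos _ xI'.
    eexists => _; split; first exact: (frame_energy_derive bi dal_ dbe_ dp dq).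
    apply: le_trans (frame_rate_le _ _ _ bi e0 le_eta).
    rewrite lerD2l lerN2 ler_wpM2l ?sqr_ge0// lef_pV2 ?posrE ?mulr_gt0//.
    by rewrite ler_pM2l// leb.
  by exists (fun i x => d (i, x)) => i x; exact: (hd (i, x)).
have ets : e * (t - s) <= 1.
  by rewrite /e mulrC ler_pdivrMr// mul1r; lra.
have K0 : 0 <= F / (e * bmin).
  by apply: divr_ge0 => //; apply: mulr_ge0; exact: ltW.
have Gt0 i : 0 <= G i t.
  apply: frame_energy_ge0.
  by have [_ _ + _] := fr i; apply; rewrite st lexx.
have GG : \sum_i G i s <=
    expR (h + 1) * (\sum_i G i t + F / (e * bmin) * (t - s)).
  apply: (@gronwall_backward R I G dG (fun i x => H i x + e * x)
    (fun i x => eta i x + e * 1) (fun i x => f i x ^+ 2 / (e * bmin)) s t) => //.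
  - move=> i; apply: cwD => //; apply: cwM; first exact: cw_cst.
    exact: cw_id.
  - by move=> i x xI; exact: (hdG i x xI).1.
  - by move=> i x xI; exact: (isdD (dH i x xI) (isdZ e (isd_id x))).
  - by move=> i x xI; rewrite addr_ge0 ?eta0// mulr1 ltW.
  - move=> i x _; apply: divr_ge0; first exact: sqr_ge0.
    by apply: mulr_ge0; exact: ltW.
  - by move=> i x xI; rewrite mulr1; exact: (hdG i x xI).2.
  - move=> x xI; rewrite -mulr_suml ler_pM2r ?invr_gt0 ?mulr_gt0// leF//.
    by move: xI; lra.
  - by move=> i; have := leh i; move: ets; lra.
apply: (le_trans GG).
apply: ler_wpM2l; first exact: expR_ge0.
rewrite lerD2l invfM invrK.
rewrite (_ : _ * (t - s) = (F / bmin) * ((1 + t - s) * (t - s))); last by ring.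
rewrite (_ : _ * F = (F / bmin) * (1 + t - s) ^+ 2); last by ring.
apply: ler_wpM2l; first by apply: divr_ge0 => //; exact: ltW.
by rewrite expr2 ler_pM2l//; lra.
Qed.

(** Comparison of the energy of a frame with the two reference energies: at a
    fixed time with [p^2 + q^2], and with [(q^2 + lam^2 p^2) / lam] when [be] is
    of the order of [lam]. *)
Lemma frame_energy_ge (al be p q : R -> R) (x A bm bM : R) :
  0 < bm -> bm <= be x <= bM -> `|al x| <= A ->
  p x ^+ 2 + q x ^+ 2 <=
  (2 * bM + (1 + 2 * A ^+ 2) / bm) * frame_energy al be p q x.
Proof.
move=> bm0 /andP[bmb bbM] alA; rewrite /frame_energy.
have b0 : 0 < be x by exact: lt_le_trans bmb.
set z := q x - al x * p x.
have b1 : be x != 0 by rewrite gt_eqF.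
have bm1 : bm != 0 by rewrite gt_eqF.
have A2 : al x ^+ 2 <= A ^+ 2.
  by rewrite -(real_normK (num_real (al x))) lerXn2r// nnegrE (le_trans _ alA).
have h1 : p x ^+ 2 <= bm^-1 * (be x * p x ^+ 2).
  by rewrite mulrA ler_peMl ?sqr_ge0// mulrC ler_pdivlMr// mul1r.
have h2 : z ^+ 2 <= bM * (z ^+ 2 / be x).
  by rewrite mulrCA ler_peMr ?sqr_ge0// ler_pdivlMr// mul1r.
have h3 : q x ^+ 2 <= 2 * z ^+ 2 + 2 * (al x ^+ 2 * p x ^+ 2).
  have : 0 <= (z - al x * p x) ^+ 2 by exact: sqr_ge0.
  by rewrite /z; lra.
have h4 : al x ^+ 2 * p x ^+ 2 <= A ^+ 2 * p x ^+ 2.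
  by rewrite ler_wpM2r// sqr_ge0.
have h5 : (1 + 2 * A ^+ 2) * p x ^+ 2 <=
    (1 + 2 * A ^+ 2) / bm * (be x * p x ^+ 2).
  by rewrite -mulrA ler_wpM2l// addr_ge0// mulr_ge0// sqr_ge0.
have h6 : 0 <= (1 + 2 * A ^+ 2) / bm * (z ^+ 2 / be x).
  apply: mulr_ge0; apply: divr_ge0; do ?[exact: sqr_ge0|exact: ltW].
  by apply: addr_ge0 => //; apply: mulr_ge0 => //; exact: sqr_ge0.
have h7 : 0 <= 2 * bM * (be x * p x ^+ 2).
  apply: mulr_ge0; last by apply: mulr_ge0; [exact: ltW|exact: sqr_ge0].
  by apply: mulr_ge0 => //; exact: le_trans (ltW b0) bbM.
by move: h1 h2 h3 h4 h5 h6 h7; lra.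
Qed.

Lemma frame_energy_le (al be p q : R -> R) (x lam A bm bM : R) :
  0 < lam -> 0 < bm -> bm * lam <= be x <= bM * lam -> `|al x| <= A * lam ->
  frame_energy al be p q x <=
  (2 * (1 + A ^+ 2) / bm + bM) / lam * (q x ^+ 2 + lam ^+ 2 * p x ^+ 2).
Proof.
move=> l0 bm0 /andP[bmb bbM] alA; rewrite /frame_energy.
have bl0 : 0 < bm * lam by rewrite mulr_gt0.
have b0 : 0 < be x by exact: lt_le_trans bmb.
set z := q x - al x * p x.
have A2 : al x ^+ 2 <= A ^+ 2 * lam ^+ 2.
  rewrite -exprMn -(real_normK (num_real (al x))).
  by rewrite lerXn2r// nnegrE (le_trans _ alA).
have z2 : z ^+ 2 <= 2 * (1 + A ^+ 2) * (q x ^+ 2 + lam ^+ 2 * p x ^+ 2).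
  have : 0 <= (q x + al x * p x) ^+ 2 by exact: sqr_ge0.
  have : al x ^+ 2 * p x ^+ 2 <= A ^+ 2 * lam ^+ 2 * p x ^+ 2.
    by rewrite ler_wpM2r// sqr_ge0.
  have : 0 <= A ^+ 2 * q x ^+ 2 by rewrite mulr_ge0// sqr_ge0.
  have : 0 <= lam ^+ 2 * p x ^+ 2 by rewrite mulr_ge0// sqr_ge0.
  by rewrite /z; lra.
have l1 : lam != 0 by rewrite gt_eqF.
have bm1 : bm != 0 by rewrite gt_eqF.
have h1 : z ^+ 2 / be x <= z ^+ 2 / (bm * lam).
  by rewrite ler_wpM2l ?sqr_ge0// lef_pV2 ?posrE.
have h2 : z ^+ 2 / (bm * lam) <=
    2 * (1 + A ^+ 2) * (q x ^+ 2 + lam ^+ 2 * p x ^+ 2) / (bm * lam).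
  by rewrite ler_pM2r ?invr_gt0.
have h3 : be x * p x ^+ 2 <= bM * lam * p x ^+ 2.
  by rewrite ler_wpM2r// sqr_ge0.
have h4 : 0 <= bM / lam * q x ^+ 2.
  apply: mulr_ge0; last exact: sqr_ge0.
  apply: divr_ge0; last exact: ltW.
  by rewrite -(pmulr_lge0 _ l0) (le_trans _ bbM)// ltW.
rewrite (_ : _ / lam * _ = 2 * (1 + A ^+ 2) * (q x ^+ 2 + lam ^+ 2 * p x ^+ 2)
  / (bm * lam) + (bM / lam * q x ^+ 2 + bM * lam * p x ^+ 2)); last first.
  by field; rewrite l1 bm1.
by move: h1 h2 h3 h4; lra.
Qed.

End frame.

(** * Lower energy bounds for families of oscillators *)

Section transfer.
Context {R : realType}.
Implicit Types (a lam : R -> R) (d M s t C D : R).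

(** Finite families of oscillators, rather than single ones, so that the sum of
    the squared forcings can be bounded by Bessel's inequality. For free
    oscillators it says that the energy grows at least like [lam t]. *)
Definition transfers a lam d M s t C D := forall (I : finType) (xi : I -> R)
    (f p q : I -> R -> R) (F : R),
  (forall i, d <= xi i <= M) -> oscillators a xi f p q t ->
  (forall x, 0 <= x <= t -> \sum_i f i x ^+ 2 <= F) ->
  \sum_i (p i s ^+ 2 + q i s ^+ 2) <=
  C / lam t * \sum_i (q i t ^+ 2 + lam t ^+ 2 * p i t ^+ 2) + D * F.

(** Frames of the size of [lam] whose relative residuals are integrable,
    uniformly over frequencies in [[d, M]]. *)
Definition adapted_frames a lam d M s := exists bm bM A h : R, 0 < bm /\
  forall xi, d <= xi <= M -> exists eta H al be : R -> R, forall t, s <= t ->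
  [/\ frame a xi eta al be s t,
      {within `[s, t], continuous H},
      forall x, s < x -> is_derive x 1 H (eta x) /\ 0 <= eta x,
      H t - H s <= h &
      bm * lam t <= be t <= bM * lam t /\ `|al t| <= A * lam t].

Section adapted.
Variables (a lam : R -> R) (d M s : R).
Hypothesis s0 : 0 <= s.
Hypothesis lam_gt0 : forall t, 0 <= t -> 0 < lam t.
Hypothesis lam_nd : forall x y, 0 <= x -> x <= y -> lam x <= lam y.

(** At the fixed time [s] all normalisations of the energy are equivalent, so
    [C] is independent of [t]; only the constant of the forcing grows with [t]. *)
Lemma adapted_frames_transfers : adapted_frames a lam d M s ->
  exists C, 0 < C /\ forall t, s <= t ->
    exists D, 0 <= D /\ transfers a lam d M s t C D.
Proof.
move=> [bm [bM [A [h [bm0 frs]]]]].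
have l0 := lam_gt0 s0.
pose c1 := 2 * (bM * lam s) + (1 + 2 * (A * lam s) ^+ 2) / (bm * lam s).
pose c2 := 2 * (1 + A ^+ 2) / bm + bM.
pose C := Num.max 1 (c1 * expR (h + 1) * c2).
exists C; split; first by rewrite lt_max ltr01.
move=> t st.
have lt0 : 0 < lam t by apply: lam_gt0; exact: le_trans st.
pose D := Num.max 0 (c1 * expR (h + 1) * ((1 + t - s) ^+ 2 / (bm * lam s))).
exists D; split; first by rewrite le_max lexx.
move=> I xi f p q F xiI osc leF.
have [i0|I0] := pselect (exists i0 : I, True); last first.
  have I0' (i : I) : False by apply: I0; exists i.
  rewrite !big1 ?mulr0 ?add0r; last 2 first.
    by move=> i; case: (I0' i).
    by move=> i; case: (I0' i).
  apply: mulr_ge0; first by rewrite le_max lexx.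
  have /leF : 0 <= t <= t by rewrite lexx (le_trans s0).
  by apply: le_trans; apply: sumr_ge0 => i; case: (I0' i).
have {i0}[i0 _] := i0.
have /choice[eta /choice[H /choice[al /choice[be hb]]]] i : exists eta, exists H,
    exists al, exists be : R -> R, forall t, s <= t ->
  [/\ frame a (xi i) eta al be s t,
      {within `[s, t], continuous H},
      forall x, s < x -> is_derive x 1 H (eta x) /\ 0 <= eta x,
      H t - H s <= h &
      bm * lam t <= be t <= bM * lam t /\ `|al t| <= A * lam t].
  by have [eta [H [al [be hi]]]] := frs _ (xiI i); exists eta, H, al, be.
have F0 : 0 <= F.
  have /leF : 0 <= t <= t by rewrite lexx (le_trans s0).
  by apply: le_trans; apply: sumr_ge0 => i _; exact: sqr_ge0.
have est := @frame_estimate R I a xi f p q eta H al be t s t (bm * lam s) F h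
  osc s0 st (lexx t).
have {}est : \sum_i frame_energy (al i) (be i) (p i) (q i) s <=
    expR (h + 1) * (\sum_i frame_energy (al i) (be i) (p i) (q i) t
     + (1 + t - s) ^+ 2 / (bm * lam s) * F).
  apply: est => //.
  - by move=> i; have [] := hb i t st.
  - by move=> i x /andP[sx _]; have [_ _ /(_ _ sx)[]] := hb i t st.
  - by move=> i x /andP[sx _]; have [_ _ /(_ _ sx)[]] := hb i t st.
  - by move=> i; have [] := hb i t st.
  - by move=> i; have [] := hb i t st.
  - by rewrite mulr_gt0.
  - move=> i x /andP[sx _]; have [_ _ _ _ [/andP[+ _] _]] := hb i x sx.
    by apply: le_trans; rewrite ler_pM2l// lam_nd.
have bM0 : 0 <= bM.
  have [_ _ _ _ [/andP[b1 b2] _]] := hb i0 s (lexx s).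
  rewrite -(pmulr_lge0 _ l0); apply: le_trans b2; apply: le_trans b1.
  by apply: mulr_ge0; exact: ltW.
have c1_ge0 : 0 <= c1.
  apply: addr_ge0; first by apply: mulr_ge0 => //; apply: mulr_ge0 => //; exact: ltW.
  apply: divr_ge0; last by apply: mulr_ge0; exact: ltW.
  by apply: addr_ge0 => //; apply: mulr_ge0 => //; exact: sqr_ge0.
have lo : \sum_i (p i s ^+ 2 + q i s ^+ 2) <=
    c1 * \sum_i frame_energy (al i) (be i) (p i) (q i) s.
  rewrite mulr_sumr; apply: ler_sum => i _.
  have [_ _ _ _ [b1 b2]] := hb i s (lexx s).
  by apply: frame_energy_ge => //; rewrite mulr_gt0.
have hi : \sum_i frame_energy (al i) (be i) (p i) (q i) t <=
    c2 / lam t * \sum_i (q i t ^+ 2 + lam t ^+ 2 * p i t ^+ 2).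
  rewrite mulr_sumr; apply: ler_sum => i _.
  have [_ _ _ _ [b1 b2]] := hb i t st.
  exact: frame_energy_le.
set S := \sum_i (q i t ^+ 2 + lam t ^+ 2 * p i t ^+ 2) in hi *.
have S0 : 0 <= S.
  apply: sumr_ge0 => i _; apply: addr_ge0; first exact: sqr_ge0.
  by apply: mulr_ge0; exact: sqr_ge0.
apply: (le_trans lo).
apply: (le_trans (ler_wpM2l c1_ge0 est)).
rewrite mulrA mulrDr; apply: lerD.
  apply: (@le_trans _ _ (c1 * expR (h + 1) * (c2 / lam t * S))).
    by rewrite ler_wpM2l// mulr_ge0// expR_ge0.
  rewrite !mulrA -[leLHS]mulrA -[leRHS]mulrA.
  apply: ler_wpM2r; last by rewrite /C le_max lexx orbT.
  by apply: mulr_ge0 => //; rewrite invr_ge0 ltW.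
rewrite [leLHS]mulrA; apply: ler_wpM2r => //.
by rewrite /D le_max lexx orbT.
Qed.

Variable c2 : R.
Hypothesis d0 : 0 < d.
Hypothesis le_a : forall t, 0 <= t -> 0 <= a t <= c2 * lam t.

(** Over a bounded time interval, [p ^+ 2 + q ^+ 2] is controlled by the frame
    [al = 0], [be = 1]. *)
Lemma bounded_time_estimate : exists B, 0 < B /\
  forall (I : finType) (xi : I -> R) (f p q : I -> R -> R) (F t T : R),
  (forall i, d <= xi i <= M) -> 0 <= t <= s -> t <= T ->
  oscillators a xi f p q T ->
  (forall x, 0 <= x <= T -> \sum_i f i x ^+ 2 <= F) ->
  \sum_i (p i 0 ^+ 2 + q i 0 ^+ 2) <=
  B * (\sum_i (p i t ^+ 2 + q i t ^+ 2) + B * F).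
Proof.
pose K := 1 + (c2 * lam s * M) ^+ 2.
have K0 : 0 <= K by apply: addr_ge0 => //; exact: sqr_ge0.
have s1 : 0 <= (1 + s) ^+ 2 by exact: sqr_ge0.
pose B := expR (K * s + 1) + (1 + s) ^+ 2.
have B0 : 0 < B by rewrite ltr_wpDr// expR_gt0.
exists B; split => // I xi f p q F t T xiI /andP[t0 ts] tT osc leF.
have F0 : 0 <= F.
  have /leF : (0 : R) <= 0 <= T by rewrite lexx (le_trans t0).
  by apply: le_trans; apply: sumr_ge0 => i _; exact: sqr_ge0.
have E x i : frame_energy (fun=> 0) (fun=> 1) (p i) (q i) x =
    p i x ^+ 2 + q i x ^+ 2.
  by rewrite /frame_energy divr1; ring.
have := @frame_estimate R I a xi f p q (fun _ _ => K) (fun _ x => K * x)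
  (fun _ _ => 0) (fun _ _ => 1) T 0 t 1 F (K * s) osc (lexx 0) t0 tT.
rewrite !(eq_bigr _ (fun i _ => E _ i)) => est.
have {}est : \sum_i (p i 0 ^+ 2 + q i 0 ^+ 2) <= expR (K * s + 1) *
   (\sum_i (p i t ^+ 2 + q i t ^+ 2) + (1 + t - 0) ^+ 2 / 1 * F).
  apply: est => //.
  - by move=> i; apply: cwM; [exact: cw_cst|exact: cw_id].
  - move=> i x _; apply: (is_derive_eq (isdZ K (isd_id x))).
    by rewrite mulr1.
  - by move=> i; rewrite mulr0 subr0 ler_wpM2l.
  - move=> i; split; [exact: cw_cst|exact: cw_cst|by []|].
    move=> x /andP[x0 xt]; exists 0, 0; split; [exact: isd_cst|exact: isd_cst|].
    rewrite (_ : 0 + 2 * 0 * 1 = 0); last by ring.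
    rewrite normr0 add0r mulr1 (_ : 0 + 0 ^+ 2 - 1 ^+ 2 + _ = (a x * xi i) ^+ 2 - 1);
      last by ring.
    apply: (le_trans (ler_normB _ _)); rewrite normr1 addrC lerD2l.
    rewrite ger0_norm ?sqr_ge0//.
    have /andP[a0 ax] := le_a (ltW x0); have /andP[dx xM] := xiI i.
    have xi0 : 0 <= xi i by rewrite (le_trans _ dx)// ltW.
    have c20 : 0 <= c2.
      by rewrite -(pmulr_lge0 _ (lam_gt0 (ltW x0))); exact: le_trans ax.
    have le1 : a x * xi i <= c2 * lam s * M.
      apply: ler_pM => //; apply: (le_trans ax); apply: ler_wpM2l => //.
      by apply: lam_nd; [exact: ltW|rewrite (le_trans (ltW xt))].
    have ge0 : 0 <= a x * xi i by exact: mulr_ge0.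
    by rewrite lerXn2r// nnegrE// (le_trans ge0).
apply: (le_trans est); rewrite divr1 subr0; apply: ler_pM.
- exact: expR_ge0.
- apply: addr_ge0; last by apply: mulr_ge0 => //; exact: sqr_ge0.
  by apply: sumr_ge0 => i _; rewrite addr_ge0// sqr_ge0.
- by rewrite /B lerDl.
rewrite lerD2l ler_wpM2r//.
apply: (@le_trans _ _ ((1 + s) ^+ 2)); last by rewrite /B lerDr expR_ge0.
by rewrite lerXn2r ?nnegrE ?addr_ge0// lerD2l.
Qed.

(** For [t <= s] the values of [lam] lie between [lam 0] and [lam s]. *)
Lemma transfers_from_origin : adapted_frames a lam d M s ->
  exists C, 0 < C /\ forall t, 0 <= t ->
    exists D, 0 <= D /\ transfers a lam d M 0 t C D.
Proof.
move=> /adapted_frames_transfers[C1 [C10 tr1]].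
have [B [B0 bt]] := bounded_time_estimate.
have l0 : 0 < lam 0 by exact: lam_gt0.
have ls : 0 < lam s by exact: lam_gt0.
have C2 : 0 < B * (lam s + (lam 0)^-1) by rewrite mulr_gt0// addr_gt0// invr_gt0.
exists (B * C1 + B * (lam s + (lam 0)^-1)); split.
  by rewrite addr_gt0// mulr_gt0.
move=> t t0; have lt0 := lam_gt0 t0.
have [st|ts] := leP s t.
  have [D [D0 tr]] := tr1 _ st.
  exists (B * (D + B)); split.
    by apply: mulr_ge0; [exact: ltW|apply: addr_ge0 => //; exact: ltW].
  move=> I xi f p q F xiI osc leF.
  have ss : 0 <= s <= s by rewrite s0 lexx.
  apply: (le_trans (bt I xi f p q F s t xiI ss st osc leF)).
  have := tr I xi f p q F xiI osc leF.
  set S := \sum_i (q i t ^+ 2 + lam t ^+ 2 * p i t ^+ 2) => h.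
  have S0 : 0 <= S.
    apply: sumr_ge0 => i _; apply: addr_ge0; first exact: sqr_ge0.
    by apply: mulr_ge0; exact: sqr_ge0.
  have : 0 <= B * (lam s + (lam 0)^-1) / lam t * S.
    by apply: mulr_ge0 => //; apply: divr_ge0; exact: ltW.
  have := ler_wpM2l (ltW B0) h.
  by lra.
exists (B * B); split; first by apply: mulr_ge0; exact: ltW.
move=> I xi f p q F xiI osc leF.
have tts : 0 <= t <= s by rewrite t0 ltW.
apply: (le_trans (bt I xi f p q F t t xiI tts (lexx t) osc leF)).
rewrite mulrDr mulrA lerD2r.
set S := \sum_i (q i t ^+ 2 + lam t ^+ 2 * p i t ^+ 2).
have S0 : 0 <= S.
  apply: sumr_ge0 => i _; apply: addr_ge0; first exact: sqr_ge0.
  by apply: mulr_ge0; exact: sqr_ge0.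
apply: (@le_trans _ _ (B * (lam s + (lam 0)^-1) / lam t * S)); last first.
  rewrite ler_wpM2r// ler_pM2r ?invr_gt0// lerDr.
  by apply: mulr_ge0; exact: ltW.
rewrite -2!mulrA ler_pM2l// mulrA /S mulr_sumr; apply: ler_sum => i _.
have lt1 : lam t != 0 by rewrite gt_eqF.
have e1 : q i t ^+ 2 <= lam s / lam t * q i t ^+ 2.
  rewrite ler_peMl ?sqr_ge0// ler_pdivlMr// mul1r.
  by apply: lam_nd => //; exact: ltW.
have e2 : p i t ^+ 2 <= lam t / lam 0 * p i t ^+ 2.
  by rewrite ler_peMl ?sqr_ge0// ler_pdivlMr// mul1r lam_nd.
have e3 : 0 <= lam s / lam t * (lam t ^+ 2 * p i t ^+ 2).
  apply: mulr_ge0; first by apply: divr_ge0; exact: ltW.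
  by apply: mulr_ge0; exact: sqr_ge0.
have e4 : 0 <= (lam 0)^-1 / lam t * q i t ^+ 2.
  apply: mulr_ge0; last exact: sqr_ge0.
  by apply: divr_ge0; [rewrite invr_ge0; exact: ltW|exact: ltW].
have -> : (lam s + (lam 0)^-1) / lam t * (q i t ^+ 2 + lam t ^+ 2 * p i t ^+ 2) =
  lam s / lam t * q i t ^+ 2 + lam t / lam 0 * p i t ^+ 2 +
  lam s / lam t * (lam t ^+ 2 * p i t ^+ 2) + (lam 0)^-1 / lam t * q i t ^+ 2.
  by field; rewrite lt1 gt_eqF.
by move: e1 e2 e3 e4; lra.
Qed.

End adapted.
End transfer.

(** * Primitives and one-sided derivatives on the half-line *)

Section half_line_calculus.
Context {R : realType}.
Implicit Types (f g : R -> R) (s t x : R).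
Local Notation mu := (@lebesgue_measure R).

Definition primitive f s x : R := \int[mu]_(y in `[s, x]) f y.

Lemma continuous_itv_integrable f s t :
  {within `[s, +oo[, continuous f} -> mu.-integrable `[s, t] (EFin \o f).
Proof.
move=> cf; apply: continuous_compact_integrable; first exact: segment_compact.
apply: continuous_subspaceW cf => x /=.
by rewrite !in_itv/= andbT => /andP[].
Qed.

Lemma within_itvy_for f s x :
  {within `[s, +oo[, continuous f} -> s < x -> {for x, continuous f}.
Proof.
move=> cf sx.
have cf' : {within `]s, +oo[, continuous f}.
  apply: continuous_subspaceW cf => y /=; rewrite !in_itv/= !andbT; exact: ltW.
have xI : x \in `]s, +oo[%classic by rewrite inE/= in_itv/= sx.
by rewrite continuous_open_subspace// in cf'; exact: (cf' x xI).
Qed.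

Lemma is_derive_primitive f s x :
  {within `[s, +oo[, continuous f} -> s < x ->
  is_derive x 1 (primitive f s) (f x).
Proof.
move=> cf sx.
have xu : x < x + 1 by rewrite ltrDl.
have [dF F'] : derivable (primitive f s) x 1 /\ (primitive f s)^`()%classic x = f x.
  exact: continuous_FTC1_closed xu (continuous_itv_integrable (x + 1) cf)
    sx (within_itvy_for cf sx).
by apply: DeriveDef; [exact: dF|rewrite -derive1E; exact: F'].
Qed.

Lemma continuous_primitive f s :
  {within `[s, +oo[, continuous f} ->
  {within `[s, +oo[, continuous (primitive f s)}.
Proof.
move=> cf; have c1 := parameterized_integral_continuous.
have {}c1 t : s <= t -> {within `[s, t], continuous (primitive f s)}.
  by move=> st; exact: (c1 R s t f st (continuous_itv_integrable t cf)).
apply/subspace_continuousP => x /=; rewrite in_itv/= andbT => sx.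
have sx1 : s <= x + 1 by rewrite (le_trans sx)// lerDl.
have /subspace_continuousP/(_ x) := c1 _ sx1.
rewrite /= in_itv/= sx lerDl ler01 => /(_ isT).
apply: cvg_trans; apply: cvg_app.
move=> P /=; rewrite !nbhs_simpl /within /=.
have near_x : \forall y \near x, y <= x + 1.
  by near=> y; apply: ltW; near: y; apply: lt_nbhsl; rewrite ltrDl.
move=> nP; near=> y; rewrite /= in_itv/= andbT => sy.
have : y \in `[s, x + 1] -> P y by near: y; exact: nP.
by apply; rewrite in_itv/= sy/=; near: y.
Unshelve. all: by end_near. Qed.

Lemma primitive_start f s : primitive f s s = 0.
Proof. by rewrite /primitive set_itv1 Rintegral_set1. Qed.

Lemma primitive_nondecreasing f s x y :
  {within `[s, +oo[, continuous f} -> (forall z, s <= z -> 0 <= f z) ->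
  s <= x -> x <= y -> primitive f s x <= primitive f s y.
Proof.
move=> cf f0 sx xy.
apply: (@ger0_derive1_ndecr _ (primitive f s) s y) => //.
- by move=> z; rewrite in_itv/= => /andP[sz _]; have [] := is_derive_primitive cf sz.
- move=> z; rewrite in_itv/= => /andP[sz _]; rewrite derive1E.
  by have /@derive_val -> := is_derive_primitive cf sz; exact/f0/ltW.
- apply: continuous_subspaceW (continuous_primitive cf) => z /=.
  by rewrite !in_itv/= andbT => /andP[].
Qed.

(** Away from the origin the one-sided notions are the ordinary ones. *)
Lemma hl_cvg_is_derive f t (l : R) : 0 < t ->
  hl_quot f t @ hl_incr t --> l -> is_derive t 1 f l.
Proof.
move=> t0 fl.
have incr0 : \forall h \near (0:R)^', 0 <= t + h.
  have : \forall h \near (0:R), 0 <= t + h.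
    near=> h; have : - t < h by near: h; apply: lt_nbhsr; rewrite oppr_lt0.
    by lra.
  exact: nbhs_dnbhs.
have fl' : (fun h => h^-1 *: (f (h *: 1 + t) - f t)) @ (0:R)^' --> l.
  move=> P /fl; rewrite /hl_incr /hl_quot !nbhs_simpl /within /= => nP.
  near=> h; rewrite /= /GRing.scale /= mulr1 [h + t]addrC.
  have /= : 0 <= t + h -> P (h^-1 * (f (t + h) - f t)) by near: h; exact: nP.
  by apply; near: h.
split; first by apply/cvg_ex; exists l; exact: fl'.
exact: (cvg_lim _ fl').
Unshelve. all: by end_near. Qed.

#[local] Instance hl_incr_filter t : Filter (hl_incr t).
Proof. exact: within_filter. Qed.

Lemma hl_incr_ge0 t : \forall h \near hl_incr t, 0 <= t + h.
Proof. exact: withinT. Qed.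

(** The increment [h = 0], which [hl_incr t] leaves out, contributes nothing. *)
Lemma hl_continuous_within f : (forall t, 0 <= t -> (fun h => f (t + h)) @ hl_incr t --> f t) ->
  {within `[0, +oo[, continuous f}.
Proof.
move=> cf; apply/subspace_continuousP => t /=; rewrite in_itv/= andbT => t0.
apply/cvgrPdist_le => /= e e0.
have : \forall h \near hl_incr t, `|f t - f (t + h)| <= e.
  by move/cvgrPdist_le : (cf t t0); apply.
rewrite /within/= near_withinE/= /hl_incr near_withinE /dnbhs near_withinE => q1.
suff : \forall x \near (t : R), 0 <= x -> `|f t - f x| <= e.
  by apply: filterS => x h; rewrite /= in_itv/= andbT; exact: h.
apply/nbhs0P; apply: filterS q1 => h q1 th.
by have [->|h0] := eqVneq h 0; [rewrite addr0 subrr normr0 ltW|exact: q1].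
Qed.

Lemma hl_incr_cvg0 t : (fun h => h) @ hl_incr t --> 0.
Proof. by apply: cvg_within_filter; apply: cvg_within. Qed.

Lemma hl_cvg_continuous f : (forall t, 0 <= t -> hl_derivable f t) ->
  {within `[0, +oo[, continuous f}.
Proof.
move=> df; apply: hl_continuous_within => t t0.
have /cvg_ex[/= l fl] := df _ t0.
have : (fun h => f t + h * hl_quot f t h) @ hl_incr t --> f t + 0 * l.
  by apply: cvgD; [exact: cvg_cst|apply: cvgM => //; exact: hl_incr_cvg0].
rewrite mul0r addr0; apply: cvg_trans; apply: near_eq_cvg.
have : \forall h \near hl_incr t, h != 0.
  by rewrite /hl_incr near_withinE; apply: filterS (nbhs_dnbhs_neq (0:R)).
apply: filterS => h h0; rewrite /hl_quot mulrA divff// mul1r addrC subrK//.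
Qed.

Lemma hl_Ck_is_derive k f j t : hl_Ck k f -> (j < k)%N -> 0 < t ->
  is_derive t 1 (hl_deriven j f) (hl_deriven j.+1 f t).
Proof.
by move=> [df _] jk t0; apply: hl_cvg_is_derive => //; exact: (df j t jk (ltW t0)).
Qed.

Lemma continuous_bounded f t : 0 <= t ->
  {within `[0, +oo[, continuous f} ->
  exists B : R, forall x : R, 0 <= x <= t -> `|f x| <= B.
Proof.
move=> t0 cf.
have cf' : {within `[0, t], continuous (fun x => `|f x|)}.
  apply: cw_abs; apply: continuous_subspaceW cf => x /=.
  by rewrite !in_itv/= andbT => /andP[].
have [c _ fc] := EVT_max t0 cf'.
by exists `|f c| => x xI; exact: fc.
Qed.

End half_line_calculus.

(** * Frames when the oscillations of the coefficient are integrable *)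

Section stabilised.
Context {R : realType}.
Variables (a lam lam1 lam2 : R -> R) (C1 C2 c2 K d M : R).
Hypothesis cont_a : {within `[0, +oo[, continuous a}.
Hypothesis cont_lam : {within `[0, +oo[, continuous lam}.
Hypothesis cont_lam1 : {within `[0, +oo[, continuous lam1}.
Hypothesis dlam : forall t : R, 0 < t -> is_derive t 1 lam (lam1 t).
Hypothesis dlam1 : forall t : R, 0 < t -> is_derive t 1 lam1 (lam2 t).
Hypothesis lam_gt0 : forall t : R, 0 <= t -> 0 < lam t.
Hypothesis C1_ge0 : 0 <= C1.
Hypothesis C2_ge0 : 0 <= C2.
Hypothesis c2_ge0 : 0 <= c2.
Hypothesis d_gt0 : 0 < d.
Hypothesis le_lam1 : forall t : R, 0 <= t ->
  `|lam1 t| <= C1 * (lam t * (lam t / Lambda lam t)).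
Hypothesis le_lam2 : forall t : R, 0 <= t ->
  `|lam2 t| <= C2 * (lam t * (lam t / Lambda lam t) ^+ 2).
Hypothesis le_a : forall t : R, 0 <= t -> 0 <= a t <= c2 * lam t.
Hypothesis le_K : forall t : R, 0 <= t ->
  primitive (fun s => `|a s - lam s|) 0 t <= K.

Lemma LambdaE t : Lambda lam t = 1 + primitive lam 0 t.
Proof. by []. Qed.

Lemma Lambda_ge1 t : 0 <= t -> 1 <= Lambda lam t.
Proof.
move=> t0; rewrite LambdaE lerDl.
have := primitive_nondecreasing cont_lam
  (fun z z0 => ltW (lam_gt0 z0)) (lexx 0) t0.
by rewrite primitive_start.
Qed.

(** The comparison coefficient [lam] has the explicit frame
    [be = xi lam], [al = - lam' / (2 lam)], with [be' + 2 al be = 0]; its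
    residual consists of [lam'' / lam] and [(lam' / lam)^2], of the integrable
    relative size [lam / Lambda^2 = - (1 / Lambda)'], and of
    [(a^2 - lam^2) xi^2]. *)
Lemma stabilised_adapted_frames : adapted_frames a lam d M 0.
Proof.
pose K1 := (C2 / 2 + C1 ^+ 2) / d; pose K2 := (1 + c2) * M.
pose g (s : R) : R := `|a s - lam s|.
have cg : {within `[0, +oo[, continuous g} by apply: cw_abs; exact: cwB.
have K1_ge0 : 0 <= K1.
  apply: divr_ge0; last exact: ltW.
  by apply: addr_ge0; [exact: divr_ge0|exact: sqr_ge0].
exists d, M, (C1 / 2), (K1 + K2 * K); split => // xi /andP[dxi xiM].
have xi0 : 0 < xi by exact: lt_le_trans dxi.
have K2_ge0 : 0 <= K2.
  by apply: mulr_ge0; [exact: addr_ge0|exact: le_trans (ltW xi0) xiM].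
pose L := Lambda lam.
have dL (t : R) : 0 < t -> is_derive t 1 L (lam t).
  move=> t0; apply: (is_derive_eq
    (isdD (isd_cst (1 : R) t) (is_derive_primitive cont_lam t0))).
  by rewrite add0r.
have cL : {within `[0, +oo[, continuous L}.
  by apply: cwD; [exact: cw_cst|exact: continuous_primitive].
have L1 (t : R) : 0 <= t -> 1 <= L t by exact: Lambda_ge1.
have L0 (t : R) : 0 <= t -> 0 < L t by move=> t0; rewrite (lt_le_trans ltr01)// L1.
pose H t := K1 * - (L t)^-1 + K2 * primitive g 0 t.
exists (fun t => K1 * (lam t / L t ^+ 2) + K2 * g t), H,
  (fun t => - (lam1 t / (2 * lam t))), (fun t => xi * lam t) => t t0.
have sub : `[0, t]%classic `<=` (`[0, +oo[%classic : set R).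
  by move=> x /=; rewrite !in_itv/= andbT => /andP[].
have lam2_neq0 (x : R) : 0 <= x -> 2 * lam x != 0.
  by move=> x0; rewrite gt_eqF// mulr_gt0// lam_gt0.
have bnd (x : R) : 0 <= x -> `|lam1 x / lam x| <= C1 * (lam x / L x).
  move=> x0; have l0 := lam_gt0 x0.
  rewrite normrM [`|_^-1|]gtr0_norm ?invr_gt0// ler_pdivrMr//.
  by rewrite (le_trans (le_lam1 x0))// le_eqVlt; apply/orP; left; apply/eqP; ring.
split.
- split.
  + apply: cwN; apply: cwM; first exact: continuous_subspaceW cont_lam1.
    apply: cwV; first by move=> x /= ; rewrite in_itv/= => /andP[/lam2_neq0].
    by apply: cwM; [exact: cw_cst|exact: continuous_subspaceW cont_lam].
  + by apply: cwM; [exact: cw_cst|exact: continuous_subspaceW cont_lam].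
  + by move=> x /andP[x0 _]; rewrite mulr_gt0// lam_gt0.
  + move=> x /andP[x0 _].
    have l0 : 0 < lam x by rewrite lam_gt0// ltW.
    have l1 : lam x != 0 by rewrite gt_eqF.
    eexists; eexists; split.
    * exact: (isdN (@isd_div _ lam1 (fun y => 2 * lam y) x _ _
        (lam2_neq0 _ (ltW x0)) (dlam1 x0) (isdZ 2 (dlam x0)))).
    * exact: (isdZ xi (dlam x0)).
    * rewrite (_ : xi * lam1 x + _ = 0); last by field.
      rewrite normr0 add0r.
      rewrite (_ : _ + (a x * xi) ^+ 2 = - (lam2 x / (2 * lam x))
        + 3 / 4 * (lam1 x / lam x) ^+ 2
        + (a x - lam x) * ((a x + lam x) * xi ^+ 2)); last by field.
      have Lx := L0 _ (ltW x0).
      have h1 : `|lam2 x / (2 * lam x)| <= C2 / 2 * (lam x / L x) ^+ 2.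
        rewrite normrM [`|_^-1|]gtr0_norm ?invr_gt0 ?mulr_gt0//.
        rewrite ler_pdivrMr ?mulr_gt0// (le_trans (le_lam2 (ltW x0)))//.
        by rewrite le_eqVlt; apply/orP; left; apply/eqP; rewrite /L; field; rewrite gt_eqF.
      have h2 : `|3 / 4 * (lam1 x / lam x) ^+ 2| <= C1 ^+ 2 * (lam x / L x) ^+ 2.
        rewrite normrM normrX -exprMn.
        have e := bnd _ (ltW x0).
        apply: (@le_trans _ _ (1 * `|lam1 x / lam x| ^+ 2)).
          rewrite ler_wpM2r ?sqr_ge0// ger0_norm ?divr_ge0//.
          by rewrite ler_pdivrMr// mul1r ler_nat.
        by rewrite mul1r lerXn2r// nnegrE (le_trans _ e).
      have /andP[a0 ax] := le_a (ltW x0).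
      have h3 : `|(a x - lam x) * ((a x + lam x) * xi ^+ 2)| <=
          K2 * g x * (xi * lam x).
        rewrite normrM -/(g x).
        rewrite (_ : K2 * _ * _ = g x * (K2 * (xi * lam x))); last by ring.
        apply: ler_wpM2l; first exact: normr_ge0.
        rewrite ger0_norm; last first.
          by apply: mulr_ge0; [apply: addr_ge0 => //; exact: ltW|exact: sqr_ge0].
        rewrite /K2 (_ : (1 + c2) * M * _ = ((1 + c2) * lam x) * (xi * M));
          last by ring.
        apply: ler_pM.
        + by apply: addr_ge0 => //; exact: ltW.
        + exact: sqr_ge0.
        + by move: ax; lra.
        + by rewrite expr2 ler_pM2l.
      have h4 : (C2 / 2 + C1 ^+ 2) * (lam x / L x) ^+ 2 <=
          K1 * (lam x / L x ^+ 2) * (xi * lam x).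
        rewrite (_ : K1 * _ * _ = (K1 * xi) * (lam x / L x) ^+ 2); last first.
          by field; rewrite gt_eqF.
        rewrite ler_wpM2r ?sqr_ge0//.
        have -> : C2 / 2 + C1 ^+ 2 = K1 * d by rewrite /K1 divfK// gt_eqF.
        by rewrite ler_wpM2l.
      apply: (le_trans (ler_normD _ _)).
      have h5 := ler_normD (- (lam2 x / (2 * lam x))) (3 / 4 * (lam1 x / lam x) ^+ 2).
      rewrite normrN in h5.
      by rewrite [leRHS]mulrDl; move: h1 h2 h3 h4 h5; lra.
- apply: cwD; apply: cwM; [exact: cw_cst| |exact: cw_cst|].
  + apply: cwN; apply: cwV; last exact: continuous_subspaceW cL.
    by move=> x /=; rewrite in_itv/= => /andP[x0 _]; rewrite gt_eqF// L0.
  + exact: continuous_subspaceW (continuous_primitive cg).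
- move=> x x0; have Lx : L x != 0 by rewrite gt_eqF// L0// ltW.
  split.
    apply: (is_derive_eq (isdD (isdZ K1 (isdN (isdV Lx (dL _ x0))))
      (isdZ K2 (is_derive_primitive cg x0)))).
    by rewrite mulNr opprK.
  apply: addr_ge0; apply: mulr_ge0 => //; last exact: normr_ge0.
  by apply: divr_ge0; [exact/ltW/lam_gt0/ltW|exact: sqr_ge0].
- rewrite /H primitive_start mulr0 addr0.
  have -> : L 0 = 1 by rewrite /L LambdaE primitive_start addr0.
  rewrite invr1.
  have h1 : K2 * primitive g 0 t <= K2 * K by rewrite ler_wpM2l// le_K.
  have : 0 <= K1 * (L t)^-1 by rewrite mulr_ge0// invr_ge0 ltW// L0.
  by move: h1; lra.
- have l0 := lam_gt0 t0; split.
    by rewrite !ler_wpM2r// ltW.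
  rewrite normrN (_ : lam1 t / (2 * lam t) = (lam1 t / lam t) / 2); last first.
    by field; rewrite gt_eqF.
  rewrite normrM (_ : `|2^-1| = 2^-1); last by rewrite gtr0_norm// invr_gt0.
  rewrite mulrAC ler_pM2r ?invr_gt0//.
  apply: (le_trans (bnd _ t0)); rewrite ler_wpM2l// ler_pdivrMr ?L0//.
  by rewrite ler_peMr ?L1// ltW.
Qed.

End stabilised.

(** * Frames by iterated diagonalisation *)

Section symbols.
Context {R : realType}.
Variables (Xi : R -> R) (d M T : R).
Hypothesis Xi_gt0 : forall t, T <= t -> 0 < Xi t.
Implicit Types (w v : R -> R) (f g : R -> R -> R).

(** Symbols of weight [w] in the sense of pseudodifferential calculus: every
    time derivative costs a factor [1 / Xi], uniformly in the frequency. *)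
Fixpoint symbol k w f : Prop :=
  [/\ forall xi t, d <= xi <= M -> T <= t -> {for t, continuous (f xi)},
      exists C, 0 <= C /\
        forall xi t, d <= xi <= M -> T <= t -> `|f xi t| <= C * w t &
      if k is k'.+1 then exists g,
        (forall xi t, d <= xi <= M -> T <= t -> is_derive t 1 (f xi) (g xi t)) /\
        symbol k' (fun t => w t / Xi t) g
      else True].

Lemma symbol_cont k w f xi t : symbol k w f -> d <= xi <= M -> T <= t ->
  {for t, continuous (f xi)}.
Proof. by case: k => [|k] [cf _ _]; exact: cf. Qed.

Lemma symbol_bound k w f : symbol k w f -> exists C, 0 <= C /\
  forall xi t, d <= xi <= M -> T <= t -> `|f xi t| <= C * w t.
Proof. by case: k => [|k] []. Qed.

Lemma symbol_low k w f : symbol k.+1 w f -> symbol k w f.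
Proof.
elim: k w f => [|k IH] w f; first by case=> cf bf _; split.
by case=> cf bf [g [fg /IH sg]]; split => //; exists g.
Qed.

Lemma symbol_le k w v f c : 0 <= c -> (forall t, T <= t -> w t <= c * v t) ->
  symbol k w f -> symbol k v f.
Proof.
move=> c0; elim: k w v f => [|k IH] w v f wv [cf [C [C0 bf]] sf]; split => //;
  try by exists (C * c); split; [exact: mulr_ge0|];
    move=> xi t xiI Tt; rewrite (le_trans (bf _ _ xiI Tt))// -mulrA ler_wpM2l// wv.
have [g [fg sg]] := sf; exists g; split => //.
apply: IH sg => t Tt; rewrite mulrA ler_pM2r ?wv//.
by rewrite invr_gt0 Xi_gt0.
Qed.

Lemma symbol_eq k w v f : (forall t, T <= t -> w t = v t) ->
  symbol k w f -> symbol k v f.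
Proof. by move=> wv; apply: (symbol_le ler01) => t Tt; rewrite mul1r wv. Qed.

Lemma symbol0 k w : (forall t, T <= t -> 0 <= w t) ->
  symbol k w (fun _ _ => 0).
Proof.
elim: k w => [|k IH] w w0; split => //; try by move=> xi t _ _; exact: cst_continuous.
- by exists 0; split => // xi t _ _; rewrite normr0 mul0r.
- by exists 0; split => // xi t _ _; rewrite normr0 mul0r.
exists (fun _ _ => 0); split; first by move=> xi t _ _; exact: isd_cst.
by apply: IH => t Tt; apply: divr_ge0; [exact: w0|exact/ltW/Xi_gt0].
Qed.

Lemma symbol_cst k (c : R -> R) B : (forall xi, d <= xi <= M -> `|c xi| <= B) ->
  symbol k (fun=> 1) (fun xi _ => c xi).
Proof.
move=> cB; case: k => [|k]; split => //; try by move=> xi t _ _; exact: cst_continuous.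
- exists (Num.max B 0); split; first by rewrite le_max lexx orbT.
  by move=> xi t /cB h _; rewrite mulr1 le_max h.
- exists (Num.max B 0); split; first by rewrite le_max lexx orbT.
  by move=> xi t /cB h _; rewrite mulr1 le_max h.
exists (fun _ _ => 0); split; first by move=> xi t _ _; exact: isd_cst.
by apply: symbol0 => t Tt; apply: divr_ge0 => //; exact/ltW/Xi_gt0.
Qed.

Lemma symbolD k w f g : symbol k w f -> symbol k w g ->
  symbol k w (fun xi t => f xi t + g xi t).
Proof.
elim: k w f g => [|k IH] w f g [cf [C [C0 bf]] sf] [cg [D [D0 bg]] sg]; split => //;
  try by move=> xi t xiI Tt; apply: cvgD; [exact: cf|exact: cg].
- exists (C + D); split; first exact: addr_ge0.
  move=> xi t xiI Tt; rewrite mulrDl (le_trans (ler_normD _ _))//.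
  by apply: lerD; [exact: bf|exact: bg].
- exists (C + D); split; first exact: addr_ge0.
  move=> xi t xiI Tt; rewrite mulrDl (le_trans (ler_normD _ _))//.
  by apply: lerD; [exact: bf|exact: bg].
have [f' [ff' sf']] := sf; have [g' [gg' sg']] := sg.
exists (fun xi t => f' xi t + g' xi t); split; last exact: IH.
by move=> xi t xiI Tt; apply: isdD; [exact: ff'|exact: gg'].
Qed.

Lemma symbolM k w v f g : symbol k w f -> symbol k v g ->
  symbol k (fun t => w t * v t) (fun xi t => f xi t * g xi t).
Proof.
have bnd w' v' f' g' : (exists C, 0 <= C /\
      forall xi t, d <= xi <= M -> T <= t -> `|f' xi t| <= C * w' t) ->
    (exists C, 0 <= C /\
      forall xi t, d <= xi <= M -> T <= t -> `|g' xi t| <= C * v' t) ->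
    exists C, 0 <= C /\ forall xi t, d <= xi <= M -> T <= t ->
      `|f' xi t * g' xi t| <= C * (w' t * v' t :> R).
  move=> [C [C0 bf]] [D [D0 bg]]; exists (C * D); split; first exact: mulr_ge0.
  move=> xi t xiI Tt; rewrite normrM mulrACA.
  by apply: ler_pM => //; [exact: bf|exact: bg].
elim: k w v f g => [|k IH] w v f g.
  move=> [cf bf sf] [cg bg sg]; split => //; last exact: bnd.
  by move=> xi t xiI Tt; apply: cvgM; [exact: cf|exact: cg].
move=> sf0 sg0; have sfk := symbol_low sf0; have sgk := symbol_low sg0.
move: sf0 sg0 => [cf bf sf] [cg bg sg]; split => //; last 1 first.
- have [f' [ff' sf']] := sf; have [g' [gg' sg']] := sg.
  exists (fun xi t => f' xi t * g xi t + f xi t * g' xi t); split.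
    by move=> xi t xiI Tt; apply: isdM; [exact: ff'|exact: gg'].
  apply: symbolD.
    by apply: symbol_eq (IH _ _ _ _ sf' sgk) => t Tt; rewrite mulrAC.
  by apply: symbol_eq (IH _ _ _ _ sfk sg') => t Tt; rewrite mulrA.
- by move=> xi t xiI Tt; apply: cvgM; [exact: cf|exact: cg].
- exact: bnd.
Qed.

Lemma symbolZ k w f (c : R -> R) B : (forall xi, d <= xi <= M -> `|c xi| <= B) ->
  symbol k w f -> symbol k w (fun xi t => c xi * f xi t).
Proof.
move=> cB sf; apply: symbol_eq (symbolM (symbol_cst k cB) sf) => t _.
by rewrite mul1r.
Qed.

Lemma symbolN k w f : symbol k w f -> symbol k w (fun xi t => - f xi t).
Proof.
move=> sf; rewrite (_ : (fun _ _ => _) = fun xi t => -1 * f xi t).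
  by apply: (@symbolZ _ _ _ _ 1) => // xi _; rewrite normrN normr1.
by apply/funext => xi; apply/funext => t; rewrite mulN1r.
Qed.

Lemma symbolB k w f g : symbol k w f -> symbol k w g ->
  symbol k w (fun xi t => f xi t - g xi t).
Proof. by move=> sf sg; apply: symbolD => //; exact: symbolN. Qed.

Lemma symbolV k w f c : 0 < c -> (forall t, T <= t -> 0 < w t) ->
  (forall xi t, d <= xi <= M -> T <= t -> c * w t <= f xi t) ->
  symbol k w f -> symbol k (fun t => (w t)^-1) (fun xi t => (f xi t)^-1).
Proof.
move=> c0 w0 lef.
have f0 xi t : d <= xi <= M -> T <= t -> 0 < f xi t.
  by move=> xiI Tt; apply: lt_le_trans (lef _ _ xiI Tt); rewrite mulr_gt0// w0.
have fn0 xi t : d <= xi <= M -> T <= t -> f xi t != 0.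
  by move=> xiI Tt; rewrite gt_eqF// f0.
have bnd : exists C, 0 <= C /\ forall xi t, d <= xi <= M -> T <= t ->
    `|(f xi t)^-1| <= C * (w t)^-1.
  exists c^-1; split; first by rewrite invr_ge0 ltW.
  move=> xi t xiI Tt; rewrite gtr0_norm ?invr_gt0 ?f0//.
  by rewrite -invfM lef_pV2 ?posrE ?f0 ?mulr_gt0 ?w0// lef.
have cV cf : (forall xi t, d <= xi <= M -> T <= t -> {for t, continuous (f xi)}) ->
    forall xi t, d <= xi <= M -> T <= t -> {for t, continuous (fun t => (f xi t)^-1)}.
  by move=> {}cf xi t xiI Tt; apply: cvgV; [exact: fn0|exact: cf].
elim: k => [|k IH]; first by move=> [cf _ _]; split => //; exact: cV.
move=> sf0; have sV := IH (symbol_low sf0).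
move: sf0 => [cf bf [f' [ff' sf']]]; split => //; first exact: cV.
exists (fun xi t => - f' xi t * ((f xi t)^-1 * (f xi t)^-1)); split.
  move=> xi t xiI Tt; apply: (is_derive_eq (isdV (fn0 _ _ xiI Tt) (ff' _ _ xiI Tt))).
  by rewrite expr2 invfM.
apply: symbol_eq (symbolM (symbolN sf') (symbolM sV sV)) => t Tt.
have wt : w t != 0 by rewrite gt_eqF// w0.
have xt : Xi t != 0 by rewrite gt_eqF// Xi_gt0.
by field; rewrite xt wt.
Qed.

End symbols.

Section wkb.
Context {R : realType}.
Variables (a a1 lam Xi : R -> R) (d M T c1 : R) (m : nat).
Hypothesis d_gt0 : 0 < d.
Hypothesis c1_gt0 : 0 < c1.
Hypothesis Xi_gt0 : forall t : R, T <= t -> 0 < Xi t.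
Hypothesis lam_gt0 : forall t : R, T <= t -> 0 < lam t.
Hypothesis lamXi_ge1 : forall t : R, T <= t -> 1 <= lam t * Xi t.
Hypothesis le_a : forall t : R, T <= t -> c1 * lam t <= a t.
Hypothesis sym_a : symbol Xi d M T m lam (fun _ => a).
Hypothesis sym_a1 : forall k, (k < m)%N ->
  symbol Xi d M T k (fun t => lam t / Xi t) (fun _ => a1).

Local Notation sym := (symbol Xi d M T).
Local Notation wJ J := (fun t => lam t * ((Xi t)^-1 * ((lam t * Xi t) ^+ J)^-1)).

(** An approximate solution [al + i (xi a + ga)] of the Riccati equation whose
    residual [Rr + i Ri] is [J] orders smaller than the one of [i xi a]; [k]
    counts the derivatives of [a] that are still available. *)
Definition wkb_frame J k := exists al ga dal dga Rr Ri : R -> R -> R,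
  [/\ forall xi t, d <= xi <= M -> T <= t ->
        is_derive t 1 (al xi) (dal xi t) /\ is_derive t 1 (ga xi) (dga xi t),
      sym k.+1 (fun t => (Xi t)^-1) al /\ sym k.+1 (fun t => (Xi t)^-1) ga,
      sym k (wJ J) Rr /\ sym k (wJ J) Ri &
      forall xi t, d <= xi <= M -> T <= t -> let be := xi * a t + ga xi t in
        Rr xi t = dal xi t + al xi t ^+ 2 - be ^+ 2 + (a t * xi) ^+ 2 /\
        Ri xi t = xi * a1 t + dga xi t + 2 * al xi t * be].

Let xi_gt0 xi : d <= xi <= M -> 0 < xi.
Proof. by move=> /andP[/(lt_le_trans d_gt0)]. Qed.

Let a_gt0 t : T <= t -> 0 < a t.
Proof. by move=> Tt; apply: lt_le_trans (le_a Tt); rewrite mulr_gt0// lam_gt0. Qed.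

Let Xi_ge0 t : T <= t -> 0 <= Xi t.
Proof. by move=> Tt; exact/ltW/Xi_gt0. Qed.

Lemma wkb_frame0 k : (k < m)%N -> wkb_frame 0 k.
Proof.
move=> km; exists (fun _ _ => 0), (fun _ _ => 0), (fun _ _ => 0), (fun _ _ => 0).
exists (fun _ _ => 0), (fun xi t => xi * a1 t).
have w0 t : T <= t -> 0 <= (Xi t)^-1 by move=> Tt; rewrite invr_ge0 Xi_ge0.
split.
- by move=> xi t _ _; split; exact: isd_cst.
- by split; exact: symbol0.
- split.
    apply: symbol0 => // t Tt; rewrite expr0 invr1 mulr1.
    by apply: mulr_ge0; [exact/ltW/lam_gt0|exact: w0].
  apply: (symbol_eq Xi_gt0 (w := fun t => lam t / Xi t)).
    by move=> t Tt; rewrite expr0 invr1 mulr1.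
  apply: (@symbolZ _ _ _ _ _ Xi_gt0 _ _ (fun _ => a1) id M).
    by move=> xi xiI; rewrite gtr0_norm ?xi_gt0//; case/andP: xiI.
  exact: sym_a1.
- by move=> xi t _ _ /=; split; ring.
Qed.

(** With [phi = i xi a + psi] and residual [r], the correction
    [- r / (2 i xi a)] cancels [r] against the leading part [2 i xi a] of the
    linearised Riccati equation; what is left is smaller by [1 / (lam Xi)] and
    involves one derivative more. *)
Lemma wkb_frame_step J k : (k < m)%N -> wkb_frame J k.+1 -> wkb_frame J.+1 k.
Proof.
move=> km [al [ga [dal [dga [Rr [Ri [dag [sal sga] [sRr sRi] RE]]]]]]].
pose vJ t := (Xi t)^-1 * ((lam t * Xi t) ^+ J)^-1.
pose c (xi : R) := (2 * xi)^-1.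
have cB xi : d <= xi <= M -> `|c xi| <= (2 * d)^-1.
  move=> xiI; have x0 := xi_gt0 xiI.
  rewrite /c gtr0_norm ?invr_gt0 ?mulr_gt0// lef_pV2 ?posrE ?mulr_gt0//.
  by rewrite ler_pM2l//; case/andP: xiI.
have saV : sym k.+1 (fun t => (lam t)^-1) (fun _ t => (a t)^-1).
  apply: (@symbolV _ _ _ _ _ Xi_gt0 _ _ (fun _ => a) c1) => //.
    by move=> xi t _; exact: le_a.
  have : sym m lam (fun _ => a) by [].
  rewrite -(subnKC km); elim: (m - k.+1)%N => [|j IH]; first by rewrite addn0.
  by rewrite addnS => /symbol_low.
have sD r : sym k.+1 (wJ J) r -> sym k.+1 vJ (fun xi t => c xi * (r xi t * (a t)^-1)).
  move=> sr; apply: (symbolZ Xi_gt0 cB).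
  apply: (symbol_eq Xi_gt0 _ (symbolM Xi_gt0 sr saV)) => t Tt.
  have l1 : lam t != 0 by rewrite gt_eqF// lam_gt0.
  by rewrite mulrAC divff// mul1r.
pose Dr xi t := - (c xi * (Ri xi t * (a t)^-1)).
pose Di xi t := c xi * (Rr xi t * (a t)^-1).
have sDr : sym k.+1 vJ Dr by apply: symbolN => //; exact: sD.
have sDi : sym k.+1 vJ Di by exact: sD.
have [_ _ [dDr [Drd sdDr]]] := sDr.
have [_ _ [dDi [Did sdDi]]] := sDi.
have pow_ge1 t j : T <= t -> 1 <= (lam t * Xi t) ^+ j.
  by move=> Tt; rewrite exprn_ege1// lamXi_ge1.
have lX t : T <= t -> 0 < lam t * Xi t by move=> Tt; rewrite mulr_gt0 ?lam_gt0 ?Xi_gt0.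
have vJ_le t : T <= t -> vJ t <= 1 * (Xi t)^-1.
  move=> Tt; rewrite mul1r /vJ ler_piMr ?invr_ge0 ?Xi_ge0//.
  by rewrite invf_le1 ?pow_ge1// exprn_gt0// lX.
have wJS t : T <= t -> vJ t / Xi t = lam t * ((Xi t)^-1 * ((lam t * Xi t) ^+ J.+1)^-1).
  move=> Tt; rewrite /vJ exprS.
  have l1 : lam t != 0 by rewrite gt_eqF// lam_gt0.
  have x1 : Xi t != 0 by rewrite gt_eqF// Xi_gt0.
  by field; rewrite x1 l1 expf_neq0// mulf_neq0.
have sX : sym k.+1 (fun t => (Xi t)^-1) Dr.
  exact: (symbol_le Xi_gt0 ler01 vJ_le) sDr.
have sY : sym k.+1 (fun t => (Xi t)^-1) Di.
  exact: (symbol_le Xi_gt0 ler01 vJ_le) sDi.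
have prod1 f g : sym k.+1 (fun t => (Xi t)^-1) f -> sym k.+1 vJ g ->
    sym k (wJ J.+1) (fun xi t => f xi t * g xi t).
  move=> /symbol_low sf /symbol_low sg.
  apply: (symbol_eq Xi_gt0 _ (symbolM Xi_gt0 sf sg)) => t Tt.
  by rewrite -wJS// mulrC.
have sal' := symbol_low sal; have sga' := symbol_low sga.
have s2 f : sym k (wJ J.+1) f -> sym k (wJ J.+1) (fun xi t => 2 * f xi t).
  by apply: (@symbolZ _ _ _ _ _ _ _ _ _ (fun=> 2) 2) => // xi _; rewrite ger0_norm.
exists (fun xi t => al xi t + Dr xi t), (fun xi t => ga xi t + Di xi t),
  (fun xi t => dal xi t + dDr xi t), (fun xi t => dga xi t + dDi xi t),
  (fun xi t => dDr xi t + (2 * (al xi t * Dr xi t - ga xi t * Di xi t)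
     + (Dr xi t * Dr xi t - Di xi t * Di xi t))),
  (fun xi t => dDi xi t + 2 * (al xi t * Di xi t + ga xi t * Dr xi t
     + Dr xi t * Di xi t)).
split.
- move=> xi t xiI Tt; have [h1 h2] := dag _ _ xiI Tt.
  by split; apply: isdD => //; [exact: Drd|exact: Did].
- by split; exact: symbolD.
- have sdDr' := symbol_eq Xi_gt0 wJS sdDr.
  have sdDi' := symbol_eq Xi_gt0 wJS sdDi.
  split; apply: symbolD => //.
    apply: symbolD; last by apply: (symbolB Xi_gt0); exact: prod1.
    by apply: s2; apply: (symbolB Xi_gt0); exact: prod1.
  by apply: s2; apply: symbolD; [apply: symbolD|]; exact: prod1.
- move=> xi t xiI Tt /=.
  have xa1 : xi != 0 by rewrite gt_eqF// xi_gt0.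
  have xa2 : a t != 0 by rewrite gt_eqF// a_gt0.
  have [RrE RiE] := RE xi t xiI Tt.
  have e1 : 2 * (xi * a t) * Di xi t = Rr xi t.
    by rewrite /Di /c; field; rewrite xa1 xa2.
  have e2 : 2 * (xi * a t) * Dr xi t = - Ri xi t.
    by rewrite /Dr /c; field; rewrite xa1 xa2.
  move: (Dr xi t) (Di xi t) e1 e2 RrE RiE => x y e1 e2 RrE RiE.
  by split; move: e1 e2 RrE RiE; lra.
Qed.

(** Starting from [phi = i xi a], of residual [i xi a'], each correction uses up
    one of the [m - 1] derivatives of [a'] that are controlled. *)
Lemma wkb_frame_exists J : (J < m)%N -> wkb_frame J (m.-1 - J).
Proof.
elim: J => [|J IH] Jm; first by apply: wkb_frame0; lia.
apply: wkb_frame_step.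
  by lia.
have -> : (m.-1 - J.+1).+1 = (m.-1 - J)%N.
  by lia.
by apply: IH; exact: ltnW.
Qed.

End wkb.

Section wkb_frames.
Context {R : realType}.
Implicit Types x t T C B : R.
Local Notation mu := (@lebesgue_measure R).
Variables (A : nat -> R -> R) (lam Xi : R -> R) (d M c1 c2 : R) (m : nat).
Let a := A 0%N.
Hypothesis m_gt0 : (0 < m)%N.
Hypothesis d_gt0 : 0 < d.
Hypothesis c1_gt0 : 0 < c1.
Hypothesis Xi_gt0 : forall t : R, 0 <= t -> 0 < Xi t.
Hypothesis lam_gt0 : forall t : R, 0 <= t -> 0 < lam t.
Hypothesis lamXi_infty : forall N : R, exists T : R, forall t,
  T <= t -> N <= lam t * Xi t.
Hypothesis le_a : forall t : R, 0 <= t -> c1 * lam t <= a t <= c2 * lam t.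
Hypothesis dA : forall j (t : R), (j < m)%N -> 0 < t ->
  is_derive t 1 (A j) (A j.+1 t).
Hypothesis cA : forall j, (j <= m)%N -> {within `[0, +oo[, continuous (A j)}.
Hypothesis le_A : forall j, (1 <= j <= m)%N -> exists C, 0 < C /\
  forall t : R, 0 <= t -> `|A j t| <= C * (lam t * Xi t ^- j).
Hypothesis mf : measurable_fun (`[0, +oo[ : set R)
  (fun s => lam s ^- m.-1 * Xi s ^- m).
Hypothesis int_f : forall t : R, 0 <= t -> exists B : R,
  (\int[mu]_(s in `[t, +oo[) (lam s ^- m.-1 * Xi s ^- m)%:E <= B%:E)%E.

Lemma coefficient_bound T j : 0 < T -> (j <= m)%N -> exists C, 0 <= C /\
  forall xi t : R, d <= xi <= M -> T <= t -> `|A j t| <= C * (lam t * Xi t ^- j).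
Proof.
move=> T0 jm.
have [->|j0] := eqVneq j 0%N.
  exists c2; split.
    have /andP[h1 h2] := le_a (ltW T0); have l0 := lam_gt0 (ltW T0).
    rewrite -(pmulr_lge0 _ l0); apply: le_trans h2; apply: le_trans h1.
    by apply: mulr_ge0; exact: ltW.
  move=> xi t _ Tt; have t0 : 0 <= t by exact: le_trans (ltW T0) Tt.
  rewrite expr0 invr1 mulr1; have /andP[h1 h2] := le_a t0.
  rewrite ger0_norm// (le_trans _ h1)// mulr_ge0// ?ltW// lam_gt0//.
have j1 : (1 <= j <= m)%N by lia.
have [C [C0 bC]] := le_A j1; exists C; split; first exact: ltW.
by move=> xi t _ Tt; apply: bC; exact: le_trans (ltW T0) Tt.
Qed.

Lemma symbol_coefficient T j k : 0 < T -> (j + k <= m)%N ->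
  symbol Xi d M T k (fun t => lam t * Xi t ^- j) (fun _ => A j).
Proof.
move=> T0; elim: k j => [|k IH] j jk.
all: have jm : (j <= m)%N by lia.
all: have cj xi t : d <= xi <= M -> T <= t -> {for t, continuous (A j)} by
  move=> _ Tt; apply: within_itvy_for (cA jm) _; exact: lt_le_trans Tt.
all: have bj := coefficient_bound T0 jm.
- by split.
split => //; exists (fun _ => A j.+1); split.
  by move=> xi t _ Tt; apply: dA; [lia|exact: lt_le_trans Tt].
have Xg t : T <= t -> 0 < Xi t.
  by move=> Tt; apply: Xi_gt0; exact: le_trans (ltW T0) Tt.
apply: (symbol_eq Xg (w := fun t => lam t * Xi t ^- j.+1)).
- by move=> t Tt; rewrite exprSr invfM mulrA.
- by apply: IH; lia.
Qed.

Lemma primitive_le (eta f : R -> R) T t C B : 0 <= T -> T <= t -> 0 <= C ->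
  {within `[T, +oo[, continuous eta} -> measurable_fun (`[0, +oo[ : set R) f ->
  (forall x, T <= x -> 0 <= eta x) -> (forall x, T <= x -> 0 <= f x) ->
  (forall x, T <= x -> eta x <= C * f x) ->
  (\int[mu]_(x in `[T, +oo[) (f x)%:E <= B%:E)%E ->
  primitive eta T t <= C * B.
Proof.
move=> T0 Tt C0 ceta mef eta0 f0 le_eta leB.
have sub1 : `[T, t]%classic `<=` (`[T, +oo[%classic : set R).
  by move=> x /=; rewrite !in_itv/= andbT => /andP[].
have sub2 : `[T, +oo[%classic `<=` (`[0, +oo[%classic : set R).
  by move=> x /=; rewrite !in_itv/= !andbT; exact: le_trans.
have mf1 : measurable_fun (`[T, +oo[%classic : set R) (fun x => (f x)%:E).
  by apply/measurable_EFinP; apply: measurable_funS mef => //.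
have inte := continuous_itv_integrable t ceta.
rewrite -lee_fin /primitive /Rintegral fineK; last exact: integrable_fin_num.
apply: (@le_trans _ _ (\int[mu]_(x in `[T, t]) (C%:E * (f x)%:E))%E).
  apply: ge0_le_integral => //.
  - by move=> x /sub1 /=; rewrite in_itv/= andbT lee_fin => /eta0.
  - exact: measurable_int inte.
  - by apply: measurable_funeM; exact: measurable_funS mf1.
  - by move=> x /sub1 /=; rewrite in_itv/= andbT -EFinM lee_fin => /le_eta.
apply: (@le_trans _ _ (\int[mu]_(x in `[T, +oo[) (C%:E * (f x)%:E))%E).
  apply: ge0_subset_integral => //; first exact: measurable_funeM.
  by move=> x /=; rewrite in_itv/= andbT -EFinM lee_fin => /f0 fx; exact: mulr_ge0.
rewrite ge0_integralZl//.
- by rewrite EFinM lee_wpmul2l.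
- by move=> x /=; rewrite in_itv/= andbT lee_fin => /f0.
Qed.

(** After [m - 1] corrections the residual relative to [be] is at most a multiple
    of [lam^(1 - m) Xi^(- m)], which is integrable; [T] is taken so large that the
    corrections, of size [1 / Xi], are small compared with [lam]. *)
Lemma wkb_adapted_frames : exists T, 0 <= T /\ adapted_frames a lam d M T.
Proof.
have [T0 hT0] := lamXi_infty 1.
pose T1 := Num.max 1 T0.
have T1_gt0 : 0 < T1 by rewrite lt_max ltr01.
have gt1 t : T1 <= t -> 0 < t by exact: lt_le_trans.
have ge1 t : T1 <= t -> 0 <= t by move=> /gt1 /ltW.
have m1 : (m.-1 < m)%N by lia.
have X1 t : T1 <= t -> 0 < Xi t by move=> /ge1 /Xi_gt0.
have [al [ga [dal [dga [Rr [Ri [dag [sal sga] [sRr sRi] RE]]]]]]] :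
    wkb_frame a (A 1%N) lam Xi d M T1 m.-1 (m.-1 - m.-1).
  apply: (@wkb_frame_exists _ _ _ _ _ _ _ _ c1 m) => //.
  - by move=> t /ge1 /lam_gt0.
  - by move=> t; rewrite /T1 ge_max => /andP[_ /hT0].
  - by move=> t /ge1 /le_a /andP[].
  - apply: (symbol_eq X1 (w := fun t => lam t * Xi t ^- 0)).
      by move=> t _; rewrite expr0 invr1 mulr1.
    by apply: (@symbol_coefficient T1 0 m T1_gt0); lia.
  - by move=> k km; apply: (@symbol_coefficient T1 1 k T1_gt0); lia.
rewrite subnn in sal sga sRr sRi.
have [Ca [Ca0 bal]] := symbol_bound sal.
have [Cg [Cg0 bga]] := symbol_bound sga.
have [Cr [Cr0 bRr]] := symbol_bound sRr.
have [Ci [Ci0 bRi]] := symbol_bound sRi.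
(* Beyond this value of [lam Xi] the correction [ga] is at most half of [xi a]. *)
pose N := 2 * Cg / (d * c1).
have [T2 hT2] := lamXi_infty N.
pose T := Num.max T1 T2.
have TT1 t : T <= t -> T1 <= t by rewrite ge_max => /andP[].
have TN t : T <= t -> N <= lam t * Xi t by rewrite ge_max => /andP[_ /hT2].
have T_ge0 : 0 <= T by apply: ge1; apply: TT1.
have [B hB] := int_f T_ge0.
have dc : 0 < d * c1 by rewrite mulr_gt0.
pose b0 := d * c1 / 2.
have b0_gt0 : 0 < b0 by rewrite divr_gt0.
pose Ct := (Cr + Ci) / b0.
have Ct0 : 0 <= Ct by rewrite divr_ge0 ?addr_ge0// ltW.
have V_le t : T <= t -> (Xi t)^-1 <= lam t.
  move=> /TT1 Tt; have Xt := X1 _ Tt.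
  rewrite -[leLHS]mul1r ler_pdivrMr//.
  by apply: hT0; move: Tt; rewrite ge_max => /andP[].
have be_ge xi t : d <= xi <= M -> T <= t -> b0 * lam t <= xi * a t + ga xi t.
  move=> xiI Tt; have T1t := TT1 _ Tt.
  have g1 := bga _ _ xiI T1t.
  have Xt := X1 _ T1t; have lt := lam_gt0 (ge1 _ T1t).
  have g2 : Cg * (Xi t)^-1 <= b0 * lam t.
    rewrite ler_pdivrMr// -mulrA.
    have := TN _ Tt; rewrite /N ler_pdivrMr// /b0; lra.
  have /andP[a1 _] := le_a (ge1 _ T1t); have /andP[dx _] := xiI.
  have : d * (c1 * lam t) <= xi * a t.
    by apply: ler_pM => //; [exact: ltW|apply: mulr_ge0; exact: ltW].
  move: g1; rewrite ler_norml => /andP[+ _]; move: g2; rewrite /b0; lra.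
exists T; split => //.
exists b0, (M * c2 + Cg), Ca, (Ct * B); split => // xi xiI.
have xi0 : 0 < xi by case/andP: xiI => /(lt_le_trans d_gt0).
pose be t := xi * a t + ga xi t.
pose eta t := (`|Ri xi t| + `|Rr xi t|) / be t.
have be_gt0 t : T <= t -> 0 < be t.
  move=> Tt; apply: lt_le_trans (be_ge _ _ xiI Tt).
  by rewrite mulr_gt0// lam_gt0// ge1// TT1.
have for_be t : T <= t -> {for t, continuous be}.
  move=> Tt; apply: cvgD; last exact: symbol_cont sga xiI (TT1 _ Tt).
  apply: cvgM; first exact: cvg_cst.
  by apply: within_itvy_for (cA (leq0n _)) _; exact/gt1/TT1.
have ceta : {within `[T, +oo[, continuous eta}.
  apply: cw_for => t /=; rewrite in_itv/= andbT => Tt.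
  apply: cvgM; last by apply: cvgV; [rewrite gt_eqF// be_gt0|exact: for_be].
  apply: cvgD; apply: cvg_norm.
    exact: symbol_cont sRi xiI (TT1 _ Tt).
  exact: symbol_cont sRr xiI (TT1 _ Tt).
have eta0 t : T <= t -> 0 <= eta t.
  by move=> Tt; apply: divr_ge0; [rewrite addr_ge0|exact/ltW/be_gt0].
have eta_le t : T <= t -> eta t <= Ct * (lam t ^- m.-1 * Xi t ^- m).
  move=> Tt; have T1t := TT1 _ Tt; have t0 := ge1 _ T1t.
  have lt := lam_gt0 t0; have Xt := Xi_gt0 t0.
  rewrite ler_pdivrMr ?be_gt0//.
  apply: (le_trans (lerD (bRi _ _ xiI T1t) (bRr _ _ xiI T1t))).
  apply: (@le_trans _ _ (Ct * (lam t ^- m.-1 * Xi t ^- m) * (b0 * lam t))); last first.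
    apply: ler_wpM2l; last exact: be_ge.
    by apply: mulr_ge0 => //; apply: mulr_ge0; rewrite invr_ge0 exprn_ge0// ltW.
  rewrite -mulrDl le_eqVlt; apply/orP; left; apply/eqP.
  have -> : Xi t ^- m = (Xi t * Xi t ^+ m.-1)^-1 by rewrite -exprS prednK.
  rewrite exprMn /Ct.
  have l1 : lam t ^+ m.-1 != 0 by rewrite expf_neq0// gt_eqF.
  have x1 : Xi t ^+ m.-1 != 0 by rewrite expf_neq0// gt_eqF.
  have x2 : Xi t != 0 by rewrite gt_eqF.
  have b1 : b0 != 0 by rewrite gt_eqF.
  move: l1 x1; set X := Xi t ^+ _; set L := lam t ^+ _ => l1 x1.
  by field; rewrite b1 x1 x2 l1.
exists eta, (primitive eta T), (al xi), be => t Tt.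
have sub : `[T, t]%classic `<=` (`[T, +oo[%classic : set R).
  by move=> x /=; rewrite !in_itv/= andbT => /andP[].
split.
- split.
  + apply: cw_for => x /=; rewrite in_itv/= => /andP[Tx _].
    exact: symbol_cont sal xiI (TT1 _ Tx).
  + by apply: cw_for => x /=; rewrite in_itv/= => /andP[Tx _]; exact: for_be.
  + by move=> x /andP[Tx _]; exact: be_gt0.
  + move=> x /andP[/ltW Tx _]; have T1x := TT1 _ Tx.
    have [d1 d2] := dag _ _ xiI T1x; have [e1 e2] := RE _ _ xiI T1x.
    exists (dal xi x), (xi * A 1%N x + dga xi x); split => //.
      apply: isdD => //; apply: isdZ; apply: dA => //; exact: gt1.
    rewrite /eta divfK ?gt_eqF ?be_gt0// e1 e2.
    by rewrite le_eqVlt eqxx.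
- exact: continuous_subspaceW (continuous_primitive ceta).
- by move=> x Tx; split; [exact: is_derive_primitive|exact/eta0/ltW].
- rewrite primitive_start subr0.
  apply: primitive_le T_ge0 Tt Ct0 ceta mf eta0 _ eta_le hB.
  move=> x Tx; have x0 := ge1 _ (TT1 _ Tx).
  by apply: mulr_ge0; rewrite invr_ge0 exprn_ge0// ltW// ?lam_gt0 ?Xi_gt0.
- have T1t := TT1 _ Tt; have t0 := ge1 _ T1t; have lt := lam_gt0 t0.
  have VV := V_le _ Tt.
  split; last first.
    by apply: le_trans (bal _ _ xiI T1t) _; rewrite ler_wpM2l.
  apply/andP; split; first exact: be_ge.
  rewrite mulrDl; apply: lerD.
    rewrite -mulrA; have /andP[ad aM] := le_a t0; have /andP[_ xM] := xiI.
    apply: ler_pM => //; first exact: ltW.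
    by apply: le_trans ad; apply: mulr_ge0; exact: ltW.
  apply: le_trans (ler_norm _) _; apply: le_trans (bga _ _ xiI T1t) _.
  by rewrite ler_wpM2l.
Qed.

End wkb_frames.

(** * Frames for the coefficients of the wave equation *)

Section coefficient.
Context {R : realType}.
Implicit Types x t s T C K N : R.
Local Notation mu := (@lebesgue_measure R).
Variables (m : nat) (a lam omega Theta Xi : R -> R) (d M : R).
Hypothesis m_ge2 : (2 <= m)%N.
Hypothesis aCm : hl_Ck m a.
Hypothesis lamC2 : hl_Ck 2 lam.
Hypothesis aE : forall t, 0 <= t -> a t = lam t * omega t.
Hypothesis Xi_gt0 : forall t, 0 <= t -> 0 < Xi t.
Hypothesis hA1 : A1 lam.
Hypothesis hA2 : A2 omega.
Hypothesis hA3 : A3 lam omega Theta.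
Hypothesis hA4 : A4 m a lam Theta Xi.
Hypothesis hA5 : A5 m lam Theta Xi.
Hypothesis d_gt0 : 0 < d.

Lemma lam_gt0 t : 0 <= t -> 0 < lam t.
Proof. by case: hA1 => h _ _ /h[]. Qed.

Lemma lam_nondecreasing x y : 0 <= x -> x <= y -> lam x <= lam y.
Proof.
case: hA1 => lam' _ _ x0 xy.
have [_ clam] := lamC2.
apply: (@ger0_derive1_ndecr _ lam 0 y) => //.
- move=> t; rewrite in_itv/= => /andP[t0 _].
  by have [] := hl_Ck_is_derive lamC2 (isT : (0 < 2)%N) t0.
- move=> t; rewrite in_itv/= => /andP[t0 _]; rewrite derive1E.
  have /@derive_val -> := hl_Ck_is_derive lamC2 (isT : (0 < 2)%N) t0.
  by have [_ /ltW] := lam' _ (ltW t0).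
- apply: continuous_subspaceW (clam 0%N isT) => t /=.
  by rewrite !in_itv/= andbT => /andP[].
Qed.

Lemma continuous_coefficient : {within `[0, +oo[, continuous a}.
Proof. by have [_ ca] := aCm; exact: (ca 0%N isT). Qed.

Lemma le_coefficient : exists c1 c2, [/\ 0 < c1, 0 <= c2 &
  forall t, 0 <= t -> c1 * lam t <= a t <= c2 * lam t].
Proof.
have [c1 [c2 [c10 om]]] := hA2; exists c1, c2.
have c20 : 0 <= c2.
  have /andP[h1 h2] := om 0 (lexx 0).
  exact: le_trans (le_trans (ltW c10) h1) h2.
split => // t t0; rewrite aE// mulrC -![_ * lam t]mulrC.
by rewrite !ler_pM2l ?lam_gt0//; exact: om.
Qed.

Lemma stabilised_case K :
  (forall t, 0 <= t -> primitive (fun s => `|a s - lam s|) 0 t <= K) ->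
  adapted_frames a lam d M 0.
Proof.
move=> le_K; have [lam' [[C1 [C10 h1]] _] [C2 [C20 h2]]] := hA1.
have [_ clam] := lamC2.
have [c1 [c2 [c10 c20 lea]]] := le_coefficient.
apply: (@stabilised_adapted_frames R a lam (hl_derive lam) (hl_deriven 2 lam)
  C1 C2 c2 K) => //.
- exact: continuous_coefficient.
- exact: (clam 0%N isT).
- exact: (clam 1%N isT).
- by move=> t t0; exact: (hl_Ck_is_derive lamC2 (isT : (0 < 2)%N) t0).
- by move=> t t0; exact: (hl_Ck_is_derive lamC2 (isT : (1 < 2)%N) t0).
- exact: lam_gt0.
- exact: ltW.
- exact: ltW.
- move=> t t0; have [_ l'] := lam' _ t0.
  by rewrite gtr0_norm//; exact: h1.
- move=> t t0; have /andP[h3 h4] := lea _ t0; rewrite h4 andbT.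
  by apply: le_trans h3; apply: mulr_ge0; [exact: ltW|exact/ltW/lam_gt0].
Qed.

(** If the integral in the stabilisation condition is unbounded, monotonicity
    forces [Theta], hence [lam Xi], to tend to infinity. *)
Lemma unstabilised_lamXi_infty :
  ~ (exists K, forall t, 0 <= t -> primitive (fun s => `|a s - lam s|) 0 t <= K) ->
  forall N, exists T, forall t, T <= t -> N <= lam t * Xi t.
Proof.
move=> noK N.
have [[C [C0 le_C]] _] := hA3.
have [_ [C4 [C40 leT]]] := hA4.
pose th := primitive (fun s => `|a s - lam s|) 0.
have [t1 [t10 tht1]] : exists t1, 0 <= t1 /\ C * (C4 * N) < th t1.
  apply: contrapT => h; apply: noK; exists (C * (C4 * N)) => t t0.
  rewrite leNgt; apply/negP => ht; apply: h; exists t; split => //.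
have [_ clam] := lamC2.
have cg : {within `[0, +oo[, continuous (fun s => `|a s - lam s|)}.
  by apply: cw_abs; apply: cwB; [exact: continuous_coefficient|exact: (clam 0%N isT)].
move: le_C => [t2 [_ le_C]].
exists (Num.max t1 (t2 + 1)) => t; rewrite ge_max => /andP[t1t t2t].
have t0 : 0 <= t by exact: le_trans t1t.
have t2t' : t2 < t by apply: lt_le_trans t2t; rewrite ltrDl.
have {}le_C := le_C t t2t'.
have thE : \int[mu]_(s in `[0, t]) (lam s * `|omega s - 1|) = th t.
  apply: eq_Rintegral => s; rewrite inE/= in_itv/= => /andP[s0 _].
  rewrite aE// -{1}(gtr0_norm (lam_gt0 s0)) -normrM mulrBr mulr1//.
rewrite thE in le_C.
have th_le : th t1 <= th t.
  by apply: primitive_nondecreasing => // s _; exact: normr_ge0.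
have : C * (C4 * N) < C * Theta t by rewrite (lt_le_trans tht1)// (le_trans th_le).
rewrite ltr_pM2l// => h.
have := lt_le_trans h (leT _ t0).
by rewrite ltr_pM2l// => /ltW.
Qed.

Lemma unstabilised_case :
  ~ (exists K, forall t, 0 <= t -> primitive (fun s => `|a s - lam s|) 0 t <= K) ->
  exists T, 0 <= T /\ adapted_frames a lam d M T.
Proof.
move=> noK; have [c1 [c2 [c10 c20 lea]]] := le_coefficient.
have [leA _] := hA4; have [mf [C5 [C50 int_f]]] := hA5.
have [_ ca] := aCm.
apply: (@wkb_adapted_frames R (hl_deriven^~ a) lam Xi d M c1 c2 m) => //.
- by lia.
- exact: lam_gt0.
- exact: unstabilised_lamXi_infty.
- by move=> j t jm t0; exact: hl_Ck_is_derive aCm jm t0.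
- by move=> t t0; exists (C5 * Theta t ^- m.-1); exact: int_f.
Qed.

(** Either [a] stays integrably close to [lam], and then [lam] serves as
    comparison coefficient, or [lam Xi] tends to infinity, and then the iterated
    diagonalisation of [a] itself produces a frame. *)
Theorem oscillator_energy_lower_bound :
  exists C, 0 < C /\ forall t, 0 <= t ->
    exists D, 0 <= D /\ transfers a lam d M 0 t C D.
Proof.
have [c1 [c2 [c10 c20 lea]]] := le_coefficient.
suff [T [T0 fr]] : exists T, 0 <= T /\ adapted_frames a lam d M T.
  apply: (transfers_from_origin T0 lam_gt0 lam_nondecreasing (c2 := c2)) => //.
  move=> t t0; have /andP[h3 h4] := lea _ t0; rewrite h4 andbT.
  by apply: le_trans h3; apply: mulr_ge0; [exact: ltW|exact/ltW/lam_gt0].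
have [[K le_K]|noK] := pselect (exists K, forall t, 0 <= t ->
    primitive (fun s => `|a s - lam s|) 0 t <= K).
  by exists 0; split => //; exact: stabilised_case le_K.
exact: unstabilised_case.
Qed.

End coefficient.

(** * Smooth functions of one variable and a bump function *)

Section smooth1.
Context {R : realType}.
Implicit Types (f g : R -> R) (x c L : R).

Fixpoint Cdiff k f : Prop :=
  if k is k'.+1 then (forall x, derivable f x 1) /\ Cdiff k' f^`()%classic
  else True.

Definition smooth f := forall k, Cdiff k f.

Lemma derive1_eq f g : (forall x, is_derive x 1 f (g x)) -> f^`()%classic = g.
Proof.
by move=> fg; apply/funext => x; rewrite derive1E; have /@derive_val -> := fg x.
Qed.

Lemma CdiffS k f g : (forall x, is_derive x 1 f (g x)) -> Cdiff k g -> Cdiff k.+1 f.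
Proof.
move=> fg ck; split; first by move=> x; have [] := fg x.
by rewrite (derive1_eq fg).
Qed.

Lemma Cdiff_is_derive k f x : Cdiff k.+1 f -> is_derive x 1 f (f^`()%classic x).
Proof. by case=> df _; rewrite derive1E; exact: derivableP. Qed.

Lemma Cdiff_low k f : Cdiff k.+1 f -> Cdiff k f.
Proof. by elim: k f => // k IH f [df /IH]. Qed.

Lemma smooth_is_derive f x : smooth f -> is_derive x 1 f (f^`()%classic x).
Proof. by move=> /(_ 1%N); exact: Cdiff_is_derive. Qed.

Lemma smooth_derive1 f : smooth f -> smooth f^`()%classic.
Proof. by move=> sf k; have [] := sf k.+1. Qed.

Lemma smooth_continuous f : smooth f -> continuous f.
Proof. by move=> sf x; exact: isd_cont (smooth_is_derive x sf). Qed.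

Lemma Cdiff_cst k c : Cdiff k (fun=> c).
Proof.
elim: k c => // k IH c; apply: (CdiffS (g := fun=> 0)) => // x; exact: isd_cst.
Qed.

Lemma CdiffD k f g : Cdiff k f -> Cdiff k g -> Cdiff k (fun x => f x + g x).
Proof.
elim: k f g => // k IH f g cf cg.
apply: (CdiffS (g := fun x => f^`()%classic x + g^`()%classic x)).
  by move=> x; exact: (isdD (Cdiff_is_derive x cf) (Cdiff_is_derive x cg)).
have [_ cf'] := cf; have [_ cg'] := cg; exact: IH.
Qed.

Lemma CdiffM k f g : Cdiff k f -> Cdiff k g -> Cdiff k (fun x => f x * g x).
Proof.
elim: k f g => // k IH f g cf cg.
pose df : R -> R := f^`()%classic; pose dg : R -> R := g^`()%classic.
have dfg (x : R) : is_derive x 1 (fun x => f x * g x) (df x * g x + f x * dg x).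
  exact: (isdM (Cdiff_is_derive x cf) (Cdiff_is_derive x cg)).
apply: (CdiffS dfg).
have [_ cf'] := cf; have [_ cg'] := cg.
by apply: CdiffD; apply: IH => //; exact: Cdiff_low.
Qed.

Lemma Cdiff_affine k f c b : Cdiff k f -> Cdiff k (fun x => f (c * x + b)).
Proof.
elim: k f => // k IH f cf.
pose df : R -> R := f^`()%classic; pose g x := c * df (c * x + b).
apply: (@CdiffS k _ g).
  move=> x; apply: (is_derive_eq (@isd_comp _ f (fun y => c * y + b) x _ _
    (Cdiff_is_derive (c * x + b) cf) (isdD (isdZ c (isd_id x)) (isd_cst b x)))).
  by rewrite mulr1 addr0 mulrC.
by apply: (@CdiffM k (fun=> c) (fun x => df (c * x + b))); [exact: Cdiff_cst|apply: IH; have [] := cf].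
Qed.

Lemma smoothM f g : smooth f -> smooth g -> smooth (fun x => f x * g x).
Proof. by move=> sf sg k; apply: CdiffM. Qed.

Lemma smooth_affine f c b : smooth f -> smooth (fun x => f (c * x + b)).
Proof. by move=> sf k; exact: Cdiff_affine. Qed.

Lemma Cdiff_sin_cos k : Cdiff k (@sin R) /\ Cdiff k (@cos R).
Proof.
elim: k => // k [IHs IHc]; split.
  by apply: (CdiffS (g := cos)) => // x; exact: is_derive_sin.
apply: (CdiffS (g := fun x => -1 * sin x)).
  by move=> x; rewrite mulN1r; exact: is_derive_cos.
by apply: CdiffM => //; exact: Cdiff_cst.
Qed.

Lemma smooth_sin : smooth (@sin R). Proof. by move=> k; case: (Cdiff_sin_cos k). Qed.
Lemma smooth_cos : smooth (@cos R). Proof. by move=> k; case: (Cdiff_sin_cos k). Qed.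

(** [s ^- k * exp (- 1 / s)] for [s > 0], extended by [0]: the span of this
    family is stable under differentiation. *)
Definition flat k x : R := if 0 < x then x ^- k * expR (- x^-1) else 0.

(** Flatness at the origin comes from one term of the exponential series. *)
Lemma flat_bound k x : 0 < x -> `|flat k x| <= k.+1`!%:R * x.
Proof.
move=> x0; rewrite /flat x0 normrM gtr0_norm ?invr_gt0 ?exprn_gt0//.
rewrite gtr0_norm ?expR_gt0// expRN.
have y0 : 0 < x^-1 by rewrite invr_gt0.
have f0 : 0 < (k.+1`!%:R : R) by rewrite ltr0n fact_gt0.
have : x^-1 ^+ k.+1 / k.+1`!%:R <= expR x^-1.
  by apply: le_trans (expR_ge1Dxn k (ltW y0)); rewrite lerDr.
rewrite ler_pdivrMr// exprS -exprVn => h.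
rewrite ler_pdivrMr ?expR_gt0// -mulrA.
have : x * (x^-1 * x^-1 ^+ k) <= x * (expR x^-1 * k.+1`!%:R) by rewrite ler_pM2l.
rewrite mulVKf ?gt_eqF// => /le_trans; apply.
by rewrite le_eqVlt; apply/orP; left; apply/eqP; ring.
Qed.

Lemma flat_derive k x :
  is_derive x 1 (flat k) (flat k.+2 x + - k%:R * flat k.+1 x).
Proof.
have [x0|x0|->] := ltgtP x 0.
- apply: (near_eq_is_derive (f := fun _ : R => 0 : R)).
    near=> y; rewrite /flat ltNge ltW//; near: y; exact: lt_nbhsl.
  rewrite /flat ltNge ltW//=; apply: (is_derive_eq (isd_cst (0 : R) x)).
  by rewrite mulr0 addr0.
- apply: (near_eq_is_derive (f := fun y : R => (y^-1) ^+ k * expR (- y^-1))).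
    near=> y; rewrite /flat exprVn ifT//; near: y; exact: lt_nbhsr.
  have x1 : x != 0 by rewrite gt_eqF.
  have dV := isdV x1 (isd_id x).
  have dX : is_derive x 1 (fun y : R => y^-1 ^+ k) (- k%:R * x ^- k.+1).
    elim: k {dV} => [|k IH].
      rewrite mulr0n oppr0 mul0r; under eq_fun do rewrite expr0; exact: isd_cst.
    under eq_fun do rewrite exprS.
    apply: (is_derive_eq (isdM (isdV x1 (isd_id x)) IH)).
    rewrite -[in RHS]natr1 exprVn !exprS.
    have xk : x ^+ k != 0 by rewrite expf_neq0.
    by field; rewrite x1 xk.
  apply: (is_derive_eq (isdM dX (isd_comp (is_derive_expR _) (isdN dV)))).
  rewrite /flat x0 exprVn !exprS.
  have xk : x ^+ k != 0 by rewrite expf_neq0.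
  by field; rewrite x1 xk.
have -> : flat k.+2 0 + - k%:R * flat k.+1 0 = 0.
  by rewrite /flat ltxx mulr0 addr0.
have C0 : 0 <= (k.+2`!%:R : R) by [].
have q0 : (fun h : R => h^-1 *: (flat k (h *: 1 + 0) - flat k 0)) @ (0:R)^' --> (0:R).
  apply/cvgr0Pnorm_le => e e0; near=> h.
  rewrite /GRing.scale/= mulr1 addr0 {2}/flat ltxx subr0.
  have h0 : h != 0 by near: h; exact: nbhs_dnbhs_neq.
  have [hp|hn] := ltP 0 h; last by rewrite /flat ltNge hn mulr0 normr0 ltW.
  have -> : h^-1 * flat k h = flat k.+1 h.
    by rewrite /flat hp exprS invfM mulrA.
  apply: (le_trans (flat_bound k.+1 hp)).
  rewrite -ler_pdivlMl ?ltr0n ?fact_gt0//.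
  near: h; apply: nbhs_dnbhs; near=> h; apply: ltW; near: h.
  by apply: lt_nbhsl; rewrite mulr_gt0// invr_gt0 ltr0n fact_gt0.
split; first by apply/cvg_ex; exists 0; exact: q0.
exact: (cvg_lim _ q0).
Unshelve. all: by end_near. Qed.

Lemma smooth_flat k : smooth (flat k).
Proof.
move=> n; elim: n k => // n IH k.
apply: (CdiffS (flat_derive k)); apply: CdiffD => //.
by apply: CdiffM => //; exact: Cdiff_cst.
Qed.

Lemma derive1_support f L : smooth f -> (forall x, L < `|x| -> f x = 0) ->
  forall x, L < `|x| -> f^`()%classic x = 0.
Proof.
move=> sf f0 x Lx; rewrite derive1E.
suff /@derive_val -> : is_derive x 1 f 0 by [].
apply: (near_eq_is_derive (f := fun _ : R => 0 : R)).
near=> y; rewrite f0//; near: y.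
have cn : {for x, continuous (fun y : R => `|y|)} by exact: norm_continuous.
exact: (cvgr_gt _ cn).
Unshelve. all: by end_near. Qed.

Lemma bounded_support f L : 0 <= L -> smooth f ->
  (forall x, L < `|x| -> f x = 0) -> exists B, 0 <= B /\ forall x, `|f x| <= B.
Proof.
move=> L0 sf f0.
have cf : {within `[- L, L], continuous (fun x => `|f x|)}.
  by apply: cw_abs; apply: continuous_subspaceT; exact: smooth_continuous.
have [] := @EVT_max R (fun x => `|f x|) (- L) L _ cf; first by lra.
move=> c _ fc; exists `|f c|; split => // x.
have [Lx|xL] := ltP L `|x|; first by rewrite f0// normr0.
by apply: fc; rewrite in_itv/= -ler_norml.
Qed.

(** The product [flat 0 (x + 1) * flat 0 (1 - x)], normalised at the origin. *)
Lemma bump_exists : exists bump : R -> R, exists B : R,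
  [/\ smooth bump, bump 0 = 1, forall x, 1 < `|x| -> bump x = 0, 0 <= B &
   forall x, [/\ `|bump x| <= B, `|bump^`()%classic x| <= B &
     `|bump^`()%classic^`()%classic x| <= B]].
Proof.
pose b x := expR 2 * (flat 0 (1 * x + 1) * flat 0 (-1 * x + 1)).
have sb : smooth b.
  apply: smoothM; first by move=> k; exact: Cdiff_cst.
  by apply: smoothM; apply: smooth_affine; exact: smooth_flat.
have b0 x : 1 < `|x| -> b x = 0.
  move=> x1; rewrite /b /flat mul1r mulN1r.
  have [x0|x0] := leP 0 x.
    rewrite ger0_norm// in x1.
    by rewrite (ltNge 0 (- x + 1)) (_ : - x + 1 <= 0)/= ?mulr0//; lra.
  rewrite ltr0_norm// in x1.
  by rewrite (ltNge 0 (x + 1)) (_ : x + 1 <= 0)/= ?mul0r ?mulr0//; lra.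
have sb' := smooth_derive1 sb; have b0' := derive1_support sb b0.
have sb'' := smooth_derive1 sb'; have b0'' := derive1_support sb' b0'.
have [B0 [B00 hB0]] := bounded_support ler01 sb b0.
have [B1 [B10 hB1]] := bounded_support ler01 sb' b0'.
have [B2 [B20 hB2]] := bounded_support ler01 sb'' b0''.
exists b, (B0 + B1 + B2); split => //.
- rewrite /b /flat !mulr0 !add0r ltr01 !expr0 invr1 !mul1r -!expRD.
  by rewrite (_ : 2 + _ = 0) ?expR0//; lra.
- by rewrite !addr_ge0.
- by move=> x; have := hB0 x; have := hB1 x; have := hB2 x; split; lra.
Qed.

End smooth1.

(** * Test functions in product form *)

Section product_test_functions.
Context {R : realType} {n : nat}.
Implicit Types (F : 'I_n -> R -> R) (x : 'rV[R]_n).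

Definition prodf F x : R := \prod_(i < n) F i (x ord0 i).

Definition derive_at F (j : 'I_n) : 'I_n -> R -> R :=
  fun i => if i == j then (F j)^`()%classic else F i.

Lemma prodfE F (j : 'I_n) x :
  prodf F x = F j (x ord0 j) * \prod_(i < n | i != j) F i (x ord0 i).
Proof. by rewrite /prodf (bigD1 j). Qed.

Lemma prodf_at F (j : 'I_n) g x :
  prodf (fun i => if i == j then g else F i) x =
  g (x ord0 j) * \prod_(i < n | i != j) F i (x ord0 i).
Proof.
rewrite (prodfE _ j) eqxx; congr (_ * _).
by apply: eq_bigr => i /negPf ->.
Qed.

Lemma continuous_prodf F : (forall i, continuous (F i)) -> continuous (prodf F).
Proof.
move=> cF x; rewrite /prodf.
apply: (@cvg_big R 'I_n *%R 1 xpredT (@mul_continuous R) _ (nbhs x)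
  (index_enum _) (fun i (y : 'rV[R]_n) => F i (y ord0 i))
  (fun i => F i (x ord0 i))) => i _.
apply: (@continuous_cvg _ _ _ _ _ (fun y : 'rV[R]_n => y ord0 i) (F i)).
  exact: cF.
exact: coord_continuous.
Qed.

Lemma is_derive_prodf F j x : (forall i, smooth (F i)) ->
  is_derive x (delta_mx ord0 j) (prodf F) (prodf (derive_at F j) x).
Proof.
move=> sF; pose r := \prod_(i < n | i != j) F i (x ord0 i).
have [dF F'] := smooth_is_derive (x ord0 j) (sF j).
have lim1 : (fun h : R => h^-1 *: ((F j \o shift (x ord0 j)) (h *: 1) - F j (x ord0 j)))
    @ (0:R)^' --> (F j)^`()%classic (x ord0 j).
  by rewrite -F'; exact: dF.
have E (h : R) : h^-1 *: ((prodf F \o shift x) (h *: delta_mx ord0 j) - prodf F x) =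
    r * (h^-1 *: ((F j \o shift (x ord0 j)) (h *: 1) - F j (x ord0 j))).
  rewrite /= !(prodfE _ j) !mxE !eqxx /=.
  rewrite (eq_bigr (fun i => F i (x ord0 i))); last first.
    by move=> i /negPf ij; rewrite !mxE eqxx ij/= mulr0 add0r.
  by rewrite -/r /GRing.scale/= mulr1; ring.
have lim2 : (fun h : R => h^-1 *: ((prodf F \o shift x) (h *: delta_mx ord0 j) - prodf F x))
    @ (0:R)^' --> prodf (derive_at F j) x.
  under eq_fun do rewrite E.
  rewrite /derive_at prodf_at mulrC; exact: cvgMr.
split; first by apply/cvg_ex; eexists; exact: lim2.
exact: (cvg_lim _ lim2).
Qed.

Lemma partial_prodf F j : (forall i, smooth (F i)) ->
  partial j (prodf F) = prodf (derive_at F j).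
Proof.
move=> sF; apply/funext => x; rewrite /partial.
by have /@derive_val -> := is_derive_prodf j x sF.
Qed.

Lemma smooth_derive_at F j : (forall i, smooth (F i)) ->
  forall i, smooth (derive_at F j i).
Proof.
by move=> sF i; rewrite /derive_at; case: ifP => // _; exact: smooth_derive1.
Qed.

Lemma test_function_prodf F L : (forall i, smooth (F i)) ->
  (forall i t, L < `|t| -> F i t = 0) -> test_function (prodf F).
Proof.
move=> sF F0; split; last first.
  pose box := [set v : 'rV[R]_n | forall i, `[- L, L]%classic (v ord0 i)].
  have cbox : compact box by apply: (@rV_compact R n (fun=> `[- L, L]%classic)) => i; exact: segment_compact.
  have sub : [set x | prodf F x != 0] `<=` box.
    move=> x /= x0 i; rewrite /= in_itv/= -ler_norml leNgt.
    apply: contra_neqN x0 => /F0 Fi0.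
    by rewrite (prodfE _ i) Fi0 mul0r.
  apply: (subclosed_compact _ cbox); first exact: closed_closure.
  have /closure_id -> : closed box by exact: (compact_closed (@norm_hausdorff _ _) cbox).
  exact: closure_subset.
move=> l; suff [G [sG ->]] : exists G, (forall i, smooth (G i)) /\
    partials l (prodf F) = prodf G.
  split; first by apply: continuous_prodf => i; apply: smooth_continuous; exact: sG.
  by move=> j x; case: (is_derive_prodf j x sG).
elim: l => [|j l [G [sG IH]]]; first by exists F.
exists (derive_at G j); split; first exact: smooth_derive_at.
by rewrite /partials /= -/(partials l _) IH partial_prodf.
Qed.

End product_test_functions.

(** * Integrals of products over the product measure *)

Section product_integral.
Context {R : realType}.
Local Notation leb := (@lebesgue_measure R).
Local Notation mu n := (lebesgue_rV R n).

Lemma measurable_rV_cons n : measurable_fun setT (@rV_cons R n).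
Proof.
apply: measurable_fun_rV => i; case: (unliftP ord0 i) => [j|] ->.
  rewrite (_ : (fun x => _) = (fun v : 'rV[R]_n => v ord0 j : measurableTypeR R) \o snd).
    by apply: measurableT_comp => //; exact: measurable_rV_coord.
  by apply/funext => x; rewrite /rV_cons mxE liftK.
rewrite (_ : (fun x => _) = fst) //.
by apply/funext => x; rewrite /rV_cons mxE unlift_none.
Qed.

Lemma measurable_prodf n (F : 'I_n -> R -> R) :
  (forall i, measurable_fun setT (F i)) -> measurable_fun setT (prodf F).
Proof.
move=> mF; rewrite /prodf; apply: measurable_prod => i _.
by apply: measurableT_comp; [exact: mF|exact: measurable_rV_coord].
Qed.

Lemma prodf_cons n (F : 'I_n.+1 -> R -> R) x v :
  prodf F (rV_cons (x, v)) = F ord0 x * prodf (fun i => F (lift ord0 i)) v.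
Proof.
rewrite /prodf big_ord_recl /rV_cons mxE unlift_none; congr (_ * _).
by apply: eq_bigr => i _; rewrite mxE liftK.
Qed.

(** Fubini's theorem, one coordinate at a time along the recursive
    definition of the measure. *)
Lemma integral_prodf n (F : 'I_n -> R -> R) :
  (forall i, leb.-integrable setT (EFin \o F i)) ->
  (mu n).-integrable setT (EFin \o prodf F) /\
  \int[mu n]_x prodf F x = \prod_i \int[leb]_x F i x.
Proof.
elim: n F => [|n IH] F iF.
  have -> : prodf F = cst 1.
    by apply/funext => x; rewrite /prodf big_ord0.
  have mu0T : mu 0 setT = 1%E by exact: (diracT R (0 : 'rV[R]_0)).
  split.
    apply/integrableP; split; first exact/measurable_EFinP.
    under eq_integral do rewrite /= normr1.
    rewrite integral_cst// mul1e; apply: (@le_lt_trans _ _ 1%E); last exact: ltry.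
    by rewrite le_eqVlt; apply/orP; left; apply/eqP; exact: mu0T.
  rewrite big_ord0 Rintegral_cst// mul1r; exact: (congr1 fine mu0T).
have mF i : measurable_fun setT (F i).
  by apply/measurable_EFinP; exact: measurable_int (iF i).
pose G i := F (lift ord0 i).
have [iG IG] := IH G (fun i => iF _).
pose h (p : measurableTypeR R * 'rV[R]_n) : \bar R := (F ord0 p.1 * prodf G p.2)%:E.
have mG : measurable_fun setT (prodf G) by apply: measurable_prodf => i; exact: mF.
have mh : measurable_fun setT h.
  apply/measurable_EFinP; apply: measurable_funM.
    by apply: measurableT_comp => //; exact: mF.
  exact: measurableT_comp.
have /integrableP[_ F0oo] := iF ord0.
have /integrableP[_ Goo] := iG.
have ih : (product_measure1 leb (mu n)).-integrable setT h.
  apply/(integrable12ltyP leb (mu n) mh).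
  have -> : (\int[leb]_x \int[mu n]_y `|h (x, y)| = \int[leb]_x
      (`|(F ord0 x)%:E| * \int[mu n]_y `|(prodf G y)%:E|))%E.
    apply: eq_integral => x _; rewrite -ge0_integralZl//.
      by apply: eq_integral => y _; rewrite /h/= normrM EFinM.
    by apply: measurableT_comp => //; exact/measurable_EFinP.
  rewrite ge0_integralZr//.
  - rewrite lte_mul_pinfty// ?integral_ge0// ge0_fin_numE ?integral_ge0//.
  - exact: measurable_int (integrable_abse (iF ord0)).
  - exact: integral_ge0.
have hE : h = (EFin \o prodf F) \o (@rV_cons R n).
  by apply/funext => -[x v]; rewrite /h/= prodf_cons.
have mPF : measurable_fun setT (EFin \o prodf F).
  by apply/measurable_EFinP; exact: measurable_prodf.
have iPF : (mu n.+1).-integrable setT (EFin \o prodf F).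
  apply: (@integrable_pushforward _ _ _ _ R _ (@measurable_rV_cons n)
    (product_measure1 leb (mu n)) setT _ mPF) => //.
  by rewrite preimage_setT -hE.
split => //.
rewrite /Rintegral big_ord_recl -/(G _).
have -> : (\int[mu n.+1]_x (prodf F x)%:E =
    \int[product_measure1 leb (mu n)]_p h p)%E.
  rewrite hE -(preimage_setT (@rV_cons R n)).
  apply: (@integral_pushforward _ _ _ _ R _ (@measurable_rV_cons n)
    (product_measure1 leb (mu n)) setT _ mPF) => //.
  by rewrite preimage_setT -hE.
rewrite -(integral12_prod_meas1 ih) /fubini_F.
have -> : (\int[leb]_x \int[mu n]_y h (x, y) =
    \int[leb]_x ((F ord0 x)%:E * \int[mu n]_y (prodf G y)%:E))%E.
  by apply: eq_integral => x _; rewrite -integralZl.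
have fG : (\int[mu n]_y (prodf G y)%:E)%E \is a fin_num by exact: integrable_fin_num.
rewrite -(fineK fG) integralZr//; last exact: (iF ord0).
rewrite fineM//; last exact: (integrable_fin_num measurableT (iF ord0)).
by congr (_ * _); rewrite -IG.
Qed.

End product_integral.

(** * Square-integrable real functions *)

Section inner_product.
Context d (T : measurableType d) {R : realType}.
Variable mu : {measure set T -> \bar R}.
Implicit Types (f g h : T -> R) (c : R).

Definition rL2 f := measurable_fun setT f /\
  mu.-integrable setT (EFin \o (fun x => f x ^+ 2)).

Definition ip f g : R := \int[mu]_x (f x * g x).

Lemma rL2_integrableM f g : rL2 f -> rL2 g ->
  mu.-integrable setT (EFin \o (fun x => f x * g x)).
Proof.
move=> [mf f2] [mg g2].
apply: (le_integrable measurableT _ _ (integrableD measurableT f2 g2)).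
  by apply/measurable_EFinP; exact: measurable_funM.
move=> x _ /=; rewrite lee_fin.
have f0 : 0 <= f x ^+ 2 by exact: sqr_ge0.
have g0 : 0 <= g x ^+ 2 by exact: sqr_ge0.
rewrite (ger0_norm (addr_ge0 f0 g0)) ler_norml; apply/andP; split.
  have : 0 <= (f x + g x) ^+ 2 by exact: sqr_ge0.
  by lra.
have : 0 <= (f x - g x) ^+ 2 by exact: sqr_ge0.
by lra.
Qed.

Lemma rL2_integrable_sqr f : rL2 f ->
  mu.-integrable setT (EFin \o (fun x => f x * f x)).
Proof. by move=> f2; exact: rL2_integrableM. Qed.

Lemma rL2D f g : rL2 f -> rL2 g -> rL2 (fun x => f x + g x).
Proof.
move=> f2 g2; have fg := rL2_integrableM f2 g2.
split; first by apply: measurable_funD; [case: f2|case: g2].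
have [_ if2] := f2; have [_ ig2] := g2.
rewrite (_ : _ \o _ = (fun x => ((f x ^+ 2)%:E + 2%:E * (f x * g x)%:E +
    (g x ^+ 2)%:E)%E)).
  by apply: (integrableD measurableT (integrableD measurableT if2
    (integrableZl measurableT 2 fg)) ig2).
by apply/funext => x /=; rewrite -EFinM -!EFinD; congr EFin; ring.
Qed.

Lemma rL2M f h B : measurable_fun setT h -> (forall x, `|h x| <= B) -> rL2 f ->
  rL2 (fun x => f x * h x).
Proof.
move=> mh hB [mf if2]; split; first exact: measurable_funM.
apply: (@le_integrable _ _ _ mu setT measurableT _
  (fun x => (B ^+ 2)%:E * (f x ^+ 2)%:E)%E).
- apply/measurable_EFinP; apply: measurable_funX; exact: measurable_funM.
- move=> x _ /=; rewrite lee_fin (ger0_norm (sqr_ge0 _)).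
  rewrite (ger0_norm (mulr_ge0 (sqr_ge0 _) (sqr_ge0 _))).
  rewrite exprMn mulrC ler_wpM2r ?sqr_ge0//.
  rewrite -(real_normK (num_real (h x))) lerXn2r// nnegrE//.
  exact: le_trans (normr_ge0 _) (hB x).
- exact: (integrableZl measurableT (B ^+ 2) if2).
Qed.

Lemma rL2Z c f : rL2 f -> rL2 (fun x => c * f x).
Proof.
move=> f2; rewrite (_ : (fun x => _) = fun x => f x * cst c x).
  by apply: (@rL2M _ _ `|c|).
by apply/funext => x; rewrite mulrC.
Qed.

Lemma rL2_0 : rL2 (fun=> 0).
Proof.
split; first exact: measurable_cst.
rewrite (_ : _ \o _ = cst 0%E); first exact: integrable0.
by apply/funext => x /=; rewrite expr0n.
Qed.

Lemma rL2_sum (I : Type) (r : seq I) (F : I -> T -> R) :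
  (forall i, rL2 (F i)) -> rL2 (fun x => \sum_(i <- r) F i x).
Proof.
move=> F2; elim: r => [|i r IH].
  by under eq_fun do rewrite big_nil; exact: rL2_0.
by under eq_fun do rewrite big_cons; exact: rL2D.
Qed.

Lemma rL2B f g : rL2 f -> rL2 g -> rL2 (fun x => f x - g x).
Proof.
move=> f2 g2; rewrite (_ : (fun x => _) = fun x => f x + -1 * g x).
  by apply: rL2D => //; exact: rL2Z.
by apply/funext => x; rewrite mulN1r.
Qed.

Lemma ipC f g : ip f g = ip g f.
Proof. by rewrite /ip; under eq_Rintegral do rewrite mulrC. Qed.

Lemma ip_ge0 f : 0 <= ip f f.
Proof. by apply: Rintegral_ge0 => x _; rewrite -expr2 sqr_ge0. Qed.

Lemma ipDl f g h : rL2 f -> rL2 g -> rL2 h ->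
  ip (fun x => f x + g x) h = ip f h + ip g h.
Proof.
move=> f2 g2 h2; rewrite /ip -RintegralD//; do ?exact: rL2_integrableM.
by apply: eq_Rintegral => x _; rewrite mulrDl.
Qed.

Lemma ipZl c f g : rL2 f -> rL2 g -> ip (fun x => c * f x) g = c * ip f g.
Proof.
move=> f2 g2; rewrite /ip -RintegralZl//; last exact: rL2_integrableM.
by apply: eq_Rintegral => x _; rewrite mulrA.
Qed.

Lemma ipBl f g h : rL2 f -> rL2 g -> rL2 h ->
  ip (fun x => f x - g x) h = ip f h - ip g h.
Proof.
move=> f2 g2 h2; rewrite -mulN1r -ipZl// -ipDl//; last exact: rL2Z.
by rewrite /ip; under [RHS]eq_Rintegral do rewrite mulN1r.
Qed.

Lemma ip_suml (I : Type) (r : seq I) (F : I -> T -> R) h :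
  (forall i, rL2 (F i)) -> rL2 h ->
  ip (fun x => \sum_(i <- r) F i x) h = \sum_(i <- r) ip (F i) h.
Proof.
move=> F2 h2; elim: r => [|i r IH].
  rewrite big_nil /ip (_ : (fun x => _) = cst 0) ?Rintegral_cst ?mul0r//.
  by apply/funext => x; rewrite big_nil mul0r.
under eq_fun do rewrite big_cons.
by rewrite big_cons ipDl//; [rewrite IH|exact: rL2_sum].
Qed.

Lemma ipBB f g : rL2 f -> rL2 g ->
  ip (fun x => f x - g x) (fun x => f x - g x) = ip f f - 2 * ip f g + ip g g.
Proof.
move=> f2 g2; have fg := rL2B f2 g2.
rewrite ipBl// !(ipC _ (fun x => f x - g x)) !ipBl// (ipC g f).
by ring.
Qed.

Lemma ip_sqr_le f g : rL2 f -> rL2 g -> ip f g ^+ 2 <= ip f f * ip g g.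
Proof.
move=> f2 g2.
have pos t : 0 <= ip f f - 2 * (t * ip f g) + t ^+ 2 * ip g g.
  have tg := rL2Z t g2.
  have := ip_ge0 (fun x => f x - t * g x); rewrite (ipBB f2 tg).
  rewrite (ipC f (fun x => t * g x)) !ipZl// (ipC g (fun x => t * g x)) ipZl//.
  by rewrite (ipC g f) (mulrA t t) -expr2.
have [g0|] := ltP 0 (ip g g).
  have := pos (ip f g / ip g g).
  rewrite -(ler_pM2r g0) mul0r.
  have -> : (ip f f - 2 * (ip f g / ip g g * ip f g) +
    (ip f g / ip g g) ^+ 2 * ip g g) * ip g g = ip f f * ip g g - ip f g ^+ 2.
    by field; rewrite gt_eqF.
  by rewrite subr_ge0.
move=> g0; have g00 : ip g g = 0 by apply/eqP; rewrite eq_le g0 ip_ge0.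
have [->|fg0] := eqVneq (ip f g) 0; first by rewrite g00 mulr0 expr0n.
have := pos ((ip f f + 1) / (2 * ip f g)).
rewrite g00 mulr0 addr0 (_ : 2 * _ = ip f f + 1); first by lra.
by field.
Qed.

Lemma bessel (I : finType) (e : I -> T -> R) (N : R) f :
  0 < N -> (forall i, rL2 (e i)) ->
  (forall i j, ip (e i) (e j) = if i == j then N else 0) -> rL2 f ->
  \sum_i ip f (e i) ^+ 2 <= N * ip f f.
Proof.
move=> N0 e2 eN f2; pose c i := ip f (e i) / N.
pose g x := \sum_i c i * e i x.
have ce2 i : rL2 (fun x => c i * e i x) by exact: rL2Z.
have g2 : rL2 g by exact: rL2_sum.
have fg : ip f g = \sum_i ip f (e i) ^+ 2 / N.
  rewrite ipC ip_suml//; apply: eq_bigr => i _.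
  by rewrite ipZl// ipC /c expr2 mulrAC.
have gg : ip g g = \sum_i ip f (e i) ^+ 2 / N.
  rewrite {1}/g ip_suml//; apply: eq_bigr => i _.
  rewrite ipZl// ipC ip_suml// (bigD1 i)//= big1 ?addr0.
    by rewrite ipZl// eN eqxx /c; field; rewrite gt_eqF.
  by move=> j ji; rewrite ipZl// eN (negPf ji) mulr0.
have := ip_ge0 (fun x => f x - g x).
rewrite ipBB// fg gg -mulr_suml => h.
rewrite -ler_pdivrMl// mulrC.
by move: h; lra.
Qed.

Lemma ip_mul_le f h K : measurable_fun setT h -> (forall x, `|h x| <= K) -> rL2 f ->
  ip (fun x => f x * h x) (fun x => f x * h x) <= K ^+ 2 * ip f f.
Proof.
move=> mh hK f2; have fh := rL2M mh hK f2.
rewrite /ip -RintegralZl//; last exact: rL2_integrable_sqr.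
apply: le_Rintegral => //; first exact: rL2_integrable_sqr.
  rewrite (_ : (fun x => _) = fun x => K ^+ 2 * f x * f x).
    exact: (rL2_integrableM (rL2Z _ f2) f2).
  by apply/funext => x; rewrite mulrA.
move=> x _; rewrite mulrACA mulrC; apply: ler_wpM2r; first by rewrite -expr2 sqr_ge0.
rewrite -expr2 -(real_normK (num_real (h _))).
by rewrite lerXn2r ?nnegrE ?hK//; apply: le_trans (hK x).
Qed.

Lemma ip_ae f f' g : measurable_fun setT f -> measurable_fun setT f' ->
  measurable_fun setT g -> {ae mu, forall x, f x = f' x} -> ip f g = ip f' g.
Proof.
move=> mf mf' mg ff'; congr fine; apply: ae_eq_integral => //.
- by apply/measurable_EFinP; exact: measurable_funM.
- by apply/measurable_EFinP; exact: measurable_funM.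
- by apply: filterS ff' => x -> _.
Qed.

End inner_product.

(** * Completeness of the sine system on indicators of intervals *)

Section sine_series.
Context {R : realType}.
Implicit Types (t e a b x : R).

Lemma le_increment (f df : R -> R) a b K : a <= b ->
  (forall x, a <= x <= b -> is_derive x 1 f (df x)) ->
  (forall x, a <= x <= b -> `|df x| <= K) ->
  `|f b - f a| <= K * (b - a).
Proof.
move=> ab dfx leK.
have cf : {within `[a, b], continuous f}.
  apply: cw_for => x; rewrite /= in_itv/= => /dfx; exact: isd_cont.
have [|c cab ->] := @MVT_segment R f df a b ab _ cf.
  by move=> x; rewrite in_itv/= => /andP[/ltW ax /ltW xb]; apply: dfx; rewrite ax xb.
rewrite in_itv/= in cab.
by rewrite normrM (ger0_norm (_ : 0 <= b - a)) ?subr_ge0// ler_wpM2r ?subr_ge0// leK.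
Qed.

Lemma one_minus_cos_le t : 0 <= t -> 0 <= 1 - cos t <= t ^+ 2.
Proof.
move=> t0; apply/andP; split; first by rewrite subr_ge0 cos_le1.
have sin_le x : 0 <= x -> `|sin x| <= x.
  move=> x0; have := @le_increment sin cos 0 x 1 x0 (fun y _ => is_derive_sin y)
    (fun y _ => cos_max y).
  by rewrite sin0 !subr0 mul1r.
have := @le_increment cos (fun y => - sin y) 0 t t t0 (fun y _ => is_derive_cos y).
rewrite cos0 subr0 -expr2 distrC => h.
apply: (le_trans (ler_norm _)); apply: h => x /andP[x0 xt].
by rewrite normrN (le_trans (sin_le _ x0)).
Qed.

Definition sine_sum N t : R := \sum_(k < N) sin (k.+1%:R * t) / k.+1%:R.

(** Its limit is, up to scaling, the second Bernoulli polynomial, and the squares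
    of cosine differences are linear combinations of its terms. *)
Definition bernoulli_sum N t : R :=
  \sum_(k < N) (1 - cos (k.+1%:R * t)) / k.+1%:R ^+ 2.

Definition bernoulli_lim t : R := pi * t / 2 - t ^+ 2 / 4.

Lemma sin_nat_pi k : sin (k%:R * pi) = 0 :> R.
Proof.
elim: k => [|k IH]; first by rewrite mul0r sin0.
by rewrite -natr1 mulrDl mul1r sinDpi IH oppr0.
Qed.

Lemma dirichlet_kernel N t :
  2 * sin (t / 2) * (2^-1 + \sum_(k < N) cos (k.+1%:R * t)) =
  sin ((N%:R + 2^-1) * t).
Proof.
elim: N => [|N IH].
  by rewrite big_ord0 addr0 add0r mulrAC divff ?mul1r 1?mulrC// pnatr_eq0.
rewrite big_ord_recr/= addrA mulrDr IH.
have -> : (N%:R + 2^-1) * t = N.+1%:R * t - t / 2.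
  by rewrite -natr1; field.
have -> : (N.+1%:R + 2^-1) * t = N.+1%:R * t + t / 2 by field.
by rewrite sinB sinD; ring.
Qed.

Lemma sine_sum_derive N t : is_derive t 1 (sine_sum N) (\sum_(k < N) cos (k.+1%:R * t)).
Proof.
apply: isd_sum => k.
have k0 : (k.+1%:R : R) != 0 by rewrite pnatr_eq0.
apply: (is_derive_eq (isdM (@isd_comp _ sin (fun y => k.+1%:R * y) t _ _
  (is_derive_sin _) (isdZ k.+1%:R (isd_id t))) (isd_cst k.+1%:R^-1 t))).
by field.
Qed.

Lemma bernoulli_sum_derive N t : is_derive t 1 (bernoulli_sum N) (sine_sum N t).
Proof.
apply: isd_sum => k.
have k0 : (k.+1%:R : R) != 0 by rewrite pnatr_eq0.
apply: (is_derive_eq (isdM (isdB (isd_cst (1 : R) t)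
  (@isd_comp _ cos (fun y => k.+1%:R * y) t _ _
  (is_derive_cos _) (isdZ k.+1%:R (isd_id t)))) (isd_cst (k.+1%:R ^+ 2)^-1 t))).
by field.
Qed.

(** Adding [cos (h t) / (2 h sin (t / 2))] to [sine_sum N - (pi - t) / 2], with
    [h = N + 1/2], makes the derivative [O(1 / h)]; the sum vanishes at [pi]. *)
Lemma sine_sum_bound e : 0 < e -> exists C, 0 <= C /\ forall N t, e <= t <= pi ->
  `|sine_sum N t - (pi - t) / 2| <= C / (N%:R + 2^-1).
Proof.
move=> e0.
have [epi|pie] := leP e pi; last first.
  exists 0; split => // N t /andP[et tpi].
  by have := lt_le_trans pie (le_trans et tpi); rewrite ltxx.
have s0 : 0 < sin (e / 2).
  apply: sin_gt0_pi; have := pi_gt0 R; move: e0 epi; lra.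
pose s := sin (e / 2).
exists (1 / (2 * s) + pi / (4 * s ^+ 2)); split.
  apply: addr_ge0; apply: divr_ge0; rewrite ?pi_ge0//.
    by rewrite mulr_ge0// ltW.
  by rewrite mulr_ge0// sqr_ge0.
move=> N t /andP[et tpi].
pose h : R := N%:R + 2^-1.
have h0 : 0 < h by rewrite ltr_wpDl// invr_gt0.
have sx x : e <= x <= pi -> s <= sin (x / 2).
  move=> /andP[ex xpi]; have p0 := pi_gt0 R.
  have m1 : e / 2 \in `[ (- (pi/2)), pi/2] by rewrite in_itv/=; move: e0 epi p0; lra.
  have m2 : x / 2 \in `[ (- (pi/2)), pi/2] by rewrite in_itv/=; move: e0 ex xpi p0; lra.
  by rewrite /s leNgt (ltr_sin m2 m1) -leNgt; move: ex; lra.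
have sx0 x : e <= x <= pi -> 0 < sin (x / 2) by move=> /sx; exact: lt_le_trans.
pose U x := sine_sum N x - (pi - x) / 2 + cos (h * x) / (2 * h * sin (x / 2)).
pose dU x := - (cos (h * x) * cos (x / 2) / (4 * h * sin (x / 2) ^+ 2)).
have dUx x : e <= x <= pi -> is_derive x 1 U (dU x).
  move=> xI; have n0 : 2 * h * sin (x / 2) != 0 by rewrite gt_eqF// !mulr_gt0// sx0.
  have dhalf : is_derive x 1 (fun y : R => y / 2) (1 / 2).
    apply: (is_derive_eq (isdM (isd_id x) (isd_cst (2^-1 : R) x))).
    by rewrite mulr0 addr0.
  apply: (is_derive_eq (isdD (isdB (sine_sum_derive N x)
    (isdM (isdB (isd_cst (pi : R) x) (isd_id x)) (isd_cst (2^-1 : R) x)))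
    (@isd_div _ (fun y => cos (h * y)) (fun y => 2 * h * sin (y / 2)) x _ _ n0
      (@isd_comp _ cos (fun y => h * y) x _ _ (is_derive_cos _)
        (isdZ h (isd_id x)))
      (isdZ (2 * h) (@isd_comp _ sin (fun y => y / 2) x _ _ (is_derive_sin _) dhalf))))).
  have /= D := dirichlet_kernel N x; rewrite -/h in D.
  have sn0 : sin (x / 2) != 0 by rewrite gt_eqF// sx0.
  have -> : \sum_(k < N) cos (k.+1%:R * x) = sin (h * x) / (2 * sin (x / 2)) - 2^-1.
    by rewrite -D; field.
  by rewrite /dU; field; rewrite sn0 gt_eqF.
have le_dU x : e <= x <= pi -> `|dU x| <= 1 / (4 * h * s ^+ 2).
  move=> xI; rewrite /dU normrN normrM normrM.
  have h4 : 0 < 4 * h by rewrite mulr_gt0.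
  have q0 : 0 < 4 * h * sin (x / 2) ^+ 2 by apply: mulr_gt0 => //; rewrite exprn_gt0// sx0.
  have q1 : 0 < 4 * h * s ^+ 2 by apply: mulr_gt0 => //; rewrite exprn_gt0.
  have c1 : `|cos (h * x)| * `|cos (x / 2)| <= 1.
    by rewrite -[leRHS]mulr1; apply: ler_pM => //; exact: cos_max.
  have c2 : `|(4 * h * sin (x / 2) ^+ 2)^-1| <= (4 * h * s ^+ 2)^-1.
    rewrite gtr0_norm ?invr_gt0// lef_pV2 ?posrE// ler_pM2l//.
    by rewrite lerXn2r ?nnegrE ?sx// ltW// sx0.
  exact: (ler_pM (mulr_ge0 (normr_ge0 _) (normr_ge0 _)) (normr_ge0 _) c1 c2).
have Upi : U pi = 0.
  rewrite /U subrr mul0r subr0 /sine_sum big1 ?add0r; last first.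
    by move=> k _; rewrite sin_nat_pi mul0r.
  rewrite /h mulrDl cosD sin_nat_pi mul0r subr0 [2^-1 * _]mulrC cos_pihalf.
  by rewrite mulr0 mul0r.
have := @le_increment U dU t pi (1 / (4 * h * s ^+ 2)) tpi.
rewrite Upi sub0r normrN => hU.
have {}hU : `|U t| <= 1 / (4 * h * s ^+ 2) * (pi - t).
  apply: hU => x /andP[tx xpi]; [apply: dUx|apply: le_dU];
  by rewrite xpi (le_trans et).
have tI : e <= t <= pi by rewrite et tpi.
have hc : `|cos (h * t) / (2 * h * sin (t / 2))| <= 1 / (2 * h * s).
  rewrite normrM; apply: ler_pM => //; first exact: cos_max.
  have q0 : 0 < 2 * h * sin (t / 2) by rewrite !mulr_gt0// sx0.
  have q1 : 0 < 2 * h * s by rewrite !mulr_gt0.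
  by rewrite gtr0_norm ?invr_gt0// lef_pV2 ?posrE// ler_pM2l ?mulr_gt0// sx.
have -> : sine_sum N t - (pi - t) / 2 =
    U t - cos (h * t) / (2 * h * sin (t / 2)) by rewrite /U addrK.
apply: (le_trans (ler_normB _ _)).
rewrite -/h.
have -> : (1 / (2 * s) + pi / (4 * s ^+ 2)) / h =
    1 / (4 * h * s ^+ 2) * pi + 1 / (2 * h * s).
  by field; rewrite !gt_eqF.
apply: lerD => //; apply: (le_trans hU).
apply: ler_wpM2l.
  apply: divr_ge0 => //; apply: mulr_ge0; last exact: sqr_ge0.
  by apply: mulr_ge0 => //; exact: ltW.
by move: et e0; lra.
Qed.

Lemma sum_inv_sqr_tail K N : (0 < K)%N ->
  \sum_(K <= k < N) (k.+1%:R ^+ 2)^-1 <= K%:R^-1 :> R.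
Proof.
move=> K0; have [NK|KN] := leqP N K; first by rewrite big_geq// invr_ge0.
have step k : (0 < k)%N -> (k.+1%:R ^+ 2)^-1 <= k%:R^-1 - k.+1%:R^-1 :> R.
  move=> k0; have k1 : 0 < (k%:R : R) by rewrite ltr0n.
  have k2 : 0 < (k.+1%:R : R) by rewrite ltr0n.
  have -> : k%:R^-1 - k.+1%:R^-1 = (k%:R * k.+1%:R)^-1 :> R.
    rewrite -natr1; field.
    by rewrite natr1 !gt_eqF.
  rewrite lef_pV2 ?posrE ?mulr_gt0 ?exprn_gt0//.
  by rewrite expr2 ler_pM2r// ler_nat.
apply: (@le_trans _ _ (\sum_(K <= k < N) (k%:R^-1 - k.+1%:R^-1))).
  apply: ler_sum_nat => k /andP[Kk _]; apply: step; exact: leq_trans Kk.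
rewrite (@telescope_sumr_eq R _ _ (fun k => - k%:R^-1)); last 2 first.
- exact: ltnW.
- by move=> k _; rewrite opprK addrC.
by rewrite opprK addrC lerBlDr lerDl invr_ge0.
Qed.

(** On [[0, 1 / K]] the first [K] terms are at most [t^2] each, the others are
    at most [2 / k^2]; the bound is uniform in [N]. *)
Lemma bernoulli_sum_small K N t : (0 < K)%N -> 0 <= t <= K%:R^-1 ->
  0 <= bernoulli_sum N t <= 3 / K%:R.
Proof.
move=> K0 /andP[t0 tK].
have p0 k : 0 <= (1 - cos (k.+1%:R * t)) / k.+1%:R ^+ 2.
  by apply: divr_ge0; rewrite ?sqr_ge0// subr_ge0 cos_le1.
apply/andP; split; first exact: sumr_ge0.
have K1 : 0 < (K%:R : R) by rewrite ltr0n.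
pose F k : R := (1 - cos (k.+1%:R * t)) / k.+1%:R ^+ 2.
have -> : bernoulli_sum N t = \sum_(0 <= k < N) F k by rewrite big_mkord.
have le1 k : F k <= K%:R^-1 ^+ 2.
  rewrite /F ler_pdivrMr ?exprn_gt0//.
  have kt : 0 <= k.+1%:R * t by rewrite mulr_ge0.
  have /andP[_ h] := one_minus_cos_le kt.
  rewrite (le_trans h)// exprMn mulrC ler_wpM2r ?sqr_ge0//.
  by rewrite lerXn2r// nnegrE invr_ge0 ltW.
have le2 k : F k <= 2 * (k.+1%:R ^+ 2)^-1.
  rewrite /F ler_wpM2r ?invr_ge0 ?sqr_ge0//.
  by have := cos_geN1 (k.+1%:R * t); lra.
have s1 M : \sum_(0 <= k < M) F k <= M%:R * K%:R^-1 ^+ 2.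
  apply: (@le_trans _ _ (\sum_(0 <= k < M) K%:R^-1 ^+ 2)).
    by apply: ler_sum_nat => k _; exact: le1.
  by rewrite big_const_nat subn0 iter_addr_0 mulr_natl.
have KK : K%:R * K%:R^-1 ^+ 2 = K%:R^-1 :> R.
  by rewrite expr2 mulrA divff ?mul1r// gt_eqF.
have Ki : 0 <= K%:R^-1 :> R by rewrite invr_ge0 ltW.
have [NK|KN] := leqP N K.
  apply: (le_trans (s1 N)); apply: (@le_trans _ _ (K%:R * K%:R^-1 ^+ 2)).
    by rewrite ler_wpM2r ?sqr_ge0// ler_nat.
  by rewrite KK; lra.
rewrite (big_cat_nat (n := K))//=; last exact: ltnW.
apply: (@le_trans _ _ (K%:R^-1 + 2 * K%:R^-1)); last by lra.
apply: lerD; first by rewrite (le_trans (s1 K))// KK.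
apply: (@le_trans _ _ (\sum_(K <= k < N) 2 * (k.+1%:R ^+ 2)^-1)).
  by apply: ler_sum_nat => k _; exact: le2.
by rewrite -mulr_sumr ler_wpM2l// sum_inv_sqr_tail.
Qed.

(** The derivative of the difference tends to [0] uniformly away from the origin;
    near the origin both functions are small. *)
Lemma bernoulli_sum_cvg_half t e : 0 <= t <= pi -> 0 < e ->
  exists N0, forall N, (N0 <= N)%N -> `|bernoulli_sum N t - bernoulli_lim t| <= e.
Proof.
move=> /andP[t0 tpi] e0; have p0 := pi_gt0 R.
pose C0 : R := 6 + 2 * pi.
have C00 : 0 < C0 by rewrite /C0; lra.
pose K := (Num.truncn (C0 / e)).+1.
have K0 : 0 < (K%:R : R) by rewrite ltr0n.
have Ke : C0 / K%:R <= e.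
  rewrite ler_pdivrMr// mulrC -ler_pdivrMr//; apply: ltW.
  exact: truncnS_gt.
have Ki : 0 < (K%:R^-1 : R) by rewrite invr_gt0.
have lim_small x : 0 <= x <= K%:R^-1 -> 0 <= x <= pi ->
    `|bernoulli_lim x| <= pi / K%:R.
  move=> /andP[x0 xK] /andP[_ xpi].
  have -> : bernoulli_lim x = x * (pi / 2 - x / 4).
    by rewrite /bernoulli_lim; field.
  rewrite normrM mulrC; apply: ler_pM => //; last by rewrite ger0_norm.
  by rewrite ger0_norm; move: x0 xpi; lra.
have small N x : 0 <= x <= K%:R^-1 -> 0 <= x <= pi ->
    `|bernoulli_sum N x - bernoulli_lim x| <= C0 / K%:R / 2.
  move=> xK xpi; apply: (le_trans (ler_normB _ _)).
  have /andP[b0 b1] := bernoulli_sum_small N (isT : (0 < K)%N) xK.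
  rewrite ger0_norm//; have := lim_small _ xK xpi; rewrite /C0.
  by move: b1; lra.
have [tK|Kt] := leP t K%:R^-1.
  exists 0%N => N _; have := small N t; rewrite t0 tK tpi => /(_ isT isT).
  by move: Ke e0; lra.
have [C [C1 hC]] := sine_sum_bound Ki.
pose N0 := (Num.truncn (2 * C * pi / e)).+1.
exists N0 => N N0N.
pose h : R := N%:R + 2^-1.
have h0 : 0 < h by rewrite ltr_wpDl// invr_gt0.
have KI : 0 <= (K%:R : R)^-1 <= (K%:R : R)^-1.
  by apply/andP; split; [exact: ltW|exact: lexx].
have KI' : 0 <= (K%:R : R)^-1 <= pi.
  by apply/andP; split; [exact: ltW|exact: le_trans (ltW Kt) tpi].
have sm := small N _ KI KI'.
pose D x := bernoulli_sum N x - bernoulli_lim x.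
have dD x : K%:R^-1 <= x <= t -> is_derive x 1 D (sine_sum N x - (pi - x) / 2).
  move=> _; apply: (is_derive_eq (isdB (bernoulli_sum_derive N x)
    (isdB (isdM (isdZ pi (isd_id x)) (isd_cst (2^-1 : R) x))
     (isdM (isd_sqr (isd_id x)) (isd_cst (4^-1 : R) x))))).
  by field.
have := le_increment (ltW Kt) dD (K := C / h).
have -> : D t - D K%:R^-1 = (bernoulli_sum N t - bernoulli_lim t) - D K%:R^-1 by [].
move=> hD; have {}hD := hD _.
have {}hD : `|bernoulli_sum N t - bernoulli_lim t - D K%:R^-1| <= C / h * (t - K%:R^-1).
  apply: hD => x /andP[Kx xt]; apply: hC; rewrite Kx (le_trans xt)//.
have Ch : C / h * (t - K%:R^-1) <= e / 2.
  apply: (@le_trans _ _ (C / h * pi)).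
    by apply: ler_wpM2l; [apply: divr_ge0 => //; exact: ltW|move: tpi Ki; lra].
  rewrite mulrAC ler_pdivrMr// -ler_pdivrMl ?divr_gt0//.
  have -> : (e / 2)^-1 * (C * pi) = 2 * C * pi / e.
    by field; rewrite gt_eqF.
  apply: (@le_trans _ _ N%:R); last by rewrite lerDl invr_ge0.
  apply: (@le_trans _ _ N0%:R); last by rewrite ler_nat.
  by apply: ltW; exact: truncnS_gt.
rewrite -[X in `|X|](subrK (D K%:R^-1)).
apply: (le_trans (ler_normD _ _)).
by move: hD Ch sm Ke; rewrite /D; lra.
Qed.

(** Both sides are symmetric about [pi]. *)
Lemma bernoulli_sum_cvg t e : 0 <= t <= 2 * pi -> 0 < e ->
  exists N0, forall N, (N0 <= N)%N -> `|bernoulli_sum N t - bernoulli_lim t| <= e.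
Proof.
move=> /andP[t0 t2pi] e0.
have [tpi|pit] := leP t pi.
  by apply: bernoulli_sum_cvg_half => //; rewrite t0 tpi.
have [|N0 hN0] := @bernoulli_sum_cvg_half (2 * pi - t) e _ e0.
  by move: t2pi pit; lra.
exists N0 => N /hN0.
have -> : bernoulli_lim (2 * pi - t) = bernoulli_lim t.
  by rewrite /bernoulli_lim; field.
suff -> : bernoulli_sum N (2 * pi - t) = bernoulli_sum N t by [].
apply: eq_bigr => k _; congr ((1 - _) / _).
rewrite mulrBr cosB (_ : k.+1%:R * (2 * pi) = (k.+1 * 2)%:R * pi); last first.
  by rewrite natrM; ring.
rewrite sin_nat_pi mul0r addr0.
suff -> : cos ((k.+1 * 2)%:R * pi) = 1 :> R by rewrite mul1r.
have -> : (k.+1 * 2)%:R * pi = (k.+1%:R * pi) *+ 2 :> R.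
  by rewrite natrM mulr2n; ring.
by rewrite cos_mulr2n cos2sin2 sin_nat_pi expr0n subr0 mulr2n addrK.
Qed.

Definition cos_diff k a b : R := (cos (k.+1%:R * a) - cos (k.+1%:R * b)) / k.+1%:R.

(** Parseval's identity for the indicator of [[a, b]], with an explicit bound
    for the tail. *)
Lemma sum_cos_diff_ge K a b : (0 < K)%N -> 0 <= a -> a <= b -> b <= pi ->
  pi / 2 * (b - a) - 4 / K%:R <= \sum_(k < K) cos_diff k a b ^+ 2.
Proof.
move=> K0 a0 ab bpi.
pose F k := cos_diff k a b ^+ 2.
have FE N : \sum_(k < N) F k = bernoulli_sum N (a + b) + bernoulli_sum N (b - a)
    - 2^-1 * bernoulli_sum N (2 * a) - 2^-1 * bernoulli_sum N (2 * b).
  rewrite !mulr_sumr -big_split/= -!sumrB; apply: eq_bigr => k _.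
  rewrite /F /cos_diff; have k0 : (k.+1%:R : R) != 0 by rewrite pnatr_eq0.
  rewrite mulrDr mulrBr cosD cosB.
  have c2 x : cos (k.+1%:R * (2 * x)) = 2 * cos (k.+1%:R * x) ^+ 2 - 1.
    rewrite (_ : _ * (2 * x) = (k.+1%:R * x) *+ 2); last by rewrite mulr2n; ring.
    by rewrite cos_mulr2n mulr2n; ring.
  by rewrite !c2; field.
have LE : bernoulli_lim (a + b) + bernoulli_lim (b - a)
    - 2^-1 * bernoulli_lim (2 * a) - 2^-1 * bernoulli_lim (2 * b) = pi / 2 * (b - a).
  by rewrite /bernoulli_lim; field.
have tail N : (K <= N)%N -> \sum_(k < N) F k <= \sum_(k < K) F k + 4 / K%:R.
  move=> KN; rewrite -!(big_mkord xpredT F) (big_cat_nat (n := K))//= lerD2l.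
  apply: (@le_trans _ _ (\sum_(K <= k < N) 4 * (k.+1%:R ^+ 2)^-1)).
    apply: ler_sum_nat => k _; rewrite /F /cos_diff exprMn exprVn.
    apply: ler_wpM2r; first by rewrite invr_ge0 sqr_ge0.
    have := cos_geN1 (k.+1%:R * a); have := cos_le1 (k.+1%:R * a).
    have := cos_geN1 (k.+1%:R * b); have := cos_le1 (k.+1%:R * b).
    by nra.
  by rewrite -mulr_sumr ler_wpM2l// sum_inv_sqr_tail.
apply/ler_addgt0Pr => e e0.
have e4 : 0 < e / 4 by rewrite divr_gt0.
have [|N1 h1] := @bernoulli_sum_cvg (a + b) (e / 4) _ e4; first by move: a0 ab bpi; lra.
have [|N2 h2] := @bernoulli_sum_cvg (b - a) (e / 4) _ e4; first by move: a0 ab bpi (pi_ge0 R); lra.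
have [|N3 h3] := @bernoulli_sum_cvg (2 * a) (e / 4) _ e4; first by move: a0 ab bpi; lra.
have [|N4 h4] := @bernoulli_sum_cvg (2 * b) (e / 4) _ e4; first by move: a0 ab bpi; lra.
pose N := (K + N1 + N2 + N3 + N4)%N.
have := tail N; rewrite FE => {}tail.
have {}tail := tail ltac:(rewrite /N; lia).
move: (h1 N ltac:(rewrite /N; lia)) (h2 N ltac:(rewrite /N; lia))
  (h3 N ltac:(rewrite /N; lia)) (h4 N ltac:(rewrite /N; lia)).
rewrite !ler_norml => /andP[a1 _] /andP[a2 _] /andP[_ a3] /andP[_ a4].
by rewrite -LE; move: tail a1 a2 a3 a4; rewrite /F; lra.
Qed.

End sine_series.

(** * Sine modes on a large cube *)

Section trig_modes.
Context {R : realType}.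
Local Notation leb := (@lebesgue_measure R).
Implicit Types (x a b c L : R).

Lemma integral_itv_primitive (g G : R -> R) a b : a <= b -> continuous g ->
  (forall x, is_derive x 1 G (g x)) ->
  leb.-integrable setT (EFin \o (g \_ `[a, b])) /\
  \int[leb]_x (g \_ `[a, b]) x = G b - G a.
Proof.
move=> ab cg dG.
have cg' : {within `[a, b], continuous g} by exact: continuous_subspaceT.
split.
  rewrite -restrict_EFin; apply/integrable_restrict => //; rewrite setTI.
  by apply: continuous_compact_integrable => //; exact: segment_compact.
rewrite -Rintegral_mkcond; move: ab; rewrite le_eqVlt => /predU1P[->|ab].
  by rewrite set_itv1 Rintegral_set1 subrr.
rewrite /Rintegral (continuous_FTC2 ab cg' (F := G))//.
- split.
  + by move=> x _; have [] := dG x.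
  + exact: cvg_at_right_filter (isd_cont (dG a)).
  + exact: cvg_at_left_filter (isd_cont (dG b)).
- by move=> x _; rewrite derive1E; have /@derive_val -> := dG x.
Qed.

(** The angle runs from [0] to [pi] as [x] runs through [[-L, L]]. *)
Definition angle L x : R := pi / (2 * L) * (x + L).
Definition sinw L k x : R := sin (k%:R * angle L x).
Definition cosw L k x : R := cos (k%:R * angle L x).

Section interval.
Variable L : R.
Hypothesis L_gt0 : 0 < L.
Local Notation rho := (pi / (2 * L)).
Local Notation I := (`[- L, L]%classic).

Lemma rho_gt0 : 0 < rho.
Proof. by rewrite divr_gt0 ?pi_gt0 ?mulr_gt0. Qed.

Lemma angle_left : angle L (- L) = 0.
Proof. by rewrite /angle addNr mulr0. Qed.

Lemma angle_right : angle L L = pi.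
Proof. by rewrite /angle; field; rewrite gt_eqF. Qed.

Lemma wave_derive (c x : R) : is_derive x 1 (fun y => c * angle L y) (c * rho).
Proof.
apply: (is_derive_eq (isdZ c (isdZ rho (isdD (isd_id x) (isd_cst L x))))).
by rewrite addr0 mulr1.
Qed.

Lemma smooth_sinw k : smooth (sinw L k).
Proof.
rewrite (_ : sinw L k = fun x => sin ((k%:R * rho) * x + k%:R * rho * L)).
  by apply: (@smooth_affine R sin); exact: smooth_sin.
by apply/funext => x; rewrite /sinw /angle; congr sin; ring.
Qed.

Lemma smooth_cosw k : smooth (cosw L k).
Proof.
rewrite (_ : cosw L k = fun x => cos ((k%:R * rho) * x + k%:R * rho * L)).
  by apply: (@smooth_affine R cos); exact: smooth_cos.
by apply/funext => x; rewrite /cosw /angle; congr cos; ring.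
Qed.

Lemma sinw_derive k x : is_derive x 1 (sinw L k) (k%:R * rho * cosw L k x).
Proof.
apply: (is_derive_eq (@isd_comp _ sin (fun y => k%:R * angle L y) x _ _
  (is_derive_sin _) (wave_derive _ _))).
by rewrite mulrC.
Qed.

Lemma cosw_derive k x : is_derive x 1 (cosw L k) (- (k%:R * rho) * sinw L k x).
Proof.
apply: (is_derive_eq (@isd_comp _ cos (fun y => k%:R * angle L y) x _ _
  (is_derive_cos _) (wave_derive _ _))).
by rewrite /sinw; ring.
Qed.

Lemma integral_cos_wave (c : R) : c != 0 -> sin (c * pi) = 0 ->
  leb.-integrable setT (EFin \o ((fun x => cos (c * angle L x)) \_ I)) /\
  \int[leb]_x ((fun x => cos (c * angle L x)) \_ I) x = 0.
Proof.
move=> c0 s0; have LL : - L <= L by move: L_gt0; lra.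
have r0 : rho != 0 by rewrite gt_eqF// rho_gt0.
have [||-> ->] := @integral_itv_primitive (fun x => cos (c * angle L x))
  (fun x => (c * rho)^-1 * sin (c * angle L x)) _ _ LL.
- move=> x; apply: continuous_comp; last exact: continuous_cos.
  exact: isd_cont (wave_derive c x).
- move=> x; apply: (is_derive_eq (isdZ (c * rho)^-1
    (@isd_comp _ sin (fun y => c * angle L y) x _ _ (is_derive_sin _)
      (wave_derive c x)))).
  by rewrite [cos _ * _]mulrC mulKf// mulf_neq0.
- by split => //; rewrite angle_left angle_right mulr0 sin0 s0 !mulr0 subr0.
Qed.

Lemma integral_cst_itv (c : R) :
  leb.-integrable setT (EFin \o ((fun=> c) \_ I)) /\
  \int[leb]_x ((fun=> c) \_ I) x = 2 * L * c.
Proof.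
have LL : - L <= L by move: L_gt0; lra.
have [||-> ->] := @integral_itv_primitive (fun=> c) (fun x => c * x) _ _ LL.
- exact: cst_continuous.
- by move=> x; apply: (is_derive_eq (isdZ c (isd_id x))); rewrite mulr1.
- by split => //; ring.
Qed.

Lemma patchM (f g : R -> R) x : (f \_ I) x * (g \_ I) x = ((fun y => f y * g y) \_ I) x.
Proof. by rewrite !patchE; case: ifP => //; rewrite mulr0. Qed.

Lemma sin_nat_sub_pi k l : sin ((k%:R - l%:R) * pi) = 0 :> R.
Proof. by rewrite mulrBl sinB !sin_nat_pi mulr0 mul0r subrr. Qed.

Lemma integral_cos_waves k l (s : R) : (0 < k)%N -> (0 < l)%N -> `|s| = 1 ->
  let f x := 2^-1 * cos ((k%:R - l%:R) * angle L x)
      + s * (2^-1 * cos ((k + l)%:R * angle L x)) in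
  leb.-integrable setT (EFin \o (f \_ I)) /\
  \int[leb]_x (f \_ I) x = if k == l then L else 0.
Proof.
move=> k0 l0 s1 f.
have kl0 : (k + l)%:R != 0 :> R by rewrite pnatr_eq0 addn_eq0 negb_and -!lt0n k0.
have [i2 J2] := integral_cos_wave kl0 (sin_nat_pi _).
pose f1 : R -> R := (fun x => cos ((k%:R - l%:R) * angle L x)) \_ I.
pose f2 : R -> R := (fun x => cos ((k + l)%:R * angle L x)) \_ I.
have [i1 J1] : leb.-integrable setT (EFin \o f1) /\
    \int[leb]_x f1 x = if k == l then 2 * L else 0.
  have [kl|kl] := eqVneq k l.
    rewrite (_ : f1 = (fun=> 1 : R) \_ I).
      by have [-> ->] := integral_cst_itv 1; rewrite mulr1.
    by apply/funext => x; rewrite /f1 kl !patchE subrr mul0r cos0.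
  apply: integral_cos_wave; last exact: sin_nat_sub_pi.
  by rewrite subr_eq0 eqr_nat.
have fE x : (f \_ I) x = 2^-1 * f1 x + s * 2^-1 * f2 x.
  rewrite /f1 /f2 !patchE; case: ifP => _; last by rewrite !mulr0 addr0.
  by rewrite /f; ring.
have Z1 : leb.-integrable setT (EFin \o (fun x => 2^-1 * f1 x)).
  exact: (integrableZl measurableT 2^-1 i1).
have Z2 : leb.-integrable setT (EFin \o (fun x => s * 2^-1 * f2 x)).
  exact: (integrableZl measurableT (s * 2^-1) i2).
split.
  rewrite (_ : _ \o _ = fun x => ((2^-1 * f1 x)%:E + (s * 2^-1 * f2 x)%:E)%E).
    exact: (integrableD measurableT Z1 Z2).
  by apply/funext => x /=; rewrite fE.
under eq_Rintegral do rewrite fE.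
rewrite RintegralD// !RintegralZl// J1 J2 mulr0 addr0.
by case: ifP => _; rewrite ?mulr0// mulrA mulVf ?mul1r// pnatr_eq0.
Qed.

Lemma sinw_orthogonal k l : (0 < k)%N -> (0 < l)%N ->
  leb.-integrable setT (EFin \o (fun x => (sinw L k \_ I) x * (sinw L l \_ I) x)) /\
  \int[leb]_x ((sinw L k \_ I) x * (sinw L l \_ I) x) = if k == l then L else 0.
Proof.
move=> k0 l0; have := @integral_cos_waves k l (-1) k0 l0; rewrite normrN normr1.
move=> /(_ erefl) /=; set f := (X in (X \_ _)) => H.
rewrite (_ : (fun x => _) = f \_ I) //.
apply/funext => x; rewrite patchM /patch; case: ifP => // _.
by rewrite /f /sinw natrD mulrBl mulrDl cosB cosD; field.
Qed.

Lemma cosw_orthogonal k l : (0 < k)%N -> (0 < l)%N ->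
  leb.-integrable setT (EFin \o (fun x => (cosw L k \_ I) x * (cosw L l \_ I) x)) /\
  \int[leb]_x ((cosw L k \_ I) x * (cosw L l \_ I) x) = if k == l then L else 0.
Proof.
move=> k0 l0; have := @integral_cos_waves k l 1 k0 l0; rewrite normr1.
move=> /(_ erefl) /=; set f := (X in (X \_ _)) => H.
rewrite (_ : (fun x => _) = f \_ I) //.
apply/funext => x; rewrite patchM /patch; case: ifP => // _.
by rewrite /f /cosw natrD mulrBl mulrDl cosB cosD; field.
Qed.

Lemma integral_indicator_sinw k a b : (0 < k)%N -> - L <= a -> a <= b -> b <= L ->
  leb.-integrable setT (EFin \o (fun x => (cst (1 : R) \_ `[a, b]) x * (sinw L k \_ I) x)) /\
  \int[leb]_x ((cst (1 : R) \_ `[a, b]) x * (sinw L k \_ I) x) =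
  cos_diff k.-1 (angle L a) (angle L b) / rho.
Proof.
move=> k0 La ab bL.
have k1 : (k%:R : R) != 0 by rewrite pnatr_eq0 -lt0n.
have r0 : rho != 0 by rewrite gt_eqF// rho_gt0.
have p1 : pi != 0 :> R by rewrite gt_eqF// pi_gt0.
have L1 : L != 0 by rewrite gt_eqF.
have [||i1 J1] := @integral_itv_primitive (sinw L k)
    (fun x => - (k%:R * rho)^-1 * cosw L k x) _ _ ab.
- by apply: smooth_continuous; exact: smooth_sinw.
- move=> x; apply: (is_derive_eq (isdZ (- (k%:R * rho)^-1) (cosw_derive k x))).
  by rewrite mulNr mulNr mulrN opprK mulKf// mulf_neq0.
rewrite (_ : (fun x => _) = sinw L k \_ `[a, b]); last first.
  apply/funext => x; rewrite !patchE; case: ifPn => [|_]; last by rewrite mul0r.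
  rewrite inE/= in_itv/= => /andP[ax xb].
  by rewrite mul1r mem_set//= in_itv/= (le_trans La ax) (le_trans xb bL).
split => //; rewrite J1 /cos_diff prednK// /cosw.
by move: rho => r; rewrite invfM; ring.
Qed.

End interval.
End trig_modes.

(** * Square-integrable functions are determined by their integrals over boxes *)

Section boxes.
Context {R : realType} {n : nat}.
Local Notation leb := (@lebesgue_measure R).
Local Notation mu := (lebesgue_rV R n).
Implicit Types (c d : 'I_n -> R).

Lemma rL2_prodf (F : 'I_n -> R -> R) : (forall i, rL2 leb (F i)) -> rL2 mu (prodf F).
Proof.
move=> F2; split; first by apply: measurable_prodf => i; case: (F2 i).
have [i2 _] := @integral_prodf R n (fun i x => F i x ^+ 2) (fun i => (F2 i).2).
rewrite (_ : (fun x => _) = prodf (fun i x => F i x ^+ 2))//.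
by apply/funext => x; rewrite /prodf prodrXl.
Qed.

Lemma ip_prodf (F G : 'I_n -> R -> R) :
  (forall i, rL2 leb (F i)) -> (forall i, rL2 leb (G i)) ->
  ip mu (prodf F) (prodf G) = \prod_i ip leb (F i) (G i).
Proof.
move=> F2 G2; have [_ <-] := @integral_prodf R n (fun i x => F i x * G i x)
  (fun i => rL2_integrableM (F2 i) (G2 i)).
by apply: eq_Rintegral => x _; rewrite /prodf big_split.
Qed.

Lemma rL2_patch (g : R -> R) a b : continuous g -> rL2 leb (g \_ `[a, b]).
Proof.
move=> cg.
have mg : measurable_fun setT (g \_ `[a, b]).
  apply/(measurable_restrictT _ (measurable_itv _)).
  by apply: measurable_funTS; exact: continuous_measurable_fun.
split => //.
have -> : (fun x => (g \_ `[a, b]) x ^+ 2) = (fun x => g x ^+ 2) \_ `[a, b].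
  by apply/funext => x; rewrite !patchE; case: ifP => // _; rewrite expr0n.
rewrite -restrict_EFin; apply/integrable_restrict => //; rewrite setTI.
apply: continuous_compact_integrable; first exact: segment_compact.
by apply: cwX; exact: continuous_subspaceT.
Qed.

Definition interval_indic (a b : R) : R -> R := cst (1 : R) \_ `[a, b].

Definition box_indic c d : 'rV[R]_n -> R :=
  prodf (fun i => interval_indic (c i) (d i)).

Definition box c d : set 'rV[R]_n :=
  [set x | forall i, c i <= x ord0 i <= d i].

Lemma box_indicE c d (x : 'rV[R]_n) : box_indic c d x = if x \in box c d then 1 else 0.
Proof.
rewrite /box_indic /prodf; case: ifPn => [|].
  rewrite inE => xB; apply: big1 => i _; rewrite /interval_indic patchE.
  by rewrite mem_set// /= in_itv/= xB.
rewrite notin_setE => nB.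
have [i ni] : exists i, ~ (c i <= x ord0 i <= d i).
  by apply: contrapT => h; apply: nB => i; apply: contrapT => k; apply: h; exists i.
by rewrite (bigD1 i)//= {1}/interval_indic patchE memNset ?mul0r//.
Qed.

Lemma rL2_box_indic c d : rL2 mu (box_indic c d).
Proof. by apply: rL2_prodf => i; apply: rL2_patch; exact: cst_continuous. Qed.

Lemma measurable_box c d : measurable (box c d).
Proof.
have [mb _] := rL2_box_indic c d.
have -> : box c d = box_indic c d @^-1` [set 1].
  apply/seteqP; split => x /=; rewrite box_indicE; first by move=> xB; rewrite mem_set.
  by case: ifPn => [|_ /eqP]; [rewrite inE|rewrite eq_sym oner_eq0].
rewrite -[X in measurable X]setTI; apply: mb => //.
Qed.

Lemma boxI c d c' d' : box c d `&` box c' d' =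
  box (fun i => Num.max (c i) (c' i)) (fun i => Num.min (d i) (d' i)).
Proof.
apply/seteqP; split => x /=.
  by move=> [h1 h2] i; rewrite ge_max le_min; move: (h1 i) (h2 i) => /andP[-> ->] /andP[-> ->].
by move=> h; split => i; move: (h i); rewrite ge_max le_min => /andP[/andP[? ?] /andP[? ?]];
  apply/andP.
Qed.

Lemma box_generates (A : set 'rV[R]_n) : measurable A ->
  <<s [set B | exists c d, B = box c d] >> A.
Proof.
pose G : set (set 'rV[R]_n) := [set B | exists c d, B = box c d].
have mc (i : 'I_n) : measurable_fun (setT : set (g_sigma_algebraType G))
    (fun v : g_sigma_algebraType G => (v : 'rV[R]_n) ord0 i : measurableTypeR R).
  apply: (@measurability _ _ (g_sigma_algebraType G) (measurableTypeR R) setT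
    (fun v : g_sigma_algebraType G => (v : 'rV[R]_n) ord0 i : measurableTypeR R)
    _ (RGenCInfty.measurableE R)) => _ [_ [a ->] <-].
  have -> : setT `&` (fun v : g_sigma_algebraType G => (v : 'rV[R]_n) ord0 i) @^-1` `[a, +oo[ =
      \bigcup_k box (fun j => if j == i then a else - k%:R) (fun=> k%:R).
    apply/seteqP; split => x /=; rewrite ?setTI/=.
      rewrite in_itv/= andbT => -[_ ax].
      pose K := \sum_j `|(x : 'rV[R]_n) ord0 j|.
      have leK j : `|(x : 'rV[R]_n) ord0 j| <= K.
        by rewrite /K (bigD1 j)//= lerDl sumr_ge0.
      exists (Num.truncn K).+1 => //= j.
      have := le_trans (leK j) (ltW (truncnS_gt K)); rewrite ler_norml.
      by case: eqP => [->|_] /andP[h1 h2]; rewrite ?h1 h2 ?ax.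
    by move=> [k _ /= /(_ i)]; rewrite eqxx in_itv/= andbT => /andP[].
  apply: bigcupT_measurable => k; apply: sub_sigma_algebra.
  by eexists; eexists; reflexivity.
move=> mA.
suff : g_sigma_preimage (fun (i : 'I_n) (v : 'rV[R]_n) => v ord0 i : measurableTypeR R) `<=` <<s G >>.
  exact.
apply: smallest_sub; first exact: smallest_sigma_algebra.
move=> B; rewrite -bigcup_seq => -[i _ /= [C mC <-]].
exact: mc.
Qed.

(** Boxes are stable under intersection and generate the sigma-algebra; the
    restriction to a large cube makes [b] integrable. *)
Lemma ae_zero_of_boxes (b : 'rV[R]_n -> R) : rL2 mu b ->
  (forall c d, ip mu b (box_indic c d) = 0) -> {ae mu, forall x, b x = 0}.
Proof.
move=> b2 b0.
have h M : {ae mu, forall x, x \in box (fun=> - M%:R) (fun=> M%:R) -> b x = 0}.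
  set Q := box _ _; pose h x := b x * box_indic (fun=> - M%:R) (fun=> M%:R) x.
  have ih : mu.-integrable setT (EFin \o h).
    by apply: rL2_integrableM => //; exact: rL2_box_indic.
  have ihA A : measurable A -> mu.-integrable A (EFin \o h).
    by move=> mA; exact: integrableS ih.
  have zero A : measurable A -> (\int[mu]_(x in A) (h x)%:E = 0)%E.
    move=> mA; have /box_generates := mA.
    pose H := [set B : set 'rV[R]_n | measurable B /\ (\int[mu]_(x in B) (h x)%:E = 0)%E].
    have GH c d : (\int[mu]_(x in box c d) (h x)%:E = 0)%E.
      have := b0 (fun i => Num.max (c i) (- M%:R)) (fun i => Num.min (d i) M%:R).
      rewrite /ip -[RHS]/(fine 0%E) /Rintegral => e.
      rewrite integral_mkcond.
      have hE : ((EFin \o h) \_ (box c d)) = (fun x => (b x * box_indic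
          (fun i => Num.max (c i) (- M%:R)) (fun i => Num.min (d i) M%:R) x)%:E).
        apply/funext => x; rewrite patchE /h /= !box_indicE -boxI in_setI.
        by case: ifP => //= _; rewrite mulr0.
      rewrite [X in integral _ _ X]hE -[LHS]fineK.
        by rewrite e.
      apply: integrable_fin_num => //.
      by apply: rL2_integrableM => //; exact: rL2_box_indic.
    have zT : (\int[mu]_x (h x)%:E = 0)%E.
      have := b0 (fun=> - M%:R) (fun=> M%:R); rewrite /ip /Rintegral => e.
      by rewrite -[LHS]fineK ?e//; exact: integrable_fin_num.
    have sub : <<s [set B | exists c d, B = box c d] >> `<=` H.
      apply: lambda_system_subset => //.
      - by move=> _ _ [c [d ->]] [c' [d' ->]]; rewrite boxI; do 2 eexists; reflexivity.
      - apply/dynkin_lambda_system; split.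
        + by split => //; exact: zT.
        + move=> B [mB B0]; split; first exact: measurableC.
          have := zT; rewrite -(setUv B) integral_setU//.
          * by rewrite B0 add0e.
          * exact: measurableC.
          * by rewrite setUv; exact: measurable_int ih.
          * by rewrite disj_set2E setICr.
        + move=> F tF HF; split; first by apply: bigcupT_measurable => k; case: (HF k).
          rewrite integral_bigcup//.
          * by rewrite eseries0// => k _ _; case: (HF k).
          * by move=> k; case: (HF k).
          * by apply: ihA; apply: bigcupT_measurable => k; case: (HF k).
      - by move=> _ [c [d ->]]; split; [exact: measurable_box|exact: GH].
    by move=> /sub[].
  have : ae_eq mu setT (EFin \o h) (cst 0%E).
    apply: integral_ae_eq => // A _ mA.
    by rewrite integral0; exact: zero.
  apply: filterS => x /(_ Logic.I) /= [] + xQ.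
  by rewrite /h box_indicE xQ mulr1.
have := ae_foralln h; apply: filterS => x hx.
pose K := \sum_j `|x ord0 j|.
apply: (hx (Num.truncn K).+1); rewrite inE => j.
have leK : `|x ord0 j| <= K by rewrite /K (bigD1 j)//= lerDl sumr_ge0.
by have := le_trans leK (ltW (truncnS_gt K)); rewrite ler_norml.
Qed.

End boxes.

(** * The mass of the middle frequencies *)

Section expansion.
Context d (T : measurableType d) {R : realType}.
Variables (mu : {measure set T -> \bar R}) (I : finType) (e : I -> T -> R) (N : R).
Hypothesis N_gt0 : 0 < N.
Hypothesis e2 : forall i, rL2 mu (e i).
Hypothesis eN : forall i j, ip mu (e i) (e j) = if i == j then N else 0.

Definition expansion (q : I -> R) : T -> R := fun x => \sum_i q i / N * e i x.

Lemma rL2_expansion q : rL2 mu (expansion q).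
Proof. by apply: rL2_sum => i; exact: rL2Z. Qed.

Lemma ip_expansionl f q : rL2 mu f ->
  ip mu (expansion q) f = \sum_i q i / N * ip mu f (e i).
Proof.
move=> f2; rewrite ip_suml//; last by move=> i; exact: rL2Z.
by apply: eq_bigr => i _; rewrite ipZl// ipC.
Qed.

Lemma ip_expansion c q :
  ip mu (expansion c) (expansion q) = (\sum_i c i * q i) / N.
Proof.
rewrite ip_expansionl; last exact: rL2_expansion.
rewrite mulr_suml; apply: eq_bigr => i _.
rewrite ip_expansionl// (bigD1 i)//= big1 ?addr0.
  by rewrite eN eqxx; field; rewrite gt_eqF.
by move=> j ji; rewrite eN eq_sym (negPf ji) mulr0.
Qed.

End expansion.

Section modes.
Context {R : realType} {n D : nat}.
Local Notation leb := (@lebesgue_measure R).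
Local Notation mu := (lebesgue_rV R n).
Variables (L : R) (w : 'I_D -> nat).
Hypothesis L_gt0 : 0 < L.
Hypothesis w_gt0 : forall m, (0 < w m)%N.
Hypothesis w_inj : injective w.

Definition mode1 (j : option 'I_n) (i : 'I_n) (k : nat) : R -> R :=
  (if Some i == j then cosw L k else sinw L k) \_ `[- L, L].

(** Sine products vanish on the boundary of the cube; the cosine in direction
    [j] is what a derivative in this direction produces. *)
Definition mode (j : option 'I_n) (k : {ffun 'I_n -> 'I_D}) : 'rV[R]_n -> R :=
  prodf (fun i => mode1 j i (w (k i))).

Lemma rL2_mode1 j i k : rL2 leb (mode1 j i k).
Proof.
rewrite /mode1; apply: rL2_patch; case: ifP => _; apply: smooth_continuous.
  exact: smooth_cosw.
exact: smooth_sinw.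
Qed.

Lemma rL2_mode j k : rL2 mu (mode j k).
Proof. by apply: rL2_prodf => i; exact: rL2_mode1. Qed.

Lemma mode_orthogonal j k l :
  ip mu (mode j k) (mode j l) = if k == l then L ^+ n else 0.
Proof.
rewrite ip_prodf; [|by move=> i; exact: rL2_mode1..].
have E i : ip leb (mode1 j i (w (k i))) (mode1 j i (w (l i))) =
    if k i == l i then L else 0.
  rewrite -(inj_eq w_inj) /mode1 /ip; case: ifP => _.
    by have [_ ->] := cosw_orthogonal L_gt0 (w_gt0 (k i)) (w_gt0 (l i)).
  by have [_ ->] := sinw_orthogonal L_gt0 (w_gt0 (k i)) (w_gt0 (l i)).
rewrite (eq_bigr _ (fun i _ => E i)).
have [->|kl] := eqVneq k l.
  by under eq_bigr do rewrite eqxx; rewrite prodr_const card_ord.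
have [i ki] : exists i, k i != l i.
  apply/existsP; apply: contraNT kl; rewrite negb_exists => /forallP h.
  by apply/eqP/ffunP => i; have := h i; rewrite negbK => /eqP.
by rewrite (bigD1 i)//= (negPf ki) mul0r.
Qed.

Lemma mode_bessel j f : rL2 mu f ->
  \sum_k ip mu f (mode j k) ^+ 2 <= L ^+ n * ip mu f f.
Proof.
move=> f2; apply: bessel => //; first exact: exprn_gt0.
  by move=> k; exact: rL2_mode.
by move=> k l; exact: mode_orthogonal.
Qed.

End modes.

Section interval_mass.
Context {R : realType}.
Local Notation leb := (@lebesgue_measure R).

(** Wave numbers between [N + 1] and [p^2 N]; for [L = p N] these are the
    frequencies between [pi / (2 p)] and [p pi / 2]. *)
Definition wave {D} N (m : 'I_D) : nat := (N + m).+1.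

Lemma wave_inj D N : injective (@wave D N).
Proof. by move=> m1 m2 [/addnI]; exact: val_inj. Qed.

Lemma ip_interval_indic (c d : R) : c <= d ->
  ip leb (interval_indic c d) (interval_indic c d) = d - c.
Proof.
move=> cd; have [_ <-] := integral_itv_primitive cd (@cst_continuous R R 1) (@isd_id R).
apply: eq_Rintegral => x _; rewrite /interval_indic !patchE.
by case: ifP => //; rewrite ?mulr1 ?mulr0.
Qed.

(** Parseval's identity bounds the full sum from below; the waves up to [N]
    contribute at most [N (d - c)^2 / L] because each coefficient is at most
    [d - c], and those beyond [p^2 N] at most a multiple of [L / (p^2 N)]. *)
Lemma interval_mass (p N : nat) (L c d : R) : (0 < p)%N -> (0 < N)%N ->
  L = (p * N)%:R -> - L <= c -> c <= d -> d <= L ->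
  (d - c) - (4 + (d - c) ^+ 2) / p%:R <=
  L^-1 * \sum_(m < (p * p * N - N)%N) ip leb (interval_indic c d)
     (sinw L (wave N m) \_ `[- L, L]) ^+ 2.
Proof.
move=> p0 N0; rewrite natrM => LE Lc cd dL.
have L0 : 0 < L by rewrite LE mulr_gt0 ?ltr0n.
pose rho := pi / (2 * L).
have rho0 : 0 < rho by exact: rho_gt0.
have pi2 := pi_ge2 R; have pi0 := pi_gt0 R.
have p1 : 0 < p%:R :> R by rewrite ltr0n.
have N1 : 0 < N%:R :> R by rewrite ltr0n.
pose F k := cos_diff k (angle L c) (angle L d) ^+ 2.
have -> : \sum_(m < (p * p * N - N)%N) ip leb (interval_indic c d)
     (sinw L (wave N m) \_ `[- L, L]) ^+ 2 =
     rho ^- 2 * \sum_(N <= k < p * p * N) F k.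
  have -> : \sum_(N <= k < p * p * N) F k =
      \sum_(m < (p * p * N - N)%N) F (N + m)%N.
    have := big_addn 0 (p * p * N) N xpredT F; rewrite add0n => ->.
    by rewrite big_mkord; apply: eq_bigr => m _; rewrite addnC.
  rewrite mulr_sumr; apply: eq_bigr => m _.
  have [_ e] := @integral_indicator_sinw R L L0 (wave N m) c d isT Lc cd dL.
  by rewrite /ip e /F /wave /= exprMn exprVn mulrC.
have NppN : (N <= p * p * N)%N by rewrite leq_pmull// muln_gt0 p0.
have split_sum : \sum_(N <= k < p * p * N) F k =
    \sum_(k < p * p * N) F k - \sum_(k < N) F k.
  rewrite -!(big_mkord xpredT F) (big_cat_nat (m := 0%N) (n := N) (p := (p * p * N)%N))//=.
  by rewrite addrAC subrr add0r.
have angleB : angle L d - angle L c = rho * (d - c) by rewrite /angle /rho; ring.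
have a0 : 0 <= angle L c.
  by rewrite mulr_ge0 ?(ltW rho0)//; move: Lc; lra.
have ad : angle L c <= angle L d.
  by rewrite -subr_ge0 angleB mulr_ge0 ?(ltW rho0)// subr_ge0.
have dpi : angle L d <= pi.
  rewrite -[leRHS](angle_right L0) /angle ler_wpM2l ?(ltW rho0)//.
  by move: dL; lra.
have big := sum_cos_diff_ge _ a0 ad dpi.
have {}big := big (p * p * N)%N ltac:(by rewrite !muln_gt0 p0 N0).
have low : \sum_(k < N) F k <= N%:R * (rho * (d - c)) ^+ 2.
  apply: (@le_trans _ _ (\sum_(k < N) (rho * (d - c)) ^+ 2)).
    apply: ler_sum => k _; rewrite /F -(real_normK (num_real (cos_diff _ _ _))).
    rewrite lerXn2r ?nnegrE//; first by rewrite -angleB subr_ge0.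
    rewrite /cos_diff normrM [`|_^-1|]gtr0_norm ?invr_gt0 ?ltr0n//.
    rewrite ler_pdivrMr ?ltr0n// -angleB.
    have kk : k.+1%:R * angle L c <= k.+1%:R * angle L d.
      by rewrite ler_pM2l ?ltr0n.
    have h := @le_increment R cos (fun y => - sin y) _ _ 1 kk
      (fun y _ => is_derive_cos y).
    rewrite distrC mulrBl !(mulrC (angle L _)) -[leRHS]mul1r.
    by apply: h => y _; rewrite normrN sin_max.
  by rewrite sumr_const card_ord mulr_natl.
rewrite split_sum.
have h : pi / 2 * (rho * (d - c)) - 4 / (p * p * N)%:R - N%:R * (rho * (d - c)) ^+ 2
    <= \sum_(k < p * p * N) F k - \sum_(k < N) F k.
  by rewrite -angleB in low *; move: big low; rewrite /F; lra.
have c0 : 0 <= L^-1 * rho ^- 2.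
  by apply: mulr_ge0; rewrite invr_ge0 ?exprn_ge0// ltW.
have {}h := ler_wpM2l c0 h.
rewrite mulrA; apply: le_trans h.
have n0 : L != 0 by rewrite gt_eqF.
have n1 : p%:R != 0 :> R by rewrite gt_eqF.
have n2 : N%:R != 0 :> R by rewrite gt_eqF.
have n3 : pi != 0 :> R by rewrite gt_eqF.
have -> : L^-1 * rho ^- 2 * (pi / 2 * (rho * (d - c)) - 4 / (p * p * N)%:R
    - N%:R * (rho * (d - c)) ^+ 2) =
    (d - c) - 16 / pi ^+ 2 / p%:R - (d - c) ^+ 2 / p%:R.
  have alg (P X a b : R) : P != 0 -> a != 0 -> b != 0 ->
      (a * b)^-1 * (P / (2 * (a * b))) ^- 2 *
      (P / 2 * (P / (2 * (a * b)) * X) - 4 / (a * a * b)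
       - b * (P / (2 * (a * b)) * X) ^+ 2) = X - 16 / P ^+ 2 / a - X ^+ 2 / a.
    by move=> P0 a1 b0; field; rewrite P0 a1 b0.
  by rewrite /rho LE !natrM; exact: alg.
have : 16 / pi ^+ 2 / p%:R <= 4 / p%:R :> R.
  rewrite ler_pM2r ?invr_gt0// ler_pdivrMr ?exprn_gt0//.
  have : 2 * 2 <= pi * pi :> R by apply: ler_pM.
  by rewrite expr2; lra.
by rewrite mulrDl; lra.
Qed.

Lemma interval_mass_le (p N : nat) (L c d : R) : 0 < L -> c <= d ->
  L^-1 * \sum_(m < (p * p * N - N)%N) ip leb (interval_indic c d)
     (sinw L (wave N m) \_ `[- L, L]) ^+ 2 <= d - c.
Proof.
move=> L0 cd.
have := @bessel _ _ R leb 'I_(p * p * N - N)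
  (fun m => sinw L (wave N m) \_ `[- L, L]) L (interval_indic c d) L0.
move=> /(_ (fun m => rL2_patch _ _ (smooth_continuous (@smooth_sinw R L _)))).
rewrite ip_interval_indic// => h; rewrite ler_pdivrMl//; apply: h.
  move=> k l; rewrite /ip -(inj_eq (@wave_inj _ N)).
  by have [_ ->] := @sinw_orthogonal R L L0 (wave N k) (wave N l) isT isT.
by apply: rL2_patch; exact: cst_continuous.
Qed.

End interval_mass.

Section spectral_mass.
Context {R : realType} {n : nat}.
Local Notation leb := (@lebesgue_measure R).
Local Notation mu := (lebesgue_rV R n).
Variables (bump : R -> R) (B : R).
Hypothesis smooth_bump : smooth bump.
Hypothesis bump0 : bump 0 = 1.
Hypothesis bump_le : forall x, `|bump x| <= B.

Definition cutoff (L : R) : 'rV[R]_n -> R := prodf (fun _ t => bump (L^-1 * t)).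

Lemma prodf_norm_le (F : 'I_n -> R -> R) (C : R) x :
  (forall i t, `|F i t| <= C) -> `|prodf F x| <= C ^+ n.
Proof.
move=> FC; rewrite /prodf normr_prod.
have <- : \prod_(i < n) C = C ^+ n by rewrite prodr_const card_ord.
by apply: ler_prod => i _; rewrite normr_ge0 FC.
Qed.

Lemma continuous_rescaled (L : R) : continuous (fun t => bump (L^-1 * t)).
Proof.
apply: smooth_continuous.
by have := smooth_affine L^-1 0 smooth_bump; under eq_fun do rewrite addr0.
Qed.

Lemma measurable_cutoff (L : R) : measurable_fun setT (cutoff L).
Proof.
by apply: measurable_prodf => i; apply: continuous_measurable_fun; exact: continuous_rescaled.
Qed.

Lemma cutoff_le (L : R) x : `|cutoff L x| <= B ^+ n.
Proof. by apply: prodf_norm_le => i t; exact: bump_le. Qed.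

Lemma rL2_cutoff (b : 'rV[R]_n -> R) L : rL2 mu b -> rL2 mu (fun x => b x * cutoff L x).
Proof. by move=> b2; apply: (rL2M (measurable_cutoff L) (cutoff_le L)). Qed.

Lemma ip_cutoff_le (b : 'rV[R]_n -> R) L : rL2 mu b ->
  ip mu (fun x => b x * cutoff L x) (fun x => b x * cutoff L x) <=
  B ^+ n ^+ 2 * ip mu b b.
Proof. by apply: ip_mul_le; [exact: measurable_cutoff|exact: cutoff_le]. Qed.

Lemma cvg_cutoff (b f : 'rV[R]_n -> R) (p : nat) : (0 < p)%N -> rL2 mu b -> rL2 mu f ->
  (fun N : nat => ip mu (fun x => b x * cutoff (p * N)%:R x) f) @ \oo --> ip mu b f.
Proof.
move=> p0 b2 f2.
have bf := rL2_integrableM b2 f2.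
have bcf N := rL2_integrableM (rL2_cutoff (p * N)%:R b2) f2.
have L0 : (fun N : nat => (p * N)%:R^-1 : R) @ \oo --> (0 : R).
  under eq_fun do rewrite natrM invfM.
  have <- : p%:R^-1 * 0 = 0 :> R by rewrite mulr0.
  apply: cvgMr.
  apply/gtr0_cvgV0; last exact: cvgr_idn.
  by exists 1%N => // N /=; rewrite ltr0n.
have [|||||_ _] := @dominated_convergence _ _ R mu setT measurableT
  (fun N x => (b x * cutoff (p * N)%:R x * f x)%:E)
  (fun x => (b x * f x)%:E) (fun x => (B ^+ n)%:E * `|(b x * f x)%:E|)%E.
- by move=> N; exact: measurable_int (bcf N).
- exact: measurable_int bf.
- apply: aeW => x _; apply: cvg_EFin; first exact: nearW.
  have : (fun N : nat => \prod_(i < n) bump ((p * N)%:R^-1 * x ord0 i)) @ \oo -->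
      \prod_(i < n) bump (0 * x ord0 i).
    apply: (@cvg_big R 'I_n *%R 1 xpredT (@mul_continuous R) _ \oo (index_enum _)
      (fun i (N : nat) => bump ((p * N)%:R^-1 * x ord0 i))
      (fun i => bump (0 * x ord0 i))) => i _.
    apply: (@continuous_cvg _ _ _ \oo _ (fun N : nat => (p * N)%:R^-1 * x ord0 i) bump).
      exact: smooth_continuous.
    exact: cvgMl.
  rewrite [X in _ --> X -> _]big1; last by move=> i _; rewrite mul0r bump0.
  move=> cut1; rewrite -[X in X * f x](mulr1 (b x)).
  by apply: cvgM; [apply: cvgM => //; exact: cvg_cst|exact: cvg_cst].
- by apply: (integrableZl measurableT (B ^+ n)); exact: integrable_abse.
- apply: aeW => x N _; rewrite /= lee_fin mulrAC normrM mulrC.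
  by apply: ler_wpM2r => //; exact: cutoff_le.
rewrite [X in _ --> X -> _](_ : _ = (ip mu b f)%:E); last first.
  by rewrite /ip /Rintegral fineK//; exact: integrable_fin_num.
move=> /fine_cvgP[_]; apply: cvg_trans.
by apply: near_eq_cvg; exact: nearW.
Qed.

(** One factor is exchanged at a time. *)
Lemma prod_gap_le (I : Type) (r : seq I) (l s e : I -> R) :
  (forall i, 0 <= s i <= l i) -> (forall i, l i - s i <= e i) ->
  \prod_(i <- r) l i - \prod_(i <- r) s i <=
  (\sum_(i <- r) e i) * \prod_(i <- r) (1 + l i).
Proof.
move=> sl le; elim: r => [|i r IH]; first by rewrite !big_nil subrr mul0r.
rewrite !big_cons.
have l0 j : 0 <= l j by have /andP[] := sl j; exact: le_trans.
have /andP[s0 sli] := sl i.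
have e0 j : 0 <= e j by apply: le_trans (le j); rewrite subr_ge0; case/andP: (sl j).
set P := \prod_(j <- r) l j in IH *; set S := \prod_(j <- r) s j in IH *.
set Q := \prod_(j <- r) (1 + l j) in IH *.
have P0 : 0 <= P by apply: prodr_ge0.
have PQ : P <= Q by apply: ler_prod => j _; rewrite l0 lerDr ler01.
have Q0 : 0 <= Q by exact: le_trans P0 PQ.
have SP : S <= P by apply: ler_prod => j _.
have E0 : 0 <= \sum_(j <- r) e j by apply: sumr_ge0.
have h1 := ler_wpM2r P0 (le i).
have h2 := ler_wpM2l s0 IH.
have h3 : e i * P <= e i * (1 + l i) * Q.
  rewrite -mulrA; apply: ler_wpM2l => //; apply: le_trans PQ _.
  by rewrite -[leLHS]mul1r ler_wpM2r ?lerDl//; exact: Q0.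
have h4 : s i * ((\sum_(j <- r) e j) * Q) <= (\sum_(j <- r) e j) * ((1 + l i) * Q).
  rewrite mulrCA; apply: ler_wpM2l => //; apply: ler_wpM2r; first exact: Q0.
  by move: sli; lra.
rewrite mulrDl; move: h1 h2 h3 h4; rewrite -(mulrA (e i)); lra.
Qed.

(** For a box on which the mean of [b] is [J <> 0], the modes between
    [N + 1] and [p ^ 2 * N] resolve the indicator of the box up to a small
    [L^2] error when [p] is large, uniformly in [N]; hence the part of [b] that
    they see keeps a mean of size [J / 2]. *)
Lemma spectral_mass (b : 'rV[R]_n -> R) : rL2 mu b -> ~ {ae mu, forall x, b x = 0} ->
  exists p c0 N0, [/\ (0 < p)%N, 0 < c0 & forall N L, (N0 <= N)%N -> (0 < N)%N ->
    L = (p * N)%:R ->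
    c0 * L ^+ n <= \sum_(k : {ffun 'I_n -> 'I_(p * p * N - N)})
      ip mu (fun x => b x * cutoff L x) (mode L (wave N) None k) ^+ 2].
Proof.
move=> b2 bn0.
have [c [d J0]] : exists c d, ip mu b (box_indic c d) != 0.
  apply: contrapT => h; apply: bn0; apply: ae_zero_of_boxes => // c d.
  by apply/eqP; apply/negP => /negP h'; apply: h; exists c, d.
set g := box_indic c d in J0; set J := ip mu b g in J0.
have g2 : rL2 mu g := rL2_box_indic c d.
have cd i : c i <= d i.
  rewrite leNgt; apply/negP => dc; move/eqP: J0; apply.
  rewrite /J /ip (_ : (fun x => _) = cst 0) ?Rintegral_cst ?mul0r//.
  apply/funext => x; rewrite /g box_indicE memNset ?mulr0// => /(_ i).
  by move=> /andP[h1 h2]; move: dc; rewrite ltNge (le_trans h1 h2).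
pose l i := d i - c i.
have l0 i : 0 <= l i by rewrite subr_ge0.
pose K := (\sum_i (4 + l i ^+ 2)) * \prod_i (1 + l i).
pose beta := B ^+ n ^+ 2 * ip mu b b.
have beta0 : 0 <= beta by rewrite mulr_ge0 ?sqr_ge0 ?ip_ge0.
have K0 : 0 <= K.
  apply: mulr_ge0; last by apply: prodr_ge0 => i _; rewrite addr_ge0.
  by apply: sumr_ge0 => i _; rewrite addr_ge0 ?sqr_ge0.
pose V := \prod_i l i.
have V0 : 0 <= V by apply: prodr_ge0.
have gg : ip mu g g = V.
  rewrite /g /box_indic ip_prodf; [|by move=> i; apply: rL2_patch; exact: cst_continuous..].
  by apply: eq_bigr => i _; rewrite ip_interval_indic.
have J2 : 0 < J ^+ 2 by rewrite exprn_even_gt0.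
(* Makes [beta * (K / p)], the square of the error in the pairing with [b], at
   most [(J / 4) ^+ 2]. *)
pose p := (Num.truncn (16 * (beta * K) / J ^+ 2)).+1.
have p_gt0 : (0 < p)%N by [].
have pJ : 16 * (beta * K) / p%:R <= J ^+ 2.
  have : 16 * (beta * K) / J ^+ 2 < p%:R by exact: truncnS_gt.
  rewrite ltr_pdivrMr// => h; rewrite ler_pdivrMr ?ltr0n//.
  by rewrite (mulrC (J ^+ 2)); exact: ltW.
pose M := \sum_i (`|c i| + `|d i|).
have cM i : `|c i| + `|d i| <= M.
  by rewrite /M (bigD1 i)//= lerDl; apply: sumr_ge0 => j _; rewrite addr_ge0.
have near_J : \forall N \near \oo,
    `|J - ip mu (fun x => b x * cutoff (p * N)%:R x) g| < `|J| / 4.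
  have := cvg_cutoff p_gt0 b2 g2; move=> /cvgrPdist_lt; apply.
  by rewrite divr_gt0// normr_gt0.
have [N1 _ hN1] := near_J.
exists p, (J ^+ 2 / (4 * (V + 1))), (maxn N1 (Num.truncn M).+1); split => //.
  by rewrite divr_gt0// mulr_gt0// ltr_wpDl.
move=> N L; rewrite geq_max => /andP[N1N MN] N0 LE.
have L0 : 0 < L by rewrite LE ltr0n muln_gt0 N0.
have Ln0 : 0 < L ^+ n by exact: exprn_gt0.
have ML : M <= L.
  apply/ltW/(lt_le_trans (truncnS_gt M)); rewrite LE ler_nat.
  by apply: leq_trans MN _; rewrite leq_pmull.
have cL i : - L <= c i.
  rewrite lerNl; apply: le_trans ML; apply: le_trans (cM i).
  by rewrite -[leLHS]addr0 lerD// -normrN ler_norm.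
have dL i : d i <= L.
  apply: le_trans ML; apply: le_trans (cM i).
  by rewrite -[leLHS]add0r lerD// ler_norm.
set D := (p * p * N - N)%N.
pose e := mode L (@wave D N) (None : option 'I_n).
have e2 k : rL2 mu (e k) by exact: rL2_mode.
have eN k k' : ip mu (e k) (e k') = if k == k' then L ^+ n else 0.
  by apply: mode_orthogonal => // ? ?; exact: wave_inj.
pose ck k := ip mu g (e k).
pose f x := b x * cutoff L x.
have f2 : rL2 mu f by exact: rL2_cutoff.
pose q k := ip mu f (e k).
pose h := expansion e (L ^+ n) ck.
have h2 : rL2 mu h by exact: rL2_expansion.
pose ci i (m : 'I_D) := ip leb (interval_indic (c i) (d i)) (sinw L (wave N m) \_ `[- L, L]).
pose s i := L^-1 * \sum_m ci i m ^+ 2.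
have hS : (\sum_k ck k * ck k) / L ^+ n = \prod_i s i.
  rewrite /s big_split/= prodr_const card_ord exprVn mulrC; congr (_ * _).
  rewrite (bigA_distr_bigA (fun i m => ci i m ^+ 2)); apply: eq_bigr => k _.
  rewrite -expr2 prodrXl; congr (_ ^+ 2); rewrite /ck /g /e /box_indic /mode ip_prodf//.
    by move=> i; apply: rL2_patch; exact: cst_continuous.
  by move=> i; exact: rL2_mode1.
have hh : ip mu h h = \prod_i s i by rewrite -hS; exact: ip_expansion.
have hg : ip mu h g = \prod_i s i.
  rewrite ip_expansionl// -hS mulr_suml; apply: eq_bigr => k _.
  by rewrite /ck; ring.
have s0 i : 0 <= s i.
  by rewrite mulr_ge0 ?invr_ge0 ?(ltW L0)//; apply: sumr_ge0 => m _; exact: sqr_ge0.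
have sl i : 0 <= s i <= l i by rewrite s0 /=; exact: interval_mass_le.
have gap : V - \prod_i s i <= K / p%:R.
  apply: le_trans (prod_gap_le (index_enum _) (e := fun i => (4 + l i ^+ 2) / p%:R) sl _) _.
    move=> i; have : l i - (4 + l i ^+ 2) / p%:R <= s i by exact: interval_mass.
    by lra.
  by rewrite -mulr_suml /K mulrAC.
have dist : ip mu (fun x => g x - h x) (fun x => g x - h x) <= K / p%:R.
  by rewrite ipBB// (ipC mu g h) hg hh gg; move: gap; lra.
have gh2 := rL2B g2 h2.
have err : `|ip mu f g - ip mu f h| <= `|J| / 4.
  rewrite -(@ler_pXn2r _ 2)// ?nnegrE ?divr_ge0//.
  rewrite real_normK ?num_real// exprMn real_normK ?num_real//.
  have -> : ip mu f g - ip mu f h = ip mu f (fun x => g x - h x).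
    by rewrite [RHS]ipC ipBl// !(ipC _ _ f).
  apply: le_trans (ip_sqr_le f2 gh2) _.
  apply: le_trans (_ : beta * (K / p%:R) <= _).
    by apply: ler_pM => //; [exact: ip_ge0|exact: ip_ge0|exact: ip_cutoff_le].
  by move: pJ; rewrite mulrA -mulrA; lra.
have near := hN1 N N1N; rewrite /= -LE -/f in near.
have big : `|J| / 2 <= `|ip mu f h|.
  have := ler_normD (J - ip mu f g) (ip mu f g - ip mu f h + ip mu f h).
  have := ler_normD (ip mu f g - ip mu f h) (ip mu f h).
  by rewrite !subrK; move: near err; lra.
have fh : ip mu f h = (\sum_k ck k * q k) / L ^+ n.
  rewrite ipC ip_expansionl// mulr_suml; apply: eq_bigr => k _; rewrite /q; ring.
have h3 := rL2_expansion (L ^+ n) e2 q.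
have cs := ip_sqr_le h2 h3.
rewrite /h !ip_expansion// -fh hS in cs.
have sV : \prod_i s i <= V by apply: ler_prod => i _.
have Q0 : 0 <= (\sum_k q k * q k) / L ^+ n.
  by apply: divr_ge0; [apply: sumr_ge0 => k _; rewrite -expr2 sqr_ge0|exact: ltW].
have hJ : J ^+ 2 / 4 <= ip mu f h ^+ 2.
  have : (`|J| / 2) ^+ 2 <= `|ip mu f h| ^+ 2.
    by rewrite lerXn2r ?nnegrE ?divr_ge0.
  rewrite exprMn !real_normK ?num_real//; lra.
have {}cs : J ^+ 2 / 4 <= (V + 1) * ((\sum_k q k * q k) / L ^+ n).
  apply: le_trans hJ _; apply: le_trans cs _; apply: ler_wpM2r => //.
  by apply: le_trans sV _; rewrite lerDl.
have V1 : 0 < V + 1 by rewrite ltr_wpDl.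
rewrite (eq_bigr (fun k => q k * q k)); last by move=> k _; rewrite expr2.
rewrite -ler_pdivlMr// invfM mulrA ler_pdivrMr//.
by rewrite (mulrC (V + 1)) in cs; exact: cs.
Qed.

End spectral_mass.

(** * Localised modes *)

Section localised_modes.
Context {R : realType} {n D : nat}.
Variables (bump : R -> R) (L : R) (w : 'I_D -> nat).
Hypothesis smooth_bump : smooth bump.
Hypothesis bump_supp : forall x, 1 < `|x| -> bump x = 0.
Hypothesis L_gt0 : 0 < L.
Local Notation bump1 := (bump^`()%classic).
Local Notation bump2 := (bump^`()%classic^`()%classic).
Implicit Types (g : R -> R) (t : R) (i j : 'I_n) (o : option 'I_n) (k : {ffun 'I_n -> 'I_D}).

Definition slot g j : 'I_n -> R -> R := fun i => if i == j then g else bump.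

Definition profile (h : 'I_n -> R -> R) : 'rV[R]_n -> R :=
  prodf (fun i t => h i (L^-1 * t)).

Definition freq k j : R := (w (k j))%:R * (pi / (2 * L)).

Definition trig o k i : R -> R :=
  if Some i == o then cosw L (w (k i)) else sinw L (w (k i)).

Definition local1 o k i (t : R) : R := bump (L^-1 * t) * trig o k i t.

(** The product of the rescaled bump and a mode is smooth, although the mode
    itself is cut sharply at the boundary of the cube. *)
Definition local_mode o k : 'rV[R]_n -> R := prodf (local1 o k).

Lemma slot_bump j : slot bump j = fun=> bump.
Proof. by apply/funext => i; rewrite /slot if_same. Qed.

Lemma smooth_rescaled g : smooth g -> smooth (fun t => g (L^-1 * t)).
Proof. by move=> /(@smooth_affine _ _ L^-1 0); under eq_fun do rewrite addr0. Qed.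

Lemma smooth_trig o k i : smooth (trig o k i).
Proof. by rewrite /trig; case: ifP => _; [exact: smooth_cosw|exact: smooth_sinw]. Qed.

Lemma smooth_local1 o k i : smooth (local1 o k i).
Proof. by apply: smoothM; [exact: smooth_rescaled|exact: smooth_trig]. Qed.

Lemma rescaled_supp g t : (forall x, 1 < `|x| -> g x = 0) -> L < `|t| -> g (L^-1 * t) = 0.
Proof.
move=> gs Lt; apply: gs; rewrite normrM gtr0_norm ?invr_gt0//.
by rewrite mulrC ltr_pdivlMr// mul1r.
Qed.

Lemma test_function_local_mode o k : test_function (local_mode o k).
Proof.
apply: (@test_function_prodf _ _ _ L); first by move=> i; exact: smooth_local1.
by move=> i t Lt; rewrite /local1 rescaled_supp ?mul0r.
Qed.

(** The profile vanishes where the mode is cut off, so the cut is invisible. *)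
Lemma profile_mode g j o k x : (forall y, 1 < `|y| -> g y = 0) ->
  profile (slot g j) x * mode L w o k x =
  g (L^-1 * x ord0 j) * trig o k j (x ord0 j) *
  \prod_(i < n | i != j) local1 o k i (x ord0 i).
Proof.
move=> gs.
have patch f i t : (forall y, 1 < `|y| -> f y = 0) ->
    f (L^-1 * t) * mode1 L o i (w (k i)) t = f (L^-1 * t) * trig o k i t.
  move=> fs; rewrite /mode1 patchE -/(trig o k i); case: ifPn => // tL.
  rewrite rescaled_supp ?mul0r// ltNge; apply: contra tL => tL.
  by rewrite inE /= in_itv/= -ler_norml.
rewrite /profile /mode /prodf -big_split/= (bigD1 j)//= /slot eqxx patch//; congr (_ * _).
by apply: eq_bigr => i /negPf ->; rewrite patch.
Qed.

Lemma cutoff_mode o k x : cutoff bump L x * mode L w o k x = local_mode o k x.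
Proof.
rewrite /cutoff /mode /local_mode /prodf -big_split/=; apply: eq_bigr => i _.
rewrite /mode1 patchE -/(trig o k i) /local1; case: ifPn => // tL.
rewrite rescaled_supp ?mul0r// ltNge; apply: contra tL => tL.
by rewrite inE /= in_itv/= -ler_norml.
Qed.

Lemma rescaled_derive g t : smooth g ->
  is_derive t 1 (fun t => g (L^-1 * t)) (L^-1 * g^`()%classic (L^-1 * t)).
Proof.
move=> sg; apply: (is_derive_eq (@isd_comp _ g (fun y => L^-1 * y) t _ _
  (smooth_is_derive _ sg) (isdZ L^-1 (isd_id t)))).
by rewrite mulr1 mulrC.
Qed.

Lemma rescaled_sinw_derive g m t : smooth g ->
  is_derive t 1 (fun t => g (L^-1 * t) * sinw L m t)
    (L^-1 * (g^`()%classic (L^-1 * t) * sinw L m t) +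
     m%:R * (pi / (2 * L)) * (g (L^-1 * t) * cosw L m t)).
Proof.
move=> sg; apply: (is_derive_eq (isdM (rescaled_derive t sg) (sinw_derive L m t))).
ring.
Qed.

Lemma rescaled_cosw_derive g m t : smooth g ->
  is_derive t 1 (fun t => g (L^-1 * t) * cosw L m t)
    (L^-1 * (g^`()%classic (L^-1 * t) * cosw L m t) -
     m%:R * (pi / (2 * L)) * (g (L^-1 * t) * sinw L m t)).
Proof.
move=> sg; apply: (is_derive_eq (isdM (rescaled_derive t sg) (cosw_derive L m t))).
ring.
Qed.

Lemma bump1_supp y : 1 < `|y| -> bump1 y = 0.
Proof. exact: derive1_support. Qed.

Lemma bump2_supp y : 1 < `|y| -> bump2 y = 0.
Proof. by apply: derive1_support; [exact: smooth_derive1|exact: bump1_supp]. Qed.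

Lemma partial_local_mode j k x : partial j (local_mode (Some j) k) x =
  L^-1 * (profile (slot bump1 j) x * mode L w (Some j) k x) -
  freq k j * (cutoff bump L x * mode L w None k x).
Proof.
rewrite partial_prodf; last by move=> i; exact: smooth_local1.
rewrite (prodfE _ j) /derive_at eqxx.
have -> : cutoff bump L x = profile (slot bump j) x by rewrite slot_bump.
rewrite !profile_mode//; last exact: bump1_supp.
rewrite (_ : local1 (Some j) k j = fun t => bump (L^-1 * t) * cosw L (w (k j)) t); last first.
  by apply/funext => t; rewrite /local1 /trig eqxx.
rewrite (derive1_eq (fun t => rescaled_cosw_derive _ t smooth_bump)).
rewrite /trig eqxx /=.
set P := \prod_(i < n | i != j) local1 None k i (x ord0 i).
have offj i : i != j -> local1 (Some j) k i = local1 None k i.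
  by move=> /negPf ij; rewrite /local1 /trig /= (_ : Some i == Some j = false).
set Q := \prod_(i < n | i != j) _.
have -> : Q = P.
  by apply: eq_bigr => i ij; rewrite (negPf ij) offj.
have -> : \prod_(i < n | i != j) local1 (Some j) k i (x ord0 i) = P.
  by apply: eq_bigr => i ij; rewrite offj.
by rewrite /freq; ring.
Qed.

Lemma laplacian_local_mode k x : laplacian (local_mode None k) x =
  \sum_j (L^-1 ^+ 2 * (profile (slot bump2 j) x * mode L w None k x) +
          2 * L^-1 * freq k j * (profile (slot bump1 j) x * mode L w (Some j) k x)) -
  (\sum_j freq k j ^+ 2) * (cutoff bump L x * mode L w None k x).
Proof.
rewrite mulr_suml -sumrB /laplacian; apply: eq_bigr => j _.
rewrite partial_prodf; last by move=> i; exact: smooth_local1.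
rewrite partial_prodf; last by apply: smooth_derive_at => i; exact: smooth_local1.
rewrite (prodfE _ j) /derive_at !eqxx.
have -> : cutoff bump L x = profile (slot bump j) x by rewrite slot_bump.
rewrite !profile_mode//; [|exact: bump1_supp|exact: bump2_supp].
rewrite (_ : local1 None k j = fun t => bump (L^-1 * t) * sinw L (w (k j)) t)//.
rewrite (derive1_eq (fun t => rescaled_sinw_derive _ t smooth_bump)).
have sb1 := smooth_derive1 smooth_bump.
have d2 t := isdD (isdZ L^-1 (rescaled_sinw_derive (w (k j)) t sb1))
  (isdZ ((w (k j))%:R * (pi / (2 * L))) (rescaled_cosw_derive (w (k j)) t smooth_bump)).
rewrite (derive1_eq d2) {d2}.
set P := \prod_(i < n | i != j) local1 None k i (x ord0 i).
set Q := \prod_(i < n | i != j) _.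
have -> : Q = P.
  by apply: eq_bigr => i /negPf ij; rewrite ij.
have -> : \prod_(i < n | i != j) local1 (Some j) k i (x ord0 i) = P.
  apply: eq_bigr => i /negPf ij; rewrite /local1 /trig /=.
  by rewrite (_ : Some i == Some j = false).
by rewrite /trig eqxx /= /freq; ring.
Qed.

End localised_modes.

(** * The oscillators of a wave *)

Section wave_field.
Context {R : realType} {n : nat}.
Local Notation mu := (lebesgue_rV R n).
Implicit Types (a : R -> R) (t s : R).

(** What the argument uses of one real component of a solution and of its
    velocity: everything is tested against functions of the space variable. *)
Definition wave_field a (u v : R -> 'rV[R]_n -> R) : Prop :=
  [/\ forall t, 0 <= t -> rL2 mu (u t) /\ rL2 mu (v t),
      {within `[0, +oo[, continuous (fun t => ip mu (u t) (u t))},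
      forall phi, rL2 mu phi -> forall t, 0 <= t ->
        hl_quot (fun s => ip mu (u s) phi) t @ hl_incr t --> ip mu (v t) phi &
      forall phi, test_function phi -> forall t, 0 <= t ->
        hl_quot (fun s => ip mu (v s) phi) t @ hl_incr t -->
          a t ^+ 2 * ip mu (u t) (laplacian phi)].

Definition weak_slope (j : 'I_n) (u g : 'rV[R]_n -> R) : Prop :=
  forall phi, test_function phi -> ip mu u (partial j phi) = - ip mu g phi.

Lemma sqr_sum_le N (x : 'I_N -> R) : (\sum_i x i) ^+ 2 <= 2 ^+ N * \sum_i x i ^+ 2.
Proof.
elim: N x => [|N IH] x; first by rewrite !big_ord0 expr0n mulr0.
rewrite !big_ord_recl [2 ^+ N.+1]exprS.
have := IH (fun i => x (lift ord0 i)).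
set S := \sum_(i < N) _; set T := \sum_(i < N) _ => h.
have p1 : 1 <= 2 ^+ N :> R by apply: exprn_ege1; rewrite ler1n.
have h0 : x ord0 ^+ 2 <= 2 ^+ N * x ord0 ^+ 2 by rewrite ler_peMl ?sqr_ge0.
have : (x ord0 + S) ^+ 2 <= 2 * x ord0 ^+ 2 + 2 * S ^+ 2.
  by rewrite -subr_ge0 (_ : _ - _ = (x ord0 - S) ^+ 2) ?sqr_ge0//; ring.
move: p1 h h0; move: (2 ^+ N) => P p1 h h0; rewrite mulrDr; lra.
Qed.

Lemma sqrD_le (x y : R) : (x + y) ^+ 2 <= 2 * (x ^+ 2 + y ^+ 2).
Proof. by rewrite -subr_ge0 (_ : _ - _ = (x - y) ^+ 2) ?sqr_ge0//; ring. Qed.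

Section localised.
Variables (D : nat) (a bump : R -> R) (B L d K : R) (w : 'I_D -> nat).
Hypothesis smooth_bump : smooth bump.
Hypothesis bump_supp : forall x, 1 < `|x| -> bump x = 0.
Hypothesis bump_le : forall x, [/\ `|bump x| <= B, `|bump^`()%classic x| <= B &
  `|bump^`()%classic^`()%classic x| <= B].
Hypothesis L_ge1 : 1 <= L.
Hypothesis w_gt0 : forall m, (0 < w m)%N.
Hypothesis w_inj : injective w.
Hypothesis d_gt0 : 0 < d.
Hypothesis freq_bounds : forall (k : {ffun 'I_n -> 'I_D}) j, d <= freq L w k j <= K.
Local Notation bump1 := (bump^`()%classic).
Local Notation bump2 := (bump^`()%classic^`()%classic).
Local Notation J := {ffun 'I_n -> 'I_D}.

Let L_gt0 : 0 < L. Proof. exact: lt_le_trans ltr01 L_ge1. Qed.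
Let Ln_gt0 : 0 < L ^+ n. Proof. exact: exprn_gt0. Qed.

Implicit Types (h : R -> R) (j : 'I_n) (o : option 'I_n) (f u g : 'rV[R]_n -> R) (k : J).

Lemma measurable_profile h j : smooth h -> measurable_fun setT (profile L (slot bump h j)).
Proof.
move=> sh; apply: measurable_prodf => i; apply: continuous_measurable_fun.
by apply: smooth_continuous; apply: smooth_rescaled; rewrite /slot; case: ifP.
Qed.

Lemma profile_le h j x : (forall y, `|h y| <= B) ->
  `|profile L (slot bump h j) x| <= B ^+ n.
Proof.
move=> hB; apply: prodf_norm_le => i t; rewrite /slot; case: ifP => _; first exact: hB.
by case: (bump_le (L^-1 * t)).
Qed.

Lemma rL2_profile f h j : smooth h -> (forall y, `|h y| <= B) -> rL2 mu f ->
  rL2 mu (fun x => f x * profile L (slot bump h j) x).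
Proof.
move=> sh hB; apply: rL2M; first exact: measurable_profile.
by move=> x; exact: profile_le.
Qed.

Lemma profile_bessel o f h j : smooth h -> (forall y, `|h y| <= B) -> rL2 mu f ->
  \sum_(k : J) ip mu (fun x => f x * profile L (slot bump h j) x) (mode L w o k) ^+ 2 <=
  L ^+ n * (B ^+ n ^+ 2 * ip mu f f).
Proof.
move=> sh hB f2; apply: le_trans (mode_bessel L_gt0 w_gt0 w_inj _ (rL2_profile _ sh hB f2)) _.
rewrite ler_pM2l//; apply: ip_mul_le => //; first exact: measurable_profile.
by move=> x; exact: profile_le.
Qed.

Let smooth_bump1 : smooth bump1. Proof. exact: smooth_derive1. Qed.
Let smooth_bump2 : smooth bump2. Proof. exact: smooth_derive1. Qed.
Let bump_leB x : `|bump x| <= B. Proof. by case: (bump_le x). Qed.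
Let bump1_leB x : `|bump1 x| <= B. Proof. by case: (bump_le x). Qed.
Let bump2_leB x : `|bump2 x| <= B. Proof. by case: (bump_le x). Qed.

Lemma cutoff_profile j : cutoff bump L = profile L (slot bump bump j) :> ('rV[R]_n -> R).
Proof. by rewrite slot_bump. Qed.

Lemma rL2_local_mode o k : rL2 mu (local_mode bump L w o k).
Proof.
rewrite (_ : local_mode _ _ _ _ _ = fun x => mode L w o k x * cutoff bump L x); last first.
  by apply/funext => x; rewrite mulrC cutoff_mode.
apply: (rL2_cutoff smooth_bump bump_leB); exact: rL2_mode.
Qed.

Definition coefficient o (f : 'rV[R]_n -> R) (k : J) : R :=
  ip mu f (local_mode bump L w o k).

Lemma coefficientE o f k :
  coefficient o f k = ip mu (fun x => f x * cutoff bump L x) (mode L w o k).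
Proof.
by apply: eq_Rintegral => x _; rewrite -mulrA cutoff_mode.
Qed.

(** Since [u] is not compactly supported the localised coefficients are driven
    by the commutator of the Laplacian with the cutoff. *)
Definition commutator (f : 'rV[R]_n -> R) (k : J) : R :=
  \sum_j (L^-1 ^+ 2 * ip mu (fun x => f x * profile L (slot bump bump2 j) x) (mode L w None k) +
    2 * L^-1 * freq L w k j *
      ip mu (fun x => f x * profile L (slot bump bump1 j) x) (mode L w (Some j) k)).

Definition frequency (k : J) : R := Num.sqrt (\sum_j freq L w k j ^+ 2).

Lemma ip_laplacian_local_mode f k : rL2 mu f ->
  ip mu f (laplacian (local_mode bump L w None k)) =
  - frequency k ^+ 2 * coefficient None f k + commutator f k.
Proof.
move=> f2.
have m2 o : rL2 mu (mode L w o k) := rL2_mode L w o k.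
have A2 j := rL2_profile j smooth_bump2 bump2_leB (m2 None).
have B2 j := rL2_profile j smooth_bump1 bump1_leB (m2 (Some j)).
have C2 : rL2 mu (fun x => mode L w None k x * cutoff bump L x).
  by apply: (rL2_cutoff smooth_bump bump_leB); exact: rL2_mode.
rewrite (_ : laplacian _ = fun x =>
    (\sum_j (L^-1 ^+ 2 * (mode L w None k x * profile L (slot bump bump2 j) x) +
      2 * L^-1 * freq L w k j * (mode L w (Some j) k x * profile L (slot bump bump1 j) x))) -
    (\sum_j freq L w k j ^+ 2) * (mode L w None k x * cutoff bump L x)); last first.
  apply/funext => x; rewrite laplacian_local_mode//.
  rewrite [cutoff _ _ _ * _]mulrC; congr (_ - _); apply: eq_bigr => j _.
  by rewrite [mode L w None k x * _]mulrC [mode L w (Some j) k x * _]mulrC.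
have T2 j := rL2D (rL2Z (L^-1 ^+ 2) (A2 j)) (rL2Z (2 * L^-1 * freq L w k j) (B2 j)).
rewrite ipC ipBl//; [|by apply: rL2_sum|exact: rL2Z].
rewrite ipZl// addrC; congr (_ + _).
  rewrite -mulNr; congr (_ * _).
    rewrite /frequency sqr_sqrtr//; apply: sumr_ge0 => j _; exact: sqr_ge0.
  by rewrite coefficientE; apply: eq_Rintegral => x _; ring.
rewrite ip_suml//; apply: eq_bigr => j _.
rewrite ipDl//; [|exact: rL2Z..]; rewrite !ipZl//.
by congr (_ * _ + _ * _); apply: eq_Rintegral => x _; ring.
Qed.

Lemma wave_oscillators (u v : R -> 'rV[R]_n -> R) T : 0 <= T -> wave_field a u v ->
  oscillators a frequency (fun k t => a t ^+ 2 * commutator (u t) k)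
    (fun k t => coefficient None (u t) k) (fun k t => coefficient None (v t) k) T.
Proof.
move=> T0 [L2 _ du dv].
have sub : `[0, T] `<=` `[0, +oo[%classic.
  by move=> x /=; rewrite !in_itv/= andbT => /andP[].
split.
- move=> k; apply: (continuous_subspaceW sub); apply: hl_cvg_continuous => t t0.
  by apply/cvg_ex; eexists; apply: du => //; exact: rL2_local_mode.
- move=> k; apply: (continuous_subspaceW sub); apply: hl_cvg_continuous => t t0.
  by apply/cvg_ex; eexists; apply: dv => //; exact: test_function_local_mode.
- move=> k t /andP[t0 _]; split.
    apply: hl_cvg_is_derive => //; apply: du; [exact: rL2_local_mode|exact: ltW].
  apply: hl_cvg_is_derive => //.
  have := dv _ (test_function_local_mode w smooth_bump bump_supp L_gt0 None k) t (ltW t0).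
  rewrite ip_laplacian_local_mode; last by case: (L2 t (ltW t0)).
  suff -> : - (a t * frequency k) ^+ 2 * coefficient None (u t) k +
    a t ^+ 2 * commutator (u t) k = a t ^+ 2 *
    (- frequency k ^+ 2 * coefficient None (u t) k + commutator (u t) k) by [].
  ring.
Qed.

Lemma frequency_bounds (j0 : 'I_n) k : d <= frequency k <= Num.sqrt (n%:R * K ^+ 2).
Proof.
have f0 j : 0 <= freq L w k j by case/andP: (freq_bounds k j) => h _; rewrite (le_trans (ltW d_gt0)).
apply/andP; split.
  rewrite -[leLHS]gtr0_norm// -sqrtr_sqr ler_wsqrtr// (bigD1 j0)//=.
  apply: ler_wpDr; first by apply: sumr_ge0 => j _; exact: sqr_ge0.
  by case/andP: (freq_bounds k j0) => h _; rewrite lerXn2r ?nnegrE ?f0// ltW.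
apply: ler_wsqrtr; apply: (@le_trans _ _ (\sum_(j < n) K ^+ 2)); last first.
  by rewrite sumr_const card_ord mulr_natl.
apply: ler_sum => j _; case/andP: (freq_bounds k j) => _ h.
by rewrite lerXn2r ?nnegrE ?f0// (le_trans (f0 j)).
Qed.

(** Every term contains a derivative of the cutoff, hence a factor [1 / L]: the
    forcing is small compared with the volume [L ^+ n] of the cube. *)
Lemma commutator_le f : rL2 mu f ->
  \sum_k commutator f k ^+ 2 <=
  2 ^+ n * (n%:R * (2 * (1 + 4 * K ^+ 2) * (L^-1 ^+ 2 * (L ^+ n * (B ^+ n ^+ 2 * ip mu f f))))).
Proof.
move=> f2; set Z := L ^+ n * _.
have Z0 : 0 <= Z by apply: mulr_ge0; [exact: ltW|apply: mulr_ge0; [exact: sqr_ge0|exact: ip_ge0]].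
pose A k j := ip mu (fun x => f x * profile L (slot bump bump2 j) x) (mode L w None k).
pose E k j := ip mu (fun x => f x * profile L (slot bump bump1 j) x) (mode L w (Some j) k).
have Li0 : 0 <= L^-1 by rewrite invr_ge0 ltW.
have Li1 : L^-1 ^+ 2 <= 1 by rewrite exprn_ile1// invf_le1.
have term k j : (L^-1 ^+ 2 * A k j + 2 * L^-1 * freq L w k j * E k j) ^+ 2 <=
    2 * L^-1 ^+ 2 * (A k j ^+ 2 + 4 * K ^+ 2 * E k j ^+ 2).
  have hA : (L^-1 ^+ 2 * A k j) ^+ 2 <= L^-1 ^+ 2 * A k j ^+ 2.
    rewrite exprMn ler_wpM2r ?sqr_ge0// expr2.
    by rewrite ler_piMl ?sqr_ge0.
  have fK : freq L w k j ^+ 2 <= K ^+ 2.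
    case/andP: (freq_bounds k j) => h1 h2.
    have f0 := le_trans (ltW d_gt0) h1.
    by rewrite lerXn2r ?nnegrE// (le_trans f0).
  have hE : L^-1 ^+ 2 * E k j ^+ 2 * freq L w k j ^+ 2 <= L^-1 ^+ 2 * E k j ^+ 2 * K ^+ 2.
    by rewrite ler_wpM2l// mulr_ge0 ?sqr_ge0.
  apply: le_trans (sqrD_le _ _) _.
  move: hA hE; move: (freq L w k j) (A k j) (E k j) => fr x y.
  by rewrite !exprMn; lra.
apply: (@le_trans _ _ (\sum_k 2 ^+ n * \sum_j 2 * L^-1 ^+ 2 *
    (A k j ^+ 2 + 4 * K ^+ 2 * E k j ^+ 2))).
  apply: ler_sum => k _; apply: le_trans (sqr_sum_le _) _.
  by rewrite ler_pM2l ?exprn_gt0//; apply: ler_sum => j _; exact: term.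
rewrite -mulr_sumr ler_pM2l ?exprn_gt0// exchange_big/=.
apply: (@le_trans _ _ (\sum_(j < n) 2 * (1 + 4 * K ^+ 2) * (L^-1 ^+ 2 * Z))); last first.
  by rewrite sumr_const card_ord [n%:R * _]mulr_natl.
apply: ler_sum => j _; rewrite -mulr_sumr big_split/= -mulr_sumr.
have hA := profile_bessel None j smooth_bump2 bump2_leB f2.
have hE := profile_bessel (Some j) j smooth_bump1 bump1_leB f2.
have K2 : 0 <= 4 * K ^+ 2 by rewrite mulr_ge0 ?sqr_ge0.
have {}hE := ler_wpM2l K2 hE.
have l2 : 0 <= 2 * L^-1 ^+ 2 by rewrite mulr_ge0 ?sqr_ge0.
apply: le_trans (ler_wpM2l l2 (lerD hA hE)) _.
by rewrite -/Z le_eqVlt; apply/orP; left; apply/eqP; ring.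
Qed.

(** Along [j] the sine coefficients of [u] are, up to a commutator, the cosine
    coefficients of its slope divided by the wave number. *)
Lemma coefficient_slope_le j u g : rL2 mu u -> rL2 mu g -> weak_slope j u g ->
  d ^+ 2 * \sum_k coefficient None u k ^+ 2 <=
  2 * (L ^+ n * (B ^+ n ^+ 2 * (L^-1 ^+ 2 * ip mu u u + ip mu g g))).
Proof.
move=> u2 g2 ug.
pose E k := ip mu (fun x => u x * profile L (slot bump bump1 j) x) (mode L w (Some j) k).
pose G k := ip mu (fun x => g x * profile L (slot bump bump j) x) (mode L w (Some j) k).
have key k : freq L w k j * coefficient None u k = L^-1 * E k + G k.
  have := ug _ (test_function_local_mode w smooth_bump bump_supp L_gt0 (Some j) k).
  have B2 := rL2_profile j smooth_bump1 bump1_leB (rL2_mode L w (Some j) k).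
  have C2 : rL2 mu (fun x => mode L w None k x * cutoff bump L x).
    by apply: (rL2_cutoff smooth_bump bump_leB); exact: rL2_mode.
  rewrite (_ : partial _ _ = fun x =>
      L^-1 * (mode L w (Some j) k x * profile L (slot bump bump1 j) x) -
      freq L w k j * (mode L w None k x * cutoff bump L x)); last first.
    apply/funext => x; rewrite partial_local_mode//.
    by rewrite [cutoff _ _ _ * _]mulrC [profile _ _ _ * _]mulrC.
  rewrite ipC ipBl//; [|exact: rL2Z..]; rewrite !ipZl//.
  have -> : ip mu (fun x => mode L w (Some j) k x * profile L (slot bump bump1 j) x) u = E k.
    by apply: eq_Rintegral => x _; ring.
  have -> : ip mu (fun x => mode L w None k x * cutoff bump L x) u = coefficient None u k.
    by rewrite coefficientE; apply: eq_Rintegral => x _; ring.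
  rewrite -/(coefficient (Some j) g k) (coefficientE (Some j)) (cutoff_profile j) -/(G k).
  by lra.
apply: (@le_trans _ _ (\sum_k 2 * (L^-1 ^+ 2 * E k ^+ 2 + G k ^+ 2))).
  rewrite mulr_sumr; apply: ler_sum => k _; rewrite -exprMn.
  apply: (@le_trans _ _ ((freq L w k j * coefficient None u k) ^+ 2)).
    case/andP: (freq_bounds k j); move: (freq L w k j) => fr h _.
    rewrite !exprMn ler_wpM2r ?sqr_ge0//.
    by rewrite lerXn2r ?nnegrE ?(le_trans (ltW d_gt0) h)// ltW.
  by rewrite key; apply: le_trans (sqrD_le _ _) _; rewrite exprMn.
rewrite -mulr_sumr ler_pM2l// big_split/= -mulr_sumr.
have hE := profile_bessel (Some j) j smooth_bump1 bump1_leB u2.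
have hG := profile_bessel (Some j) j smooth_bump bump_leB g2.
apply: le_trans (lerD (ler_wpM2l (sqr_ge0 _) hE) hG) _.
by rewrite le_eqVlt; apply/orP; left; apply/eqP; ring.
Qed.

Lemma coefficient_le f (j0 : 'I_n) : rL2 mu f ->
  \sum_k coefficient None f k ^+ 2 <= L ^+ n * (B ^+ n ^+ 2 * ip mu f f).
Proof.
move=> f2; have := profile_bessel None j0 smooth_bump bump_leB f2.
by under eq_bigr do rewrite -cutoff_profile -coefficientE.
Qed.

End localised.
End wave_field.

(** * Energy of one real component *)

Section wave_field_energy.
Context {R : realType} {n : nat}.
Local Notation mu := (lebesgue_rV R n).
Variables (a lam : R -> R) (j0 : 'I_n).
Hypothesis lam_gt0 : forall t : R, 0 <= t -> 0 < lam t.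
Hypothesis continuous_a : {within `[0, +oo[, continuous a}.
Hypothesis lower_bound : forall d M : R, 0 < d -> exists C : R, 0 < C /\ forall t : R, 0 <= t ->
  exists D : R, 0 <= D /\ transfers a lam d M 0 t C D.

Lemma le_of_vanishing_error (N0 : nat) (c X Y : R) :
  (forall N, (N0 <= N)%N -> (0 < N)%N -> c <= X + Y / N%:R) -> c <= X.
Proof.
move=> h; rewrite leNgt; apply/negP => Xc.
have cX : 0 < c - X by rewrite subr_gt0.
pose N := maxn N0 (Num.truncn (Y / (c - X))).+1.
have N_gt0 : (0 < N)%N by rewrite /N leq_max orbT.
have := h N (leq_maxl _ _) N_gt0.
have : Y / (c - X) < N%:R.
  by apply: (lt_le_trans (truncnS_gt _)); rewrite ler_nat leq_maxr.
rewrite ltr_pdivrMr// mulrC -ltr_pdivrMr ?ltr0n//; lra.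
Qed.

Lemma wave_freq_bounds (p N D : nat) (k : {ffun 'I_n -> 'I_D}) j : (0 < p)%N -> (0 < N)%N ->
  D = (p * p * N - N)%N ->
  pi / (2 * p%:R) <= freq ((p * N)%:R : R) (@wave D N) k j <= p%:R * pi / 2.
Proof.
move=> p0 N0 DE.
have p1 : 0 < p%:R :> R by rewrite ltr0n.
have N1 : 0 < N%:R :> R by rewrite ltr0n.
have pi0 := pi_gt0 R.
have kD : (wave N (k j) <= p * p * N)%N.
  have := ltn_ord (k j); rewrite /wave; move: (nat_of_ord (k j)) => m; lia.
have rho0 : 0 <= pi / (2 * (p * N)%:R) :> R.
  by rewrite divr_ge0 ?(ltW pi0)// mulr_ge0.
rewrite /freq; apply/andP; split.
  apply: (@le_trans _ _ (N%:R * (pi / (2 * (p * N)%:R)))).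
    by rewrite natrM le_eqVlt; apply/orP; left; apply/eqP; field; rewrite !gt_eqF.
  by rewrite ler_wpM2r// ler_nat /wave; lia.
apply: (@le_trans _ _ ((p * p * N)%:R * (pi / (2 * (p * N)%:R)))).
  by rewrite ler_wpM2r// ler_nat.
by rewrite !natrM le_eqVlt; apply/orP; left; apply/eqP; field; rewrite !gt_eqF.
Qed.

(** On the cube of half-side [L = p N] the mass of the data, the energy and the
    forcing are of respective orders [L ^+ n], [L ^+ n] and [L ^+ n / L ^+ 2].
    After division by [L ^+ n] the forcing and the commutators disappear as [N]
    tends to infinity, [t] and the solution being fixed. *)
Theorem wave_field_energy_lower_bound (b : 'rV[R]_n -> R) :
  rL2 mu b -> ~ {ae mu, forall x, b x = 0} ->
  exists C : R, 0 < C /\ forall u v g (t : R), 0 <= t -> wave_field a u v ->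
    {ae mu, forall x, u 0 x = b x} \/ {ae mu, forall x, v 0 x = b x} ->
    rL2 mu g -> weak_slope j0 (u t) g ->
    C * lam t <= lam t ^+ 2 * ip mu g g + ip mu (v t) (v t).
Proof.
move=> b2 bn0.
have [bump [B [sb bump0 bs _ bB]]] := @bump_exists R.
have bB0 x : `|bump x| <= B by case: (bB x).
have [p [c0 [N0 [p_gt0 c0_gt0 mass]]]] := spectral_mass sb bump0 bB0 b2 bn0.
have p1 : 0 < p%:R :> R by rewrite ltr0n.
pose d : R := pi / (2 * p%:R); pose K : R := p%:R * pi / 2.
have d_gt0 : 0 < d by rewrite divr_gt0 ?pi_gt0 ?mulr_gt0.
have [C1 [C1_gt0 trans]] := lower_bound (Num.sqrt (n%:R * K ^+ 2)) d_gt0.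
pose G := B ^+ n ^+ 2.
have G_gt0 : 0 < G.
  have : 0 < B by apply: lt_le_trans (bB0 0); rewrite bump0 normr1.
  by move=> B0; rewrite !exprn_gt0.
have e0 : 0 < 1 + 2 * d ^- 2.
  by rewrite ltr_pwDl// mulr_ge0// invr_ge0 sqr_ge0.
have CGe : 0 < C1 * G * (1 + 2 * d ^- 2).
  by apply: mulr_gt0 => //; exact: mulr_gt0.
exists (c0 / (C1 * G * (1 + 2 * d ^- 2))); split.
  exact: divr_gt0.
move=> u v g t t0 uv init g2 ug.
have [L2 cu _ _] := uv.
have [D [D0 tr]] := trans t t0.
have [A aA] := continuous_bounded t0 continuous_a.
have [U uU] := continuous_bounded t0 cu.
have l0 := lam_gt0 t0.
have [u2 v2] := L2 t t0.
pose E := ip mu (v t) (v t) + 2 * d ^- 2 * lam t ^+ 2 * ip mu g g.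
have U0 (s : R) : 0 <= s <= t -> ip mu (u s) (u s) <= U.
  by move=> st; have := uU s st; rewrite ger0_norm// ip_ge0.
pose Y := C1 / lam t * (lam t ^+ 2 * (d ^- 2 * (2 * (G * U)))) +
  D * (A ^+ 4 * (2 ^+ n * (n%:R * (2 * (1 + 4 * K ^+ 2) * (G * U))))).
have Uge0 : 0 <= U.
  by apply: le_trans (ip_ge0 mu (u t)) _; apply: U0; rewrite t0 lexx.
have Age0 : 0 <= A by apply: le_trans (normr_ge0 (a t)) (aA t _); rewrite t0 lexx.
have GU : 0 <= G * U by rewrite mulr_ge0// ltW.
have Y0 : 0 <= Y.
  rewrite /Y addr_ge0// mulr_ge0//.
  - by rewrite divr_ge0// ltW.
  - by rewrite mulr_ge0 ?sqr_ge0// mulr_ge0 ?invr_ge0 ?sqr_ge0// mulr_ge0.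
  - rewrite mulr_ge0 ?exprn_ge0// mulr_ge0 ?exprn_ge0// mulr_ge0// mulr_ge0//.
    by rewrite mulr_ge0// addr_ge0// mulr_ge0// sqr_ge0.
suff main : c0 <= C1 / lam t * G * E.
  have EE : E <= (1 + 2 * d ^- 2) * (lam t ^+ 2 * ip mu g g + ip mu (v t) (v t)).
    have h1 : 0 <= lam t ^+ 2 * ip mu g g by rewrite mulr_ge0 ?sqr_ge0 ?ip_ge0.
    have h2 : 0 <= d ^- 2 * ip mu (v t) (v t) by rewrite mulr_ge0 ?invr_ge0 ?sqr_ge0 ?ip_ge0.
    by rewrite /E; move: h1 h2; lra.
  rewrite mulrAC ler_pdivrMr//.
  have : c0 * lam t <= C1 * G * E.
    rewrite -ler_pdivlMr//; apply: le_trans main _.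
    by rewrite le_eqVlt; apply/orP; left; apply/eqP; ring.
  move=> h; apply: le_trans h _.
  have CG : 0 <= C1 * G by rewrite mulr_ge0 ?ltW.
  apply: le_trans (ler_wpM2l CG EE) _.
  by rewrite le_eqVlt; apply/orP; left; apply/eqP; ring.
apply: (@le_of_vanishing_error N0 _ _ Y) => N N0N N_gt0.
pose L : R := (p * N)%:R.
have N1 : 1 <= N%:R :> R by rewrite ler1n.
have L1 : 1 <= L by rewrite /L ler1n muln_gt0 p_gt0.
have L0 : 0 < L by exact: lt_le_trans L1.
have NL : N%:R <= L by rewrite /L ler_nat leq_pmull.
have Ln0 : 0 < L ^+ n by exact: exprn_gt0.
have LN : L^-1 ^+ 2 <= N%:R^-1.
  rewrite expr2; apply: (@le_trans _ _ (1 * L^-1)).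
    by rewrite ler_wpM2r ?invr_ge0 ?(ltW L0)// invf_le1.
  by rewrite mul1r lef_pV2// posrE (lt_le_trans ltr01).
pose M := (p * p * N - N)%N.
have freqs := fun (k : {ffun 'I_n -> 'I_M}) j => @wave_freq_bounds p N M k j p_gt0 N_gt0 (erefl _).
rewrite -/L -/d -/K in freqs.
have w0 m : (0 < @wave M N m)%N by [].
have wi := @wave_inj M N.
pose co (f : 'rV[R]_n -> R) k := coefficient bump L (@wave M N) None f k.
pose F := A ^+ 4 * (2 ^+ n * (n%:R * (2 * (1 + 4 * K ^+ 2) * (L^-1 ^+ 2 * (L ^+ n * (G * U)))))).
have osc := wave_oscillators (@wave M N) sb bs bB L1 t0 uv.
have force (s : R) : 0 <= s <= t -> \sum_k (a s ^+ 2 * commutator bump L (@wave M N) (u s) k) ^+ 2 <= F.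
  move=> st; have /andP[s0 _] := st.
  under eq_bigr do rewrite exprMn -exprM.
  rewrite -mulr_sumr.
  have [us2 _] := L2 s s0.
  have h := commutator_le sb bB L1 w0 wi d_gt0 freqs us2.
  apply: ler_pM => //.
  - by rewrite exprM exprn_ge0 ?sqr_ge0.
  - by apply: sumr_ge0 => k _; exact: sqr_ge0.
  - rewrite -(ger0_norm (_ : 0 <= a s ^+ 4)); last by rewrite (exprM _ 2 2) exprn_ge0 ?sqr_ge0.
    by rewrite normrX lerXn2r ?nnegrE ?aA.
  - apply: le_trans h _; rewrite ler_pM2l ?exprn_gt0// ler_wpM2l// ler_wpM2l//.
      by rewrite mulr_ge0// addr_ge0// mulr_ge0// sqr_ge0.
    by rewrite ler_wpM2l ?sqr_ge0// ler_pM2l// ler_pM2l// U0.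
have fb k := frequency_bounds d_gt0 freqs j0 k.
have := tr _ _ _ _ _ F fb osc force.
rewrite -/co => est.
have start : c0 * L ^+ n <= \sum_k (co (u 0) k ^+ 2 + co (v 0) k ^+ 2).
  apply: le_trans (mass N L N0N N_gt0 erefl) _; apply: ler_sum => k _.
  have [u02 v02] := L2 0 (lexx 0).
  have eqc f : rL2 mu f -> {ae mu, forall x, f x = b x} ->
      ip mu (fun x => b x * cutoff bump L x) (mode L (@wave M N) None k) = co f k.
    move=> f2 fb'; rewrite /co -(coefficientE (@wave M N) bs L1); apply/esym; apply: ip_ae => //.
    + by case: f2.
    + by case: b2.
    + by case: (rL2_local_mode (@wave M N) sb bs bB L1 None k).
  case: init => /eqc ->//; [rewrite lerDl|rewrite lerDr]; exact: sqr_ge0.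
have endq : \sum_k co (v t) k ^+ 2 <= L ^+ n * (G * ip mu (v t) (v t)).
  exact: (coefficient_le sb bs bB L1 w0 wi j0 v2).
have endp : d ^+ 2 * \sum_k co (u t) k ^+ 2 <=
    2 * (L ^+ n * (G * (L^-1 ^+ 2 * U + ip mu g g))).
  apply: le_trans (coefficient_slope_le sb bs bB L1 w0 wi d_gt0 freqs u2 g2 ug) _.
  rewrite ler_pM2l// ler_pM2l// ler_pM2l// lerD2r ler_wpM2l ?sqr_ge0// U0//.
  by rewrite t0 lexx.
have {}endp : \sum_k co (u t) k ^+ 2 <=
    d ^- 2 * (2 * (L ^+ n * (G * (L^-1 ^+ 2 * U + ip mu g g)))).
  by rewrite ler_pdivlMl// exprn_gt0.
have {start}est := le_trans start est.
rewrite -ler_pdivlMr// in est; apply: le_trans est _.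
apply: (@le_trans _ _ ((C1 / lam t * (L ^+ n * (G * ip mu (v t) (v t)) + lam t ^+ 2 *
   (d ^- 2 * (2 * (L ^+ n * (G * (L^-1 ^+ 2 * U + ip mu g g)))))) + D * F) / L ^+ n)).
  rewrite ler_pM2r ?invr_gt0// lerD2r ler_pM2l ?divr_gt0// big_split/= -mulr_sumr.
  by rewrite lerD// ler_pM2l ?exprn_gt0.
apply: (@le_trans _ _ (C1 / lam t * G * E + Y * L^-1 ^+ 2)); last first.
  by rewrite lerD2l ler_wpM2l.
rewrite le_eqVlt; apply/orP; left; apply/eqP; rewrite /F /Y /E.
move: (L ^+ n) Ln0 (d ^- 2) (L^-1) (2 ^+ n) => P P0 d2 Li Q.
by field; rewrite !gt_eqF.
Qed.

End wave_field_energy.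

(** * Real components of a solution *)

Section components.
Context {R : realType} {n : nat}.
Local Notation mu := (lebesgue_rV R n).
Local Notation normc := Normc.normc.
Implicit Types (c : bool) (z : R[i]) (f g : 'rV[R]_n -> R[i]) (phi : 'rV[R]_n -> R).

Definition component c z : R := if c then complex.Im z else complex.Re z.

Lemma componentB c z1 z2 : component c (z1 - z2) = component c z1 - component c z2.
Proof. by case: c z1 z2 => [] [? ?] [? ?]. Qed.

Lemma componentN c z : component c (- z) = - component c z.
Proof. by case: c z => [] [? ?]. Qed.

Lemma componentZ c (r : R) z : component c (r%:C%C * z) = r * component c z.
Proof. by case: c z => [] [x y]; rewrite /component /= !mul0r ?addr0 ?subr0. Qed.

Lemma componentZr c (r : R) z : component c (z * r%:C%C) = component c z * r.
Proof. by rewrite mulrC componentZ mulrC. Qed.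

Lemma normc_sqr z : normc z ^+ 2 = complex.Re z ^+ 2 + complex.Im z ^+ 2.
Proof. by case: z => x y; rewrite /normc sqr_sqrtr// addr_ge0 ?sqr_ge0. Qed.

Lemma component_sqr_le c z : component c z ^+ 2 <= normc z ^+ 2.
Proof. by rewrite normc_sqr; case: c; rewrite /component ?lerDr ?lerDl sqr_ge0. Qed.

Lemma component_le c z : `|component c z| <= normc z.
Proof.
have z0 : 0 <= normc z by case: z => x y; exact: sqrtr_ge0.
by rewrite -(@ler_pXn2r _ 2)// ?nnegrE// real_normK ?num_real// component_sqr_le.
Qed.

Lemma component_eq0 z : (forall c, component c z = 0) -> z = 0.
Proof.
by move=> z0; move: (z0 true) (z0 false); case: z {z0} => x y; rewrite /component /= => -> ->.
Qed.

Lemma measurable_component c f : measurable_fun setT (fun x => complex.Re (f x)) ->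
  measurable_fun setT (fun x => complex.Im (f x)) ->
  measurable_fun setT (fun x => component c (f x)).
Proof. by case: c. Qed.

Lemma measurable_normc_sqr f : measurable_fun setT (fun x => complex.Re (f x)) ->
  measurable_fun setT (fun x => complex.Im (f x)) ->
  measurable_fun setT (fun x => normc (f x) ^+ 2).
Proof.
move=> mr mi; under eq_fun do rewrite normc_sqr.
by apply: measurable_funD; apply: measurable_funX.
Qed.

Lemma integral_component_le c f : measurable_fun setT (fun x => complex.Re (f x)) ->
  measurable_fun setT (fun x => complex.Im (f x)) ->
  (\int[mu]_x (component c (f x) ^+ 2)%:E <= L2_norm2 f)%E.
Proof.
move=> mr mi; apply: ge0_le_integral => //.
- by move=> x _; rewrite lee_fin sqr_ge0.
- by apply/measurable_EFinP/measurable_funX; exact: measurable_component.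
- by apply/measurable_EFinP; exact: measurable_normc_sqr.
- by move=> x _; rewrite lee_fin component_sqr_le.
Qed.

Lemma rL2_component c f : isL2 f -> rL2 mu (fun x => component c (f x)).
Proof.
move=> [mr mi foo]; split; first exact: measurable_component.
apply/integrableP; split.
  by apply/measurable_EFinP/measurable_funX; exact: measurable_component.
apply: le_lt_trans foo; apply: le_trans (integral_component_le c mr mi).
rewrite le_eqVlt; apply/orP; left; apply/eqP; apply: eq_integral => x _.
by rewrite /= ger0_norm// sqr_ge0.
Qed.

Lemma ip_component_le c f : measurable_fun setT (fun x => complex.Re (f x)) ->
  measurable_fun setT (fun x => complex.Im (f x)) ->
  ((ip mu (fun x => component c (f x)) (fun x => component c (f x)))%:E <= L2_norm2 f)%E.
Proof.
move=> mr mi; apply: le_trans (integral_component_le c mr mi).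
rewrite /ip /Rintegral; under eq_integral do rewrite -expr2.
set I := (\int[mu]_x _)%E.
have : (0 <= I)%E by apply: integral_ge0 => x _; rewrite lee_fin sqr_ge0.
by case: I => [r| |]//= _; rewrite leey.
Qed.

Lemma component_pairing c f phi :
  component c (pairing f phi) = ip mu (fun x => component c (f x)) phi.
Proof.
case: c; rewrite /component /pairing /cintegral /=; apply: eq_Rintegral => x _.
  exact: (componentZr true).
exact: (componentZr false).
Qed.

Section limits.
Variables (G : set_system R).
Hypothesis FG : Filter G.

Lemma component_vanishes c (f : R -> 'rV[R]_n -> R[i]) :
  (\forall h \near G, measurable_fun setT (fun x => complex.Re (f h x)) /\
     measurable_fun setT (fun x => complex.Im (f h x))) ->
  (fun h => L2_norm2 (f h)) @ G --> 0%E ->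
  (fun h => ip mu (fun x => component c (f h x)) (fun x => component c (f h x))) @ G --> 0.
Proof.
move=> mf /fine_cvgP[fin f0].
apply: (@squeeze_cvgr _ _ _ _ (fun=> 0) (fun h => fine (L2_norm2 (f h)))) => //.
  near=> h; have finh : L2_norm2 (f h) \is a fin_num by near: h.
  have [mr mi] : measurable_fun setT (fun x => complex.Re (f h x)) /\
     measurable_fun setT (fun x => complex.Im (f h x)) by near: h.
  by have := ip_component_le c mr mi; rewrite -(fineK finh) lee_fin ip_ge0 => ->.
exact: cvg_cst.
Unshelve. all: by end_near. Qed.

Lemma ip_vanishes (f : R -> 'rV[R]_n -> R) phi : rL2 mu phi ->
  (\forall h \near G, rL2 mu (f h)) ->
  (fun h => ip mu (f h) (f h)) @ G --> 0 -> (fun h => ip mu (f h) phi) @ G --> 0.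
Proof.
move=> p2 f2 f0.
have s0 : (fun h => Num.sqrt (ip mu (f h) (f h) * ip mu phi phi)) @ G --> 0.
  rewrite -[X in _ --> X](@sqrtr0 R) -[X in _ --> Num.sqrt X](mul0r (ip mu phi phi)).
  apply: (@continuous_cvg _ _ _ G _ (fun h => ip mu (f h) (f h) * ip mu phi phi) Num.sqrt).
    exact: sqrt_continuous.
  by apply: cvgMl.
apply/norm_cvg0P.
apply: (@squeeze_cvgr _ _ _ _ (fun=> 0)
  (fun h => Num.sqrt (ip mu (f h) (f h) * ip mu phi phi))) => //; last exact: cvg_cst.
near=> h; rewrite normr_ge0/= -sqrtr_sqr ler_wsqrtr// ip_sqr_le//.
by near: h.
Unshelve. all: by end_near. Qed.

End limits.

End components.

Section solution.
Context {R : realType} {n : nat}.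
Local Notation mu := (lebesgue_rV R n).
Local Notation normc := Normc.normc.
Variables (a : R -> R) (u : R -> 'rV[R]_n -> R[i]).
Hypothesis u_class : energy_class u.
Implicit Types (t : R) (c : bool).

Lemma is_L2_derive_time_deriv t : 0 <= t -> is_L2_derive u t (time_deriv u t).
Proof. by move=> t0; have [_ _ h _] := u_class; have /xgetPex := h t t0; apply. Qed.

Lemma weak_slope_grad c t j : 0 <= t ->
  isL2 (grad (u t) j) /\ weak_slope j (fun x => component c (u t x))
    (fun x => component c (grad (u t) j x)).
Proof.
move=> t0; have [h _ _ _] := u_class; have [_ /(_ j)] := h t t0.
move=> /(xgetPex (fun=> 0))[g2 gw]; split => // phi tphi.
by rewrite -!component_pairing (gw _ tphi) componentN.
Qed.

(** The velocity is a strong derivative, so difference quotients converge after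
    pairing by the Cauchy-Schwarz inequality. *)
Lemma component_wave_field c : wave_equation a u ->
  wave_field a (fun t x => component c (u t x)) (fun t x => component c (time_deriv u t x)).
Proof.
move=> weq; have [uH1 [cu _] _ _] := u_class.
have u2 t : 0 <= t -> isL2 (u t) by move=> t0; have [] := uH1 t t0.
have v2 t : 0 <= t -> isL2 (time_deriv u t).
  by move=> t0; have [] := is_L2_derive_time_deriv t0.
pose w t x := component c (u t x); pose v t x := component c (time_deriv u t x).
have w2 t : 0 <= t -> rL2 mu (w t) by move=> t0; exact/rL2_component/u2.
have rv2 t : 0 <= t -> rL2 mu (v t) by move=> t0; exact/rL2_component/v2.
split => [t t0||phi p2 t t0|phi tphi t t0].
- by split; [exact: w2|exact: rv2].
- apply: hl_continuous_within => t t0.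
  pose f h x := u (t + h) x - u t x.
  have fE h : (fun x => component c (f h x)) = fun x => w (t + h) x - w t x.
    by apply/funext => x; rewrite /f componentB.
  have f0 : (fun h => ip mu (fun x => component c (f h x)) (fun x => component c (f h x)))
      @ hl_incr t --> 0.
    apply: component_vanishes (cu t t0).
    apply: filterS (hl_incr_ge0 t) => h th.
    have [mr mi _] := u2 _ th; have [mr' mi' _] := u2 _ t0.
    split.
      rewrite (_ : (fun x => _) = fun x => complex.Re (u (t + h) x) - complex.Re (u t x)).
        exact: measurable_funB.
      by apply/funext => x; exact: (componentB false).
    rewrite (_ : (fun x => _) = fun x => complex.Im (u (t + h) x) - complex.Im (u t x)).
      exact: measurable_funB.
    by apply/funext => x; exact: (componentB true).
  have f1 : (fun h => ip mu (fun x => component c (f h x)) (w t)) @ hl_incr t --> 0.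
    apply: (ip_vanishes _ (w2 t t0) _ f0).
    by apply: filterS (hl_incr_ge0 t) => h th; rewrite fE; exact: rL2B (w2 _ th) (w2 _ t0).
  have lim : (fun h => ip mu (fun x => component c (f h x)) (fun x => component c (f h x)) +
      2 * ip mu (fun x => component c (f h x)) (w t) + ip mu (w t) (w t)) @ hl_incr t -->
      (0 + 2 * 0 + ip mu (w t) (w t) : R).
    by apply: cvgD; [apply: cvgD => //; exact: cvgMr|exact: cvg_cst].
  rewrite mulr0 !add0r in lim; apply: cvg_trans lim; apply: near_eq_cvg.
  apply: filterS (hl_incr_ge0 t) => h th; rewrite /= fE.
  have wt := w2 _ t0; have wth := w2 _ th.
  by rewrite -/(w _) -/(w _) ipBB// ipBl//; ring.
- pose f h x := (h^-1)%:C%C * (u (t + h) x - u t x) - time_deriv u t x.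
  have fE h : (fun x => component c (f h x)) = fun x => h^-1 * (w (t + h) x - w t x) - v t x.
    by apply/funext => x; rewrite /f componentB componentZ componentB.
  have f0 : (fun h => ip mu (fun x => component c (f h x)) (fun x => component c (f h x)))
      @ hl_incr t --> 0.
    have [_ dl] := is_L2_derive_time_deriv t0; apply: component_vanishes dl.
    apply: filterS (hl_incr_ge0 t) => h th.
    have [mr mi _] := u2 _ th; have [mr' mi' _] := u2 _ t0; have [mr1 mi1 _] := v2 _ t0.
    split.
      rewrite (_ : (fun x => _) = fun x =>
          h^-1 * (complex.Re (u (t + h) x) - complex.Re (u t x)) - complex.Re (time_deriv u t x)).
        by apply: measurable_funB => //; apply: measurable_funM => //; exact: measurable_funB.
      by apply/funext => x; rewrite -![complex.Re _]/(component false _) componentB componentZ componentB.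
    rewrite (_ : (fun x => _) = fun x =>
        h^-1 * (complex.Im (u (t + h) x) - complex.Im (u t x)) - complex.Im (time_deriv u t x)).
      by apply: measurable_funB => //; apply: measurable_funM => //; exact: measurable_funB.
    by apply/funext => x; rewrite -![complex.Im _]/(component true _) componentB componentZ componentB.
  have r2 h : 0 <= t + h -> rL2 mu (fun x => h^-1 * (w (t + h) x - w t x)).
    by move=> th; apply: rL2Z; exact: rL2B (w2 _ th) (w2 _ t0).
  have f1 : (fun h => ip mu (fun x => component c (f h x)) phi) @ hl_incr t --> 0.
    apply: (ip_vanishes _ p2 _ f0).
    by apply: filterS (hl_incr_ge0 t) => h th; rewrite fE; exact: rL2B (r2 h th) (rv2 _ t0).
  have lim : (fun h => ip mu (fun x => component c (f h x)) phi + ip mu (v t) phi) @ hl_incr t -->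
      (0 + ip mu (v t) phi : R) by apply: cvgD => //; exact: cvg_cst.
  rewrite add0r in lim; apply: cvg_trans lim; apply: near_eq_cvg.
  apply: filterS (hl_incr_ge0 t) => h th; rewrite /= fE.
  rewrite (ipBl (r2 h th) (rv2 t t0) p2) subrK (ipZl _ (rL2B (w2 _ th) (w2 _ t0)) p2).
  by rewrite (ipBl (w2 _ th) (w2 _ t0) p2).
- pose P s := pairing (time_deriv u s) phi; pose Q := pairing (u t) (laplacian phi).
  have PE s : component c (P s) = ip mu (v s) phi by exact: component_pairing.
  have QE : component c Q = ip mu (w t) (laplacian phi) by exact: component_pairing.
  have q0 : (fun h => normc ((h^-1)%:C%C * (P (t + h) - P t) - (a t ^+ 2)%:C%C * Q))
    @ hl_incr t --> (0 : R) := weq phi tphi t t0.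
  move: P Q PE QE q0 => P Q PE QE q0.
  apply/subr_cvg0/norm_cvg0P; apply: (@squeeze_cvgr _ _ _ _ (fun=> 0) (fun h =>
    normc ((h^-1)%:C%C * (P (t + h) - P t) - (a t ^+ 2)%:C%C * Q))) => //; last exact: cvg_cst.
  near=> h; rewrite normr_ge0/=.
  apply: le_trans (component_le c _); rewrite componentB !componentZ componentB.
  by rewrite !PE QE.
Unshelve. all: by end_near. Qed.

(** One component of one partial derivative suffices; the energy itself may be
    infinite a priori, so the comparison is made in the extended reals. *)
Lemma energy_component_ge c lam t (j : 'I_n) : 0 <= t ->
  (((lam t ^+ 2 * ip mu (fun x => component c (grad (u t) j x)) (fun x => component c (grad (u t) j x)) +
    ip mu (fun x => component c (time_deriv u t x)) (fun x => component c (time_deriv u t x))) / 2)%:E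
   <= energy lam t u)%E.
Proof.
move=> t0; have [v2 _] := is_L2_derive_time_deriv t0.
have g2 i : isL2 (grad (u t) i) by have [] := weak_slope_grad c i t0.
have [mrv miv _] := v2.
have rv := rL2_integrable_sqr (rL2_component c v2).
have rg := rL2_integrable_sqr (rL2_component c (g2 j)).
set G := fun x => component c (grad (u t) j x) in rg *.
set V := fun x => component c (time_deriv u t x) in rv *.
have ig : mu.-integrable setT (EFin \o (fun x => lam t ^+ 2 * (G x * G x))).
  exact: (integrableZl measurableT (lam t ^+ 2) rg).
have iS : mu.-integrable setT (EFin \o (fun x => lam t ^+ 2 * (G x * G x) + V x * V x)).
  exact: (integrableD measurableT ig rv).
have -> : lam t ^+ 2 * ip mu G G + ip mu V V =
    \int[mu]_x (lam t ^+ 2 * (G x * G x) + V x * V x).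
  by rewrite RintegralD// RintegralZl.
rewrite mulrC EFinM /energy; apply: lee_wpmul2l; first by rewrite lee_fin invr_ge0.
rewrite /Rintegral fineK; last exact: integrable_fin_num.
apply: ge0_le_integral => //.
- by move=> x _; rewrite lee_fin -!expr2; apply: addr_ge0; [apply: mulr_ge0|]; exact: sqr_ge0.
- exact: measurable_int iS.
- apply/measurable_EFinP; apply: measurable_funD; last exact: measurable_normc_sqr.
  apply: measurable_funM => //; apply: measurable_sum => i.
  by have [mr mi _] := g2 i; exact: measurable_normc_sqr.
- move=> x _; rewrite lee_fin; apply: lerD.
    apply: ler_wpM2l; first exact: sqr_ge0.
    rewrite (bigD1 j)//= -expr2; apply: ler_wpDr; last exact: component_sqr_le.
    by apply: sumr_ge0 => i _; exact: sqr_ge0.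
  by rewrite -expr2; exact: component_sqr_le.
Qed.

End solution.

(** The initial velocity is [i u2], because [- i u_t = u2] initially. *)
Lemma initial_component {R : realType} {n : nat} (u1 u2 : 'rV[R]_n -> R[i]) :
  isL2 u1 -> isL2 u2 -> ~ (ae_zero u1 /\ ae_zero u2) ->
  exists c b, [/\ rL2 (lebesgue_rV R n) b, ~ {ae lebesgue_rV R n, forall x, b x = 0} &
    b = (fun x => component c (u1 x)) \/ b = (fun x => component c ('i%C * u2 x))].
Proof.
move=> u12 u22 u0.
have iu2 : isL2 (fun x => 'i%C * u2 x).
  have [mr mi foo] := u22; split.
  - rewrite (_ : (fun x => _) = fun x => - complex.Im (u2 x)); first exact: measurableT_comp.
    by apply/funext => x; case: (u2 x) => p q /=; rewrite mul0r mul1r sub0r.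
  - rewrite (_ : (fun x => _) = fun x => complex.Re (u2 x))//.
    by apply/funext => x; case: (u2 x) => p q /=; rewrite mul0r mul1r add0r.
  - rewrite (_ : L2_norm2 _ = L2_norm2 u2)//; apply: eq_integral => x _.
    rewrite !normc_sqr; congr (_%:E); case: (u2 x) => p q /=.
    by rewrite !mul0r !mul1r sub0r add0r sqrrN addrC.
have ex f : isL2 f -> ~ ae_zero f ->
    exists c, ~ {ae lebesgue_rV R n, forall x, component c (f x) = 0}.
  move=> f2 f0; apply: contrapT => h; apply: f0.
  have all0 c : {ae lebesgue_rV R n, forall x, component c (f x) = 0}.
    by apply: contrapT => hc; apply: h; exists c.
  rewrite /ae_zero; move: (all0 true) (all0 false); apply: filterS2 => x h1 h2.
  by apply: component_eq0; case.
have [z1|z1] := pselect (ae_zero u1); last first.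
  have [c hc] := ex _ u12 z1; exists c; eexists; split; [|exact: hc|by left].
  exact: rL2_component.
have z2 : ~ ae_zero (fun x => 'i%C * u2 x).
  move=> z2; apply: u0; split => //; apply: filterS z2 => x /eqP.
  rewrite mulf_eq0 => /orP[|/eqP//]; rewrite eq_complex/= oner_eq0 andbF//.
have [c hc] := ex _ iu2 z2; exists c; eexists; split; [|exact: hc|by right].
exact: rL2_component.
Qed.

(** * Lower bound of the energy *)

Theorem theorem3p2 (R : realType) (n m : nat) (n_gt0 : (0 < n)%N)
    (m_ge2 : (2 <= m)%N) (a lam omega Theta Xi : R -> R)
    (aCm : hl_Ck m a) (lamC2 : hl_Ck 2 lam)
    (aE : forall t, 0 <= t -> a t = lam t * omega t)
    (Theta_gt0 : forall t, 0 <= t -> 0 < Theta t)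
    (Xi_gt0 : forall t, 0 <= t -> 0 < Xi t)
    (hA1 : A1_plus lam) (hA2 : A2 omega) (hA3 : A3 lam omega Theta)
    (hA4 : A4 m a lam Theta Xi) (hA5 : A5 m lam Theta Xi)
    (u1 u2 : 'rV[R]_n -> R[i]) (u1H1 : isH1 u1) (u2L2 : isL2 u2)
    (data_neq0 : ~ (ae_zero u1 /\ ae_zero u2)) :
  exists C : R, 0 < C /\
    forall u : R -> 'rV[R]_n -> R[i], cauchy_solution a u1 u2 u ->
      forall t, 0 <= t -> ((C * lam t)%:E <= energy lam t u)%E.
Proof.
have [hA1' _] := hA1; have [u1L2 _] := u1H1.
have [_ ca] := aCm.
have lam0 := lam_gt0 hA1'.
have [c [b [b2 b0 data]]] := initial_component u1L2 u2L2 data_neq0.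
pose j0 := Ordinal n_gt0.
have low (d M : R) (d_gt0 : 0 < d) :=
  oscillator_energy_lower_bound M m_ge2 aCm lamC2 aE Xi_gt0 hA1' hA2 hA3 hA4 hA5 d_gt0.
have [C [C0 hC]] := wave_field_energy_lower_bound j0 lam0 (ca 0%N isT) low b2 b0.
exists (C / 2); split; first by rewrite divr_gt0.
move=> u [uc weq init0 init1] t t0.
apply: le_trans (energy_component_ge uc c lam j0 t0).
rewrite lee_fin mulrAC ler_pM2r ?invr_gt0//.
have [g2 slope] := weak_slope_grad uc c j0 t0.
apply: hC t0 (component_wave_field uc c weq) _ (rL2_component c g2) slope.
case: data => ->; [left|right].
  by apply: filterS init0 => x ->.
apply: filterS init1 => x <-; congr component.
by rewrite mulNr mulrN mulrA -expr2 sqr_i mulN1r opprK.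
Qed.
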